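(* Suppose the error assumptions (E1)–(E7) hold, the variances of the idiosyncratic innovations $\varepsilon_t^{(0,\nu)}$ are bounded uniformly in $t$, and $0<\liminf_{T}\lambda_{\min}(\Gamma_T^{(\nu)})<\limsup_T\lambda_{\max}(\Gamma_T^{(\nu)})<\infty$ for $\nu=1,\dots,d$. (i) If the regularization parameter $\lambda_T\ge0$ is non-random with $\lambda_T=o(1)$, then $\sqrt T(\widehat{\boldsymbol\beta}^{(R)}_{T\nu}-\boldsymbol\beta_\nu)$ is $\mathcal{AN}(\mathbf 0,\Sigma_{\mathbf x}^{-1}\Gamma_T^{(\nu)}\Sigma_{\mathbf x}^{-1})$ for $\nu=1,\dots,d$. (ii) If the regularization parameter $\lambda_T\ge0$ is random with $\mathbb E(\lambda_T^2)=o(1)$ as $T\to\infty$, then $\sqrt T(\widehat{\boldsymbol\beta}^{(R)}_{T\nu}-\boldsymbol\beta_\nu)$ is $\mathcal{AN}(\mathbf 0,\Sigma_{\mathbf x}^{-1}\Gamma_T^{(\nu)}\Sigma_{\mathbf x}^{-1})$ for $\nu=1,\dots,d$.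
   Context: Setting: regressors $\mathbf x_t\in\mathbb R^p$, spatial locations $\mathbf s_t\in[0,1]^q$, responses $Y_t^{(\nu)}=\mathbf x_t^\top\boldsymbol\beta_\nu+\epsilon_t^{(\nu)}$, $\nu=1,\dots,d$, $t=1,\dots,T$; probabilities are conditional on the regressors. $\mathbb X_T=(\mathbf x_1,\dots,\mathbf x_T)^\top$ full rank, $\mathbf Y_T^{(\nu)}=(Y_1^{(\nu)},\dots,Y_T^{(\nu)})^\top$, ridge estimator $\widehat{\boldsymbol\beta}^{(R)}_{T\nu}=(\mathbb X_T^\top\mathbb X_T+\lambda_T\mathbb I)^{-1}\mathbb X_T^\top\mathbf Y_T^{(\nu)}$. Standing regressor assumption (R): regressors bounded; there exist positive definite $\Sigma_{\mathbf x}$, $\eta\ge0$, $C<\infty$, compact interval $A\subset(0,\infty)$, independent of $T,p$, with $\|T^{-1}\sum_t\mathbf x_t\mathbf x_t^\top-\Sigma_{\mathbf x}\|_2\le Cp^\eta/\sqrt T$ and $\operatorname{spec}(T^{-1}\mathbb X_T^\top\mathbb X_T)\subset A$. $\Gamma_T^{(\nu)}=T^{-1}\sum_{s=1}^T\sum_{t=1}^T\mathbf x_s\mathbf x_t^\top\operatorname{Cov}(\epsilon_s^{(\nu)},\epsilon_t^{(\nu)})$. Asymptotic normality: $\mathbf Z_n$ is $\mathcal{AN}(\boldsymbol\mu_n,\Sigma_n)$ if for every $\mathbf a$ with $\mathbf a^\top\Sigma_n\mathbf a>0$ for all large $n$, $(\mathbf a^\top\mathbf Z_n-\mathbf a^\top\boldsymbol\mu_n)/(\mathbf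 a^\top\Sigma_n\mathbf a)^{1/2}\xrightarrow{d}\mathcal N(0,1)$. Error model: $\boldsymbol\epsilon_t=\mathbf H(\mathbf U_t(\mathbf s_t),\dots,\mathbf U_{t-m}(\mathbf s_t))-\mathbb E\,\mathbf H(\mathbf U_t(\mathbf s_t),\dots,\mathbf U_{t-m}(\mathbf s_t))$, $m\in\mathbb N_0$ fixed, $\mathbf H=(H_1,\dots,H_d):\mathbb R^{d\times(m+1)}\to\mathbb R^d$; the $\nu$th coordinate of $\mathbf U_t(\mathbf s)$ is $\sum_{\ell=1}^L\phi_{\nu\ell}d(\mathbf s,\mathbf r_\ell)F_t^{(\ell,\nu)}+E_t^{(\nu)}$ with fixed $L$, real $\phi_{\nu\ell}$, sites $\mathbf r_\ell\in[0,1]^q$, a function $d:[0,1]^q\times[0,1]^q\to[0,1]$, $\mathbf F_t^{(\ell)}=\sum_{j\ge0}\mathbb C_j^{(\ell)}\boldsymbol\varepsilon_{t-j}^{(\ell)}$, idiosyncratic noise $\mathbf E_t=\sum_{j\ge0}\mathbb C_j^{(0)}\boldsymbol\varepsilon_{t-j}^{(0)}$, $d\times d$ matrices $\mathbb C_j^{(\ell)}$ with rows $\mathbf c_j^{(\ell,\nu)\top}$; $\varepsilon_t^{(\ell,\nu)}$ is the $\nu$th coordinate of $\boldsymbol\varepsilon_t^{(\ell)}$. (E1) $\{\boldsymbol\varepsilon_t^{(\ell)}\}_t$, $\ell=0,\dots,L$, mutually independent sequences of independent mean zero vectors $\boldsymbol\varepsilon_t^{(\ell)}=\Sigma_{\varepsilon,t}^{(\ell)1/2}\mathbf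 u_t^{(\ell)}$, $\Sigma_{\varepsilon,t}^{(\ell)}$ symmetric positive definite, $\mathbf u_t^{(\ell)}$ mean zero with independent coordinates. (E2) $\sup_t\max_\ell\max_\nu\mathbb E|\varepsilon_t^{(\ell,\nu)}|^{2+\delta}<\infty$ for some $\delta>0$. (E3) If $d=1$: $\sup_t\max_\ell\mathbb E(\varepsilon_t^{(\ell)})^2<\infty$. (E4) If $d=1$: $\mathbb E(\varepsilon_t^{(0)})^2\ge\underline\sigma_0^2>0$; if $d>1$: $\lambda_{\min}(\Sigma_{\varepsilon,t}^{(0)})\ge\underline\lambda>0$. (E5) $\varepsilon_t^{(\ell,\nu)}$ has density $p_t^{(\ell,\nu)}$ with $\sup_t\int|p_t^{(\ell,\nu)}(z+x)-p_t^{(\ell,\nu)}(z)|dz=O(|x|)$. (E6) $\max_\ell\max_\nu\|\mathbf c_j^{(\ell,\nu)}\|_\infty\le C\max(j,1)^{-7/2-\theta}$, some $\theta>0$. (E7) each $H_\nu$ is $L_H$-Lipschitz w.r.t. the Frobenius norm, and some random $d\times(m+1)$ matrix $\Xi$ independent of $\{\mathbf U_t\}$ has $\sup_\nu\mathbb E|H_\nu(\Xi)|^{2+\delta}<\infty$. *)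

(* Defs.v *)
From HB Require Import structures.
From mathcomp Require Import all_boot all_order all_algebra.
From mathcomp Require Import all_classical all_reals all_analysis.
Set Implicit Arguments. Unset Strict Implicit. Unset Printing Implicit Defensive.
Import Order.TTheory GRing.Theory Num.Theory.
Import numFieldNormedType.Exports.
Local Open Scope classical_set_scope.
Local Open Scope ring_scope.

Section LinAlg.
Context {R : realType}.

Definition posdef n (A : 'M[R]_n) : Prop :=
  A^T = A /\ forall v : 'cV[R]_n, v != 0 -> 0 < (v^T *m A *m v) 0 0.

Definition psd n (A : 'M[R]_n) : Prop :=
  A^T = A /\ forall v : 'cV[R]_n, 0 <= (v^T *m A *m v) 0 0.

Definition lmin n (A : 'M[R]_n) : R := inf [set a | eigenvalue A a].
Definition lmax n (A : 'M[R]_n) : R := sup [set a | eigenvalue A a].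

Definition enorm n (v : 'cV[R]_n) : R := Num.sqrt (\sum_(i < n) v i 0 ^+ 2).

Definition opnorm m n (A : 'M[R]_(m, n)) : R :=
  sup [set enorm (A *m v) | v in [set v : 'cV[R]_n | enorm v <= 1]].

Definition frob m n (A : 'M[R]_(m, n)) : R :=
  Num.sqrt (\sum_(i < m) \sum_(j < n) A i j ^+ 2).

Definition rowsupnorm m n (A : 'M[R]_(m, n)) (i : 'I_m) : R :=
  \big[Num.max/0]_(j < n) `|A i j|.

Definition in_unit_cube q (s : 'rV[R]_q) : Prop :=
  forall i, 0 <= s 0 i <= 1.

End LinAlg.

Section Prob.
Context {R : realType} {dT : measure_display} {Omega : measurableType dT}
  (P : probability Omega R).

(* Mutual independence of a family (indexed by i : I) of collections G i of
   real random variables, i.e. independence of the sigma-algebras they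
   generate, stated as the product rule on the generating pi-systems
   (finite intersections of events {X in B}, X in G i, B Borel). *)
Definition mutual_indep (I : eqType) (G : I -> set (Omega -> R)) : Prop :=
  forall (s : seq I), uniq s ->
  forall (n : I -> nat) (X : I -> nat -> Omega -> R) (B : I -> nat -> set R),
    (forall i k, (k < n i)%N -> G i (X i k) /\ measurable (B i k)) ->
    fine (P (\bigcap_(i in [set` s]) \bigcap_(k in `I_(n i)) (X i k @^-1` B i k)))
    = \prod_(i <- s) fine (P (\bigcap_(k in `I_(n i)) (X i k @^-1` B i k))).

(* convergence in distribution of a sequence of real random variables to the
   standard normal law (convergence of the distribution functions at every
   point; every point is a continuity point of the limit) *)
Definition cvg_dist_std_normal (W : nat -> Omega -> R) : Prop :=
  forall y : R,
    (fun n => P [set w | W n w <= y]) @ \oo --> normal_prob 0 1 `]-oo, y].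

Definition asymp_normal p (Z : nat -> Omega -> 'cV[R]_p)
    (mu : nat -> 'cV[R]_p) (S : nat -> 'M[R]_p) : Prop :=
  forall a : 'cV[R]_p,
    (\forall n \near \oo, 0 < (a^T *m S n *m a) 0 0) ->
    cvg_dist_std_normal (fun n w =>
      ((a^T *m Z n w) 0 0 - (a^T *m mu n) 0 0) / Num.sqrt ((a^T *m S n *m a) 0 0)).

End Prob.

(*  time index t : nat, t = 0,1,... (t stands for the paper's t+1);   *)
(*  factor index l : 'I_L.+1, l = ord0 is the idiosyncratic noise E,  *)
(*  l = lift ord0 l' is the factor l'+1.                              *)
Section Model.
Context {R : realType} {dT : measure_display} {Omega : measurableType dT}
  (P : probability Omega R).
Context (p q d m L : nat).
Context (x : nat -> 'cV[R]_p)
        (s : nat -> 'rV[R]_q)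
        (beta : 'I_d -> 'cV[R]_p)
        (r : 'I_L -> 'rV[R]_q)
        (dist : 'rV[R]_q -> 'rV[R]_q -> R)
        (phi : 'I_d -> 'I_L -> R)
        (C : 'I_L.+1 -> nat -> 'M[R]_d)
        (inn : 'I_L.+1 -> int -> Omega -> 'cV[R]_d)
        (H : 'I_d -> 'M[R]_(d, m.+1) -> R).

Definition Flin (l : 'I_L.+1) (t : int) (nu : 'I_d) (w : Omega) : R :=
  limn (fun n => \sum_(0 <= j < n) (C l j *m inn l (t - j%:Z) w) nu 0).

Definition Ucoord (nu : 'I_d) (t : int) (loc : 'rV[R]_q) (w : Omega) : R :=
  \sum_(l < L) phi nu l * dist loc (r l) * Flin (lift ord0 l) t nu w
  + Flin ord0 t nu w.

Definition Umat (t : nat) (w : Omega) : 'M[R]_(d, m.+1) :=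
  \matrix_(nu < d, k < m.+1) Ucoord nu (t%:Z - k%:Z) (s t) w.

Definition err (nu : 'I_d) (t : nat) (w : Omega) : R :=
  H nu (Umat t w) - fine ('E_P[(fun w' => H nu (Umat t w'))%R])%E.

Definition XT (T : nat) : 'M[R]_(T, p) := \matrix_(t < T, i < p) x t i 0.

Definition YT (T : nat) (nu : 'I_d) (w : Omega) : 'cV[R]_T :=
  \col_(t < T) (((x t)^T *m beta nu) 0 0 + err nu t w).

Definition ridge (lam : R) (T : nat) (nu : 'I_d) (w : Omega) : 'cV[R]_p :=
  invmx ((XT T)^T *m XT T + lam%:M) *m (XT T)^T *m YT T nu w.

Definition Gamma (T : nat) (nu : 'I_d) : 'M[R]_p :=
  T%:R^-1 *: \sum_(t1 < T) \sum_(t2 < T)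
     fine (covariance P (err nu t1) (err nu t2)) *: (x t1 *m (x t2)^T).

Definition assumption_R (Sx : 'M[R]_p) : Prop :=
  (exists B : R, forall t i, `|x t i 0| <= B)
  /\ posdef Sx
  /\ (exists (eta Cst a b : R), 0 <= eta /\ 0 < a <= b /\
       (forall T, (0 < T)%N ->
          opnorm (T%:R^-1 *: (\sum_(t < T) x t *m (x t)^T) - Sx)
            <= Cst * p%:R `^ eta / Num.sqrt T%:R) /\
       (forall T, (0 < T)%N -> (p <= T)%N ->
          forall e, eigenvalue (T%:R^-1 *: ((XT T)^T *m XT T)) e -> a <= e <= b))
  /\ (forall T, (p <= T)%N -> \rank (XT T) = p).

Definition spatial_setting : Prop :=
  (forall t, in_unit_cube (s t)) /\ (forall l, in_unit_cube (r l)) /\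
  (forall s1 s2, in_unit_cube s1 -> in_unit_cube s2 -> 0 <= dist s1 s2 <= 1).

Definition E1 (Sig : 'I_L.+1 -> int -> 'M[R]_d) : Prop :=
  mutual_indep P (fun i : 'I_L.+1 * int =>
      [set X | exists nu : 'I_d, X = fun w => inn i.1 i.2 w nu ord0])
  /\ (forall l t nu, measurable_fun setT (fun w => inn l t w nu ord0)
                     /\ ('E_P[(fun w => inn l t w nu ord0)%R] = 0)%E)
  /\ (forall l t, posdef (Sig l t))
  /\ exists (u : 'I_L.+1 -> int -> Omega -> 'cV[R]_d)
            (Sroot : 'I_L.+1 -> int -> 'M[R]_d),
       forall l t,
         psd (Sroot l t) /\ Sroot l t *m Sroot l t = Sig l t
         /\ (forall w, inn l t w = Sroot l t *m u l t w)
         /\ (forall nu, measurable_fun setT (fun w => u l t w nu ord0)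
                        /\ ('E_P[(fun w => u l t w nu ord0)%R] = 0)%E)
         /\ mutual_indep P (fun nu : 'I_d => [set fun w => u l t w nu ord0]).

Definition E2 (delta : R) : Prop :=
  exists K : R, forall l t nu,
    ('E_P[(fun w => `|inn l t w nu ord0| `^ (2 + delta))%R] <= K%:E)%E.

Definition E3 : Prop :=
  d = 1%N -> exists K : R, forall l t nu,
    ('E_P[(fun w => inn l t w nu ord0 ^+ 2)%R] <= K%:E)%E.

Definition E4 (Sig : 'I_L.+1 -> int -> 'M[R]_d) : Prop :=
  (d = 1%N -> exists sigma0 : R, 0 < sigma0 /\ forall t nu,
      ((sigma0 ^+ 2)%:E <= 'E_P[(fun w => inn ord0 t w nu ord0 ^+ 2)%R])%E)
  /\ ((1 < d)%N -> exists lam0 : R, 0 < lam0 /\ forall t, lam0 <= lmin (Sig ord0 t)).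

Definition E5 : Prop :=
  exists dens : 'I_L.+1 -> int -> 'I_d -> R -> R,
    (forall l t nu z, 0 <= dens l t nu z)
    /\ (forall l t nu, measurable_fun setT (dens l t nu))
    /\ (forall l t nu (A : set R), measurable A ->
          P ((fun w => inn l t w nu ord0) @^-1` A)
          = (\int[lebesgue_measure]_(z in A) (dens l t nu z)%:E)%E)
    /\ (forall l nu, exists K c : R, 0 < c /\ forall t (y : R), `|y| < c ->
          (\int[lebesgue_measure]_z (`|dens l t nu (z + y) - dens l t nu z|)%:E
             <= (K * `|y|)%:E)%E).

Definition E6 : Prop :=
  exists (K theta : R), 0 < theta /\ forall l j nu,
    rowsupnorm (C l j) nu <= K * ((maxn j 1)%:R `^ (- (7 / 2) - theta)).

Definition E7 (delta : R) : Prop :=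
  (exists LH : R, forall nu (A B : 'M[R]_(d, m.+1)),
      `|H nu A - H nu B| <= LH * frob (A - B))
  /\ exists Xi : Omega -> 'M[R]_(d, m.+1),
       (forall i j, measurable_fun setT (fun w => Xi w i j))
       /\ mutual_indep P (fun b : bool =>
            if b then [set X | exists i j, X = fun w => Xi w i j]
            else [set X | exists nu t loc, in_unit_cube loc /\
                                  X = Ucoord nu t loc])
       /\ forall nu, ('E_P[(fun w => `|H nu (Xi w)| `^ (2 + delta))%R] < +oo)%E.

Definition bounded_idio_var : Prop :=
  exists K : R, forall t nu,
    (covariance P (fun w => inn ord0 t w nu ord0) (fun w => inn ord0 t w nu ord0)
       <= K%:E)%E.

Definition Gamma_eig_cond (nu : 'I_d) : Prop :=
  (0 < limn_einf (fun T => (lmin (Gamma T nu))%:E))%E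
  /\ (limn_einf (fun T => (lmin (Gamma T nu))%:E)
        < limn_esup (fun T => (lmax (Gamma T nu))%:E))%E
  /\ (limn_esup (fun T => (lmax (Gamma T nu))%:E) < +oo)%E.

End Model.

(* Main.v *)
Require Import Defs.
From HB Require Import structures.
From mathcomp Require Import all_boot all_order all_algebra.
From mathcomp Require Import all_classical all_reals all_analysis.
From mathcomp Require Import measurable_realfun lra ring zify.
Set Implicit Arguments. Unset Strict Implicit. Unset Printing Implicit Defensive.
Import Order.TTheory GRing.Theory Num.Theory.
Import numFieldNormedType.Exports.
Local Open Scope classical_set_scope.
Local Open Scope ring_scope.

(** The central limit theorem behind the statement is proved with Stein's
    method. For [y < z] the equation [g x - x * f x = h x - c], where [h] is
    piecewise linear between the indicators of [x <= y] and [x <= z], has an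
    explicit solution glued from pieces [(al + be * ncdf) / npdf + ga]; Mills'
    inequalities bound it together with the first-order Taylor remainder.
    The errors are approximated in L2, uniformly after normalisation of the
    sums, by bounded N-dependent variables: the linear processes are cut at lag
    [M] (increments in [M] are N-dependent, so that their sums have variance
    [O(T M / M^6)]) and the innovations are clipped, which needs the moments of
    order [2 + delta]. For bounded N-dependent sums [W], Stein's identity
    [E (W f(W)) = E W^2 * E g(W) + O(T^-1/2)] follows by removing the
    neighbourhood of one or two summands. Finally the ridge statistic is a
    linear statistic of the errors up to a term that vanishes in probability,
    and a deterministic regularisation is a special case of a random one. *)

(** * Stein's equation for the standard normal law *)

(** [Gamma] need not converge and the errors need not be stationary, so no limiting variance is
    available: the sums are normalised by their own exact standard deviation, and every
    approximation must be [O(T)] in mean square, uniformly over bounded weights. Approximating each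
    error separately in L2 would only give [O(T^2)]. The linear rate comes from the increments in
    the lag: the one at lag [k] has second moment of order [k^-6] and dependence range of order [k],
    so its weighted sum has variance of order [T k^-5], whose square roots are summable in [k].
    Smoothing the indicator into a piecewise linear [h] makes [g] Lipschitz, and expressing the
    derivative only through a Taylor remainder lets Stein's argument run across the kinks of [h]. A
    random regularisation is handled pointwise: the matrix estimates have constants uniform over
    parameters in [[0,1]], and the event that the parameter exceeds 1 is controlled by its second
    moment. *)

Section Calculus.
Context {R : realType}.
Implicit Types (f g h : R -> R) (a b c x y z K : R).

Lemma is_derive_MVT f df a b : (forall x, is_derive x 1 f (df x)) ->
  exists2 c, Num.min a b <= c <= Num.max a b & f b - f a = df c * (b - a).
Proof.
move=> fd.
have cf : continuous f.
  move=> x; apply/differentiable_continuous/derivable1_diffP.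
  exact: ex_derive.
have [ab|ba] := leP a b.
  have [c cab fab] := @MVT_segment _ f df a b ab (fun x _ => fd x)
    (continuous_subspaceT cf).
  exists c => //; by rewrite in_itv/= in cab.
have [c cab fab] := @MVT_segment _ f df b a (ltW ba) (fun x _ => fd x)
  (continuous_subspaceT cf).
exists c; first by rewrite in_itv/= in cab.
by rewrite -opprB fab; ring.
Qed.

(** Stands for [g] being the derivative of [f] and Lipschitz. Unlike a bound on a second derivative,
    it survives gluing at points where the second derivative jumps. *)
Definition taylor2 (D : set R) f g K :=
  forall a b, D a -> D b -> `|f b - f a - (b - a) * g a| <= K * (b - a) ^+ 2.

Lemma taylor2_derive (D : set R) f g g2 K :
  (forall x, is_derive x 1 f (g x)) -> (forall x, is_derive x 1 g (g2 x)) ->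
  (forall x y z, D x -> D y -> Num.min x y <= z <= Num.max x y -> D z) ->
  (forall x, D x -> `|g2 x| <= K) -> taylor2 D f g K.
Proof.
move=> df dg convD g2K a b Da Db.
have [c cab ->] := is_derive_MVT a b df.
have [e eac gg] := is_derive_MVT a c dg.
have -> : g c * (b - a) - (b - a) * g a = (g c - g a) * (b - a) by ring.
rewrite gg.
have De : D e by apply: (convD a c) => //; apply: (convD a b).
have ca : `|c - a| <= `|b - a|.
  move: cab; case: (lerP a b) => ab; move=> /andP[h1 h2].
    by rewrite !ger0_norm; lra.
  by rewrite !ler0_norm; lra.
rewrite !normrM expr2 -[_ * (b - a)]ger0_norm -?expr2 ?sqr_ge0// expr2 normrM.
rewrite mulrA ler_wpM2r// ler_pM// g2K//.
Qed.

Lemma taylor2_sub (D : set R) f g K K' : K <= K' -> taylor2 D f g K ->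
  taylor2 D f g K'.
Proof.
move=> KK' tf a b Da Db; apply: le_trans (tf _ _ Da Db) _.
by rewrite ler_wpM2r// sqr_ge0.
Qed.

Lemma taylor2_eq (D : set R) f g f' g' K :
  {in D, f =1 f'} -> {in D, g =1 g'} -> taylor2 D f g K -> taylor2 D f' g' K.
Proof.
by move=> ff gg tf a b Da Db; rewrite -!ff ?inE// -gg ?inE//; exact: tf.
Qed.

(** Adding the expansion at [a] and the expansion at [b] cancels the increments of [f]. *)
Lemma taylor2_lip (D : set R) f g K a b : taylor2 D f g K -> D a -> D b ->
  `|g b - g a| <= K *+ 2 * `|b - a|.
Proof.
move=> tf Da Db.
have [->|ab] := eqVneq a b; first by rewrite !subrr normr0 mulr0.
have ab0 : 0 < `|b - a| by rewrite normr_gt0 subr_eq0 eq_sym.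
have : `|(g b - g a) * (b - a)| <= K *+ 2 * (b - a) ^+ 2.
  have -> : (g b - g a) * (b - a) =
    - (f b - f a - (b - a) * g a) * (-1) + (f a - f b - (a - b) * g b) by ring.
  apply: le_trans (ler_normD _ _) _.
  rewrite mulrNN mulr1 mulrnAl mulr2n lerD// ?tf//.
  by rewrite (_ : (b - a) ^+ 2 = (a - b) ^+ 2); [exact: tf|ring].
by rewrite normrM -real_normK ?num_real// expr2 mulrA ler_pM2r.
Qed.

(** A pair on both sides of [y] is expanded in two steps [p] and [q] through [y]. The errors [K p^2]
    and [K q^2], and [2 K p q] from the Lipschitz bound on [g], add up to [K (p + q)^2], so the
    constant does not deteriorate. *)
Lemma taylor2_glue (D1 D2 : set R) f g K y :
  (forall x, D1 x -> x <= y) -> (forall x, D2 x -> y <= x) -> D1 y -> D2 y ->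
  taylor2 D1 f g K -> taylor2 D2 f g K -> taylor2 (D1 `|` D2) f g K.
Proof.
move=> le1 le2 y1 y2 t1 t2 a b.
have cross u v p q : p * q >= 0 -> `|f y - f u - p * g u| <= K * p ^+ 2 ->
    `|f v - f y - q * g y| <= K * q ^+ 2 ->
    `|g y - g u| <= K *+ 2 * `|p| ->
    `|f v - f u - (p + q) * g u| <= K * (p + q) ^+ 2.
  move=> pq h1 h2 h3.
  have -> : f v - f u - (p + q) * g u = (f y - f u - p * g u) +
    (f v - f y - q * g y) + q * (g y - g u) by ring.
  apply: le_trans (ler_normD _ _) _.
  apply: le_trans (lerD (ler_normD _ _) (lexx _)) _.
  have h4 : `|q * (g y - g u)| <= K *+ 2 * (p * q).
    rewrite normrM; apply: le_trans (ler_wpM2l (normr_ge0 _) h3) _.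
    rewrite mulrCA -normrM (mulrC q p) ger0_norm//.
  apply: le_trans (lerD (lerD h1 h2) h4) _.
  rewrite le_eqVlt; apply/orP; left; apply/eqP; ring.
case=> [a1|a2] [b1|b2]; [exact: t1| | |exact: t2].
- have -> : b - a = (y - a) + (b - y) by ring.
  apply: cross; [by rewrite mulr_ge0 ?subr_ge0 ?le1 ?le2| exact: t1|exact: t2|].
  exact: taylor2_lip t1 a1 y1.
- have -> : b - a = (y - a) + (b - y) by ring.
  apply: cross; [|exact: t2|exact: t1|].
    by rewrite mulr_le0 ?subr_le0 ?le1 ?le2.
  exact: taylor2_lip t2 a2 y2.
Qed.

(** The function is nondecreasing, so a negative value at [x] would keep it below that value all the
    way to the left, against the limit 0. *)
Lemma ge0_derive_cvgNy0 f df b : (forall x, x < b -> is_derive x 1 f (df x)) ->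
  (forall x, x < b -> 0 <= df x) -> f x @[x --> -oo] --> (0:R) ->
  forall x, x < b -> 0 <= f x.
Proof.
move=> fd df0 f0 x xb; rewrite leNgt; apply/negP => fx0.
have mono t : t < x -> f t <= f x.
  move=> tx.
  have inb u : u <= x -> u < b by move=> ux; apply: le_lt_trans ux xb.
  have [||u ux] := @MVT_segment _ f df t x (ltW tx).
  - by move=> u; rewrite in_itv/= => /andP[_ /ltW ux]; exact: fd (inb _ ux).
  - apply: derivable_within_continuous => u; rewrite in_itv/= => /andP[_ ux].
    by apply: ex_derive; exact: fd (inb _ ux).
  move/(congr1 (fun r => r + f t)); rewrite subrK => ->.
  rewrite lerDr mulr_ge0 ?subr_ge0 ?(ltW tx)// df0//.
  by move: ux; rewrite in_itv/= => /andP[_]; exact: inb.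
have /cvgrPdist_lt/(_ (- f x)) := f0; rewrite oppr_gt0 => /(_ fx0).
case=> M [_ hM].
pose t := Num.min (M - 1) (x - 1).
have tM : t < M by rewrite /t gt_min; apply/orP; (left + right); rewrite ltrBlDr ltrDl ltr01.
have tx : t < x by rewrite /t gt_min; apply/orP; (left + right); rewrite ltrBlDr ltrDl ltr01.
have := hM _ tM; rewrite sub0r normrN => h.
have := mono _ tx; move=> h2.
by move: h; rewrite ltr0_norm ?(le_lt_trans h2)//; lra.
Qed.

End Calculus.

(** * The standard normal density and distribution function *)

Section StdNormal.
Context {R : realType}.
Implicit Types (a b c x y z K : R).

Definition npdf (x : R) : R := normal_pdf 0 1 x.
Definition ncdf (x : R) : R := fine (normal_prob 0 1 `]-oo, x]).

Lemma npdfE x : npdf x = normal_peak 1 * expR (- (x ^+ 2 / 2)).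
Proof.
rewrite /npdf normal_pdfE ?oner_neq0// /normal_fun subr0 expr1n mulNr.
by rewrite -[1 *+ 2]/(2%:R).
Qed.

Lemma npdf_gt0 x : 0 < npdf x.
Proof. by rewrite npdfE mulr_gt0 ?expR_gt0// normal_peak_gt0 ?oner_neq0. Qed.

Lemma npdf_ge_sqr x y : x ^+ 2 <= y -> normal_peak 1 * expR (- (y / 2)) <= npdf x.
Proof.
move=> xy; rewrite npdfE ler_wpM2l ?normal_peak_ge0// ler_expR lerN2.
by rewrite ler_wpM2r// invr_ge0.
Qed.

Lemma npdf_decay x : npdf x * (1 + x ^+ 2) <= normal_peak 1 *+ 2.
Proof.
rewrite npdfE -mulrA -[leRHS]mulr_natr ler_wpM2l ?normal_peak_ge0//.
rewrite expRN mulrC ler_pdivrMr ?expR_gt0//.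
have := expR_ge1Dx (x ^+ 2 / 2); lra.
Qed.

Lemma npdfN x : npdf (- x) = npdf x.
Proof. by rewrite !npdfE sqrrN. Qed.

Lemma is_derive_npdf x : is_derive x 1 npdf (- x * npdf x).
Proof.
have -> : npdf = (fun x => normal_peak 1 * expR (- (x ^+ 2 / 2))).
  by apply/funext => t; rewrite npdfE.
have h : is_derive x 1 (fun t : R => - (t ^+ 2 / 2)) (- x).
  by apply: is_derive_eq; rewrite /GRing.scale/=; field.
have h2 := @is_derive1_comp _ expR (fun t : R => - (t ^+ 2 / 2)) x _ _
  (is_derive_expR _) h.
have h3 := is_deriveZ (normal_peak 1) h2.
by apply: is_derive_eq h3 _; rewrite /GRing.scale/=; ring.
Qed.

Lemma ncdf_ge0 x : 0 <= ncdf x. Proof. exact: fine_ge0. Qed.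

Lemma EFin_ncdf x : (ncdf x)%:E = normal_prob 0 1 `]-oo, x].
Proof. by rewrite /ncdf fineK// fin_num_measure. Qed.

Lemma ncdf_le1 x : ncdf x <= 1.
Proof. by rewrite -lee_fin EFin_ncdf probability_le1. Qed.

Lemma ncdf_nondecreasing x y : x <= y -> ncdf x <= ncdf y.
Proof.
move=> xy; rewrite -lee_fin !EFin_ncdf le_measure ?inE//.
exact: subset_itvl.
Qed.

Lemma is_derive_ncdf x : is_derive x 1 ncdf (npdf x).
Proof.
have xx1 : x < x + 1 by rewrite ltrDl.
have ip : lebesgue_measure.-integrable `]-oo, x + 1] (EFin \o npdf).
  exact: integrableS (integrable_normal_pdf 0 1).
have cp : {for x, continuous npdf} by apply: continuous_normal_pdf; exact: oner_neq0.
have [h1 h2] := continuous_FTC1 xx1 ip (ltNyr x) cp.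
split => //.
by rewrite -h2 derive1E.
Qed.

(** The identity, seen as a random variable under the normal law, has [ncdf] as its distribution
    function; this gives the limits of [ncdf] at both infinities. *)
Let idTR : measurableTypeR R -> R := idfun.

#[local] HB.instance Definition _ :=
  @isMeasurableFun.Build _ _ _ _ idTR (@measurable_id _ _ setT).

Lemma cvg_ncdfNy : ncdf x @[x --> -oo] --> (0 : R).
Proof.
have /fine_cvgP[_ h] := @cvg_cdfNy0 _ _ _ (normal_prob 0 1) idTR.
exact: h.
Qed.

Lemma cvg_ncdfy : ncdf x @[x --> +oo] --> (1 : R).
Proof.
have /fine_cvgP[_ h] := @cvg_cdfy1 _ _ _ (normal_prob 0 1) idTR.
exact: h.
Qed.

Lemma cvg_npdf_divNy (k : R) (u : R -> R) :
  (forall x, x < -1 -> `|u x| <= k) -> (npdf x * u x) @[x --> -oo] --> (0 : R).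
Proof.
move=> uk.
pose C := normal_peak 1 *+ 2 * `|k| : R.
have C0 : 0 <= C by rewrite mulr_ge0// mulrn_wge0// normal_peak_ge0.
have bnd x : x < -1 -> `|npdf x * u x| <= C / `|x|.
  move=> x1; rewrite normrM (gtr0_norm (npdf_gt0 x)).
  have nx1 : 1 < `|x| by rewrite ltr0_norm; lra.
  rewrite ler_pdivlMr; last lra.
  rewrite mulrAC ler_pM ?mulr_ge0 ?(ltW (npdf_gt0 _))//.
    apply: le_trans (npdf_decay x); rewrite ler_wpM2l ?(ltW (npdf_gt0 _))//.
    by rewrite -real_normK ?num_real//; nra.
  by apply: le_trans (uk _ x1) _; exact: ler_norm.
apply/cvgrPdist_le => e e0.
exists (Num.min (-1) (- (C / e))); split => [|x]; first exact: num_real.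
rewrite lt_min => /andP[x1 xC]; rewrite sub0r normrN.
apply: le_trans (bnd _ x1) _.
rewrite ler0_norm; last lra.
rewrite ler_pdivrMr; last lra.
by move: xC; rewrite ltrNr ltr_pdivrMr// => /ltW; rewrite mulrC.
Qed.

(** * Mills' inequalities for the lower tail *)

Section Mills.
Variable ps : R -> R.
Hypothesis dps : forall x, is_derive x 1 ps (npdf x).
Hypothesis ps0 : ps x @[x --> -oo] --> (0 : R).
Hypothesis ps_ge0 : forall x, 0 <= ps x.
Hypothesis ps_le1 : forall x, ps x <= 1.

(** The difference of the two sides vanishes at [-oo] and has derivative [npdf x / x ^+ 2]. The
    function [ps] is abstract because it is used both as [ncdf] and as the reflected upper tail
    [1 - ncdf (- x)]. *)
Lemma mills_ub x : x < 0 -> ps x <= npdf x / - x.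
Proof.
move=> x0; rewrite -subr_ge0.
pose F (x : R) := npdf x / - x - ps x.
apply: (@ge0_derive_cvgNy0 _ F (fun x => npdf x / x ^+ 2) 0) => //.
- move=> t t0.
  have nt0 : - t != 0 by rewrite oppr_eq0 lt_eqF.
  have h1 := is_derive_npdf t.
  have hN : is_derive t 1 (fun x : R => - x) (- 1) by apply: is_derive_eq.
  have h2 := @is_deriveV _ (fun x : R => - x) t _ 1 nt0 hN.
  have h3 := is_deriveM h1 h2.
  have h4 := is_deriveB h3 (dps t).
  apply: is_derive_eq h4 _; rewrite /GRing.scale/=; field.
  by rewrite lt_eqF.
- by move=> t _; rewrite divr_ge0 ?(ltW (npdf_gt0 _))// sqr_ge0.
- rewrite -(subr0 (0 : R)); apply: cvgB ps0.
  apply: (@cvg_npdf_divNy 1) => t t1.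
  rewrite normfV normrN ler0_norm; last lra.
  by rewrite invf_le1; lra.
Qed.

(** Same argument; the derivative of the difference is [2 npdf x / (1 + x^2)^2]. *)
Lemma mills_lb x : x < 0 -> npdf x * (- x / (1 + x ^+ 2)) <= ps x.
Proof.
move=> x0; rewrite -subr_ge0.
pose F (x : R) := ps x - npdf x * (- x / (1 + x ^+ 2)).
apply: (@ge0_derive_cvgNy0 _ F (fun x => npdf x * (2 / (1 + x ^+ 2) ^+ 2)) 0) => //.
- move=> t t0.
  have nt0 : 1 + t ^+ 2 != 0 by rewrite gt_eqF// ltr_pwDl// sqr_ge0.
  have h1 := is_derive_npdf t.
  have hD : is_derive t 1 (fun x : R => 1 + x ^+ 2) (2 * t).
    by apply: is_derive_eq; rewrite /GRing.scale/=; ring.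
  have h2 := @is_deriveV _ (fun x : R => 1 + x ^+ 2) t _ 1 nt0 hD.
  have hN : is_derive t 1 (fun x : R => - x) (- 1) by apply: is_derive_eq.
  have h3 := is_deriveM h1 (is_deriveM hN h2).
  have h4 := is_deriveB (dps t) h3.
  apply: is_derive_eq h4 _; rewrite /GRing.scale/= fctE; field.
  exact: nt0.
- by move=> t _; rewrite mulr_ge0 ?(ltW (npdf_gt0 _))// divr_ge0// sqr_ge0.
- rewrite -(subr0 (0 : R)); apply: cvgB => //.
  apply: (@cvg_npdf_divNy 1) => t t1.
  rewrite normrM normfV normrN ler0_norm; last lra.
  rewrite ger0_norm ?addr_ge0 ?sqr_ge0//.
  by rewrite ler_pdivrMr ?ltr_pwDl ?sqr_ge0//; nra.
Qed.

(** The three quantities are [q = ps / npdf] and its first two derivatives, since [q' = 1 + x q].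
    For [x <= -1] the upper inequality says [0 <= q'] and the lower one [0 <= q''], which also
    yields upper bounds. On the rest, [x ^+ 2 <= 1 + y ^+ 2] keeps the density away from 0, whence
    the constant [k]. *)
Lemma mills_bounded y : exists K : R, forall x, x <= y ->
  [/\ `|ps x / npdf x| <= K, `|1 + x * (ps x / npdf x)| <= K &
      `|ps x / npdf x + x * (1 + x * (ps x / npdf x))| <= K].
Proof.
pose k := (normal_peak 1 * expR (- ((1 + y ^+ 2) / 2)))^-1 : R.
have k0 : 0 < k by rewrite invr_gt0 mulr_gt0 ?expR_gt0// normal_peak_gt0// oner_neq0.
pose X := 1 + `|y| : R.
exists (1 + k + X * (1 + X * k) + (1 + X * k)) => x xy.
set q := ps x / npdf x.
have q0 : 0 <= q by rewrite divr_ge0// ltW// npdf_gt0.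
have X0 : 0 <= X by rewrite addr_ge0.
have [x1|x1] := leP x (-1).
  have x0 : x < 0 by lra.
  have ub := mills_ub x0; have lb := mills_lb x0.
  have qx : q * - x <= 1.
    rewrite /q mulrAC ler_pdivrMr ?npdf_gt0// mul1r.
    by rewrite -ler_pdivlMr// oppr_gt0.
  have sx : 0 < 1 + x ^+ 2 by rewrite ltr_pwDl ?sqr_ge0.
  have qx2 : - x <= q * (1 + x ^+ 2).
    rewrite /q mulrAC ler_pdivlMr ?npdf_gt0// mulrC -ler_pdivrMr//.
    by rewrite -mulrA.
  have q1 : q <= 1 by nra.
  have Xk : 0 <= X * k by rewrite mulr_ge0// ltW.
  have XXk : 0 <= X * (1 + X * k) by rewrite mulr_ge0// addr_ge0.
  have p1 : 0 <= 1 + x * q by lra.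
  have p2 : 0 <= q + x * (1 + x * q).
    by rewrite (_ : _ + _ = q * (1 + x ^+ 2) + x); [lra|ring].
  split; rewrite ger0_norm//; [lra|nra|].
  have : x * (1 + x * q) <= 0 by rewrite mulr_le0_ge0// ltW.
  lra.
have x2 : x ^+ 2 <= 1 + y ^+ 2.
  have [?|?] := leP 0 x; last by nra.
  by nra.
have qk : q <= k.
  rewrite /q ler_pdivrMr ?npdf_gt0//; apply: le_trans (ps_le1 x) _.
  by rewrite mulrC ler_pdivlMr ?mulr_gt0 ?expR_gt0 ?normal_peak_gt0 ?oner_neq0// mul1r npdf_ge_sqr.
have xX : `|x| <= X.
  rewrite ler_norml /X; have := ler_norm y; have := normr_ge0 y => *; lra.
have h1 : `|q| <= k by rewrite ger0_norm.
have h2 : `|1 + x * q| <= 1 + X * k.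
  apply: le_trans (ler_normD _ _) _; rewrite normr1 lerD2l normrM ler_pM//.
have h3 : `|x * (1 + x * q)| <= X * (1 + X * k).
  by rewrite normrM ler_pM.
have a1 : 0 <= X * k by rewrite mulr_ge0// ltW.
have a2 : 0 <= X * (1 + X * k) by rewrite mulr_ge0// addr_ge0.
split; [lra|lra|].
apply: le_trans (ler_normD _ _) _; lra.
Qed.

End Mills.

End StdNormal.

(** * Explicit bounded solutions of Stein's equation *)

Section SteinSolution.
Context {R : realType}.
Implicit Types (a b c x y z K : R).

(** General solution of [F' - x F = be - ga x]: the right-hand side covers every affine piece of
    [h - c], and [al] is the integration constant left for gluing. *)
Definition stein_piece (al be ga : R) (x : R) : R :=
  (al + be * ncdf x) / npdf x + ga.

Lemma is_derive_stein_piece al be ga x :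
  is_derive x 1 (stein_piece al be ga) (x * stein_piece al be ga x + be - ga * x).
Proof.
have n0 : npdf x != 0 by rewrite gt_eqF ?npdf_gt0.
have h1 : is_derive x 1 (fun x => al + be * ncdf x) (be * npdf x).
  have h0 := is_derive_ncdf x.
  by apply: is_derive_eq; rewrite /GRing.scale/=; ring.
have h2 := @is_deriveV _ _ _ _ _ n0 (is_derive_npdf x).
have h3 := is_deriveD (is_deriveM h1 h2) (is_derive_cst ga x 1).
apply: is_derive_eq h3 _; rewrite /stein_piece /GRing.scale/=; field.
exact: n0.
Qed.

Lemma is_derive2_stein_piece al be ga x :
  is_derive x 1 (fun x => x * stein_piece al be ga x + be - ga * x)
   (stein_piece al be ga x + x * (x * stein_piece al be ga x + be - ga * x) - ga).
Proof.
have h := is_derive_stein_piece al be ga x.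
by apply: is_derive_eq; rewrite /GRing.scale/=; ring.
Qed.

Lemma stein_piece_taylor2 (D : set R) al be ga K :
  (forall x y z, D x -> D y -> Num.min x y <= z <= Num.max x y -> D z) ->
  (forall x, D x -> `|stein_piece al be ga x +
     x * (x * stein_piece al be ga x + be - ga * x) - ga| <= K) ->
  taylor2 D (stein_piece al be ga)
    (fun x => x * stein_piece al be ga x + be - ga * x) K.
Proof.
move=> cD bK.
exact: (taylor2_derive (is_derive_stein_piece al be ga)
  (is_derive2_stein_piece al be ga) cD bK).
Qed.

Lemma stein_piece_left c y : exists K : R, forall x, x <= y ->
  let F := stein_piece 0 c 0 in
  [/\ `|F x| <= K, `|x * F x + c| <= K & `|F x + x * (x * F x + c)| <= K].
Proof.
have [K hK] := mills_bounded is_derive_ncdf cvg_ncdfNy ncdf_ge0 ncdf_le1 y.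
exists (`|c| * K) => x xy F.
have [h1 h2 h3] := hK x xy.
have FE : F x = c * (ncdf x / npdf x).
  by rewrite /F /stein_piece add0r addr0 mulrA.
rewrite FE; split.
- by rewrite normrM ler_wpM2l.
- rewrite (_ : _ + c = c * (1 + x * (ncdf x / npdf x))); last by ring.
  by rewrite normrM ler_wpM2l.
- set q := ncdf x / npdf x in h1 h2 h3 *.
  rewrite [X in `|X|](_ : _ = c * (q + x * (1 + x * q))); last by ring.
  by rewrite normrM ler_wpM2l.
Qed.

(** The reflection [x -> - x] turns the upper tail into the function [ps], to which the lower tail
    bounds apply. *)
Lemma stein_piece_right c z : exists K : R, forall x, z <= x ->
  let F := stein_piece c (- c) 0 in
  [/\ `|F x| <= K, `|x * F x - c| <= K & `|F x + x * (x * F x - c)| <= K].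
Proof.
pose ps x := 1 - ncdf (- x) : R.
have dps x : is_derive x 1 ps (npdf x).
  have hN : is_derive x 1 (fun x : R => - x) (- 1) by apply: is_derive_eq.
  have h := @is_derive1_comp _ ncdf (fun x : R => - x) x _ _ (is_derive_ncdf _) hN.
  have h2 := is_deriveB (is_derive_cst (1 : R) x 1) h.
  by apply: is_derive_eq h2 _; rewrite npdfN; ring.
have ps0 : ps x @[x --> -oo] --> (0 : R).
  rewrite -(subrr (1 : R)); apply: cvgB; first exact: cvg_cst.
  by apply/(cvgy_compNP ncdf); exact: cvg_ncdfy.
have [K hK] := mills_bounded dps ps0 (fun x => ltac:(by rewrite subr_ge0 ncdf_le1))
  (fun x => ltac:(by rewrite gerBl ncdf_ge0)) (- z).
exists (`|c| * K) => x xy F.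
have [h1 h2 h3] := hK (- x) (ltac:(by rewrite lerN2)).
have FE : F x = c * (ps (- x) / npdf (- x)).
  by rewrite /F /stein_piece /ps addr0 opprK npdfN; ring.
set q := ps (- x) / npdf (- x) in FE h1 h2 h3 *.
rewrite FE; split.
- by rewrite normrM ler_wpM2l.
- rewrite (_ : _ - c = - c * (1 + - x * q)); last by ring.
  by rewrite normrM normrN ler_wpM2l.
- rewrite [X in `|X|](_ : _ = c * (q + - x * (1 + - x * q))); last by ring.
  by rewrite normrM ler_wpM2l.
Qed.

Lemma stein_piece_mid al be ga y z : exists K : R, forall x, y <= x <= z ->
  let F := stein_piece al be ga in
  [/\ `|F x| <= K, `|x * F x + be - ga * x| <= K &
      `|F x + x * (x * F x + be - ga * x) - ga| <= K].
Proof.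
pose k := (normal_peak 1 * expR (- ((y ^+ 2 + z ^+ 2) / 2)))^-1 : R.
have k0 : 0 < k by rewrite invr_gt0 mulr_gt0 ?expR_gt0// normal_peak_gt0// oner_neq0.
pose B := (`|al| + `|be|) * k + `|ga| : R.
pose X := `|y| + `|z| : R.
have B0 : 0 <= B by rewrite addr_ge0// mulr_ge0// ?ltW// addr_ge0.
have X0 : 0 <= X by rewrite addr_ge0.
pose B1 := X * B + `|be| + `|ga| * X.
have B10 : 0 <= B1 by rewrite !addr_ge0// mulr_ge0.
pose B2 := B + X * B1 + `|ga|.
have XB1 : 0 <= X * B1 by rewrite mulr_ge0.
exists (B + B1 + B2) => x /andP[yx xz] F.
have x2 : x ^+ 2 <= y ^+ 2 + z ^+ 2.
  have [?|?] := leP 0 x; nra.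
have xX : `|x| <= X.
  rewrite ler_norml /X; have := ler_norm z; have := ler_norm (- y).
  by rewrite normrN; have := normr_ge0 y; have := normr_ge0 z => *; lra.
have FB : `|F x| <= B.
  apply: le_trans (ler_normD _ _) _; rewrite lerD2r normrM ler_pM//.
    apply: le_trans (ler_normD _ _) _; rewrite lerD2l normrM ler_piMr//.
    by rewrite ger0_norm ?ncdf_ge0 ?ncdf_le1.
  rewrite normfV gtr0_norm ?npdf_gt0// /k lef_pV2 ?posrE ?npdf_gt0//.
    exact: npdf_ge_sqr.
  by rewrite mulr_gt0 ?expR_gt0// normal_peak_gt0// oner_neq0.
have FB1 : `|x * F x + be - ga * x| <= B1.
  apply: le_trans (ler_normB _ _) _; apply: lerD.
    by apply: le_trans (ler_normD _ _) _; rewrite lerD2r normrM ler_pM.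
  by rewrite normrM ler_wpM2l.
have FB2 : `|F x + x * (x * F x + be - ga * x) - ga| <= B2.
  apply: le_trans (ler_normB _ _) _; rewrite lerD2r.
  apply: le_trans (ler_normD _ _) _; apply: lerD => //.
  by rewrite normrM ler_pM.
have B20 : 0 <= B2 by rewrite /B2 (addr_ge0 (addr_ge0 B0 XB1)).
by split; lra.
Qed.

(** On the outer pieces the integration constants are forced by boundedness at infinity, on the
    middle piece [al] by continuity at [y]. Continuity at [z] is then a condition on [c], met
    exactly when [c] is the normal mean of [h]. *)
Lemma stein_solution y z : y < z -> exists (f g : R -> R) (c K : R),
  [/\ ncdf y <= c <= ncdf z,
      (forall x, `|f x| <= K), (forall x, `|g x| <= K),
      taylor2 setT f g K &
      forall x, (x <= y)%R%:R <= c + g x - x * f x <= (x <= z)%R%:R].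
Proof.
move=> yz.
have e0 : 0 < z - y by rewrite subr_gt0.
have en0 : z - y != 0 by rewrite gt_eqF.
(* An antiderivative of [ncdf]. The normal mean [c] of [h] is the average of [ncdf] over [[y, z]],
   so the mean value theorem puts it between [ncdf y] and [ncdf z]. *)
pose A x := x * ncdf x + npdf x : R.
have dA x : is_derive x 1 A (ncdf x).
  have h0 := is_derive_ncdf x; have h1 := is_derive_npdf x.
  by apply: is_derive_eq; rewrite /GRing.scale/=; ring.
pose c := (A z - A y) / (z - y).
have cyz : ncdf y <= c <= ncdf z.
  have [u] := is_derive_MVT y z dA.
  rewrite min_l ?max_r ?(ltW yz)// => /andP[yu uz] Au.
  by rewrite /c Au mulfK// !ncdf_nondecreasing.
pose ga := (z - y)^-1.
pose be := z * ga - c.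
pose al := (1 - c) * ncdf y - be * ncdf y - ga * npdf y.
pose f1 := stein_piece 0 (1 - c) 0.
pose f2 := stein_piece al be ga.
pose f3 := stein_piece c (- c) 0.
have py := npdf_gt0 y; have pz := npdf_gt0 z.
have f12 : f1 y = f2 y.
  rewrite /f1 /f2 /stein_piece /al; field.
  by rewrite gt_eqF.
(* No free constant is left here; the equality unfolds to the definition of [c]. *)
have f23 : f2 z = f3 z.
  rewrite /f3 /f2 /stein_piece /al /be /ga /c /A; field.
  by rewrite en0 gt_eqF.
pose f x := if x <= y then f1 x else if x <= z then f2 x else f3 x.
pose h x := if x <= y then 1 else if x <= z then (z - x) * ga else 0.
pose g x := x * f x + h x - c.
have [K1 hK1] := stein_piece_left (1 - c) y.
have [K2 hK2] := stein_piece_mid al be ga y z.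
have [K3 hK3] := stein_piece_right c z.
pose K := `|K1| + `|K2| + `|K3|.
have K1K : K1 <= K by have := ler_norm K1; have := normr_ge0 K2; have := normr_ge0 K3; rewrite /K => *; lra.
have K2K : K2 <= K by have := ler_norm K2; have := normr_ge0 K1; have := normr_ge0 K3; rewrite /K => *; lra.
have K3K : K3 <= K by have := ler_norm K3; have := normr_ge0 K2; have := normr_ge0 K1; rewrite /K => *; lra.
have fE2 x : y <= x <= z -> f x = f2 x.
  move=> /andP[yx xz]; rewrite /f xz; case: ifP => // xy.
  by have -> : x = y by apply/eqP; rewrite eq_le xy yx.
have fE3 x : z <= x -> f x = f3 x.
  move=> zx; rewrite /f leNgt (lt_le_trans yz zx)/=; case: ifP => // xz.
  by have -> : x = z by apply/eqP; rewrite eq_le xz zx.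
have hE2 x : y <= x <= z -> h x = (z - x) * ga.
  move=> /andP[yx xz]; rewrite /h xz; case: ifP => // xy.
  have -> : x = y by apply/eqP; rewrite eq_le xy yx.
  by rewrite mulfV.
have hE3 x : z <= x -> h x = 0.
  move=> zx; rewrite /h leNgt (lt_le_trans yz zx)/=; case: ifP => // xz.
  by have -> : x = z; [apply/eqP; rewrite eq_le xz zx|rewrite subrr mul0r].
have gE1 x : x <= y -> g x = x * f1 x + (1 - c) - 0 * x.
  by move=> xy; rewrite /g /f /h xy; ring.
have gE2 x : y <= x <= z -> g x = x * f2 x + be - ga * x.
  by move=> xy; rewrite /g fE2// hE2// /be; ring.
have gE3 x : z <= x -> g x = x * f3 x + (- c) - 0 * x.
  by move=> xy; rewrite /g fE3// hE3//; ring.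
exists f, g, c, K; split => //.
- move=> x; have [xy|yx] := leP x y.
    by rewrite /f xy; have [+ _ _] := hK1 x xy; lra.
  have [xz|zx] := leP x z.
    rewrite fE2 ?(ltW yx)//; have [|+ _ _] := hK2 x; first by rewrite (ltW yx).
    by rewrite -/f2; lra.
  by rewrite fE3 ?(ltW zx)//; have [+ _ _] := hK3 x (ltW zx); rewrite -/f3; lra.
- move=> x; have [xy|yx] := leP x y.
    by rewrite gE1// mul0r subr0; have [_ + _] := hK1 x xy; rewrite -/f1; lra.
  have [xz|zx] := leP x z.
    rewrite gE2 ?(ltW yx)//; have [|_ + _] := hK2 x; first by rewrite (ltW yx).
    by rewrite -/f2; lra.
  by rewrite gE3 ?(ltW zx)// mul0r subr0; have [_ + _] := hK3 x (ltW zx); rewrite -/f3; lra.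
- pose D1 := [set x | x <= y]; pose D2 := [set x | y <= x <= z]; pose D3 := [set x | z <= x].
  have -> : [set: R] = (D1 `|` D2) `|` D3.
    apply/seteqP; split => // x _; rewrite /D1 /D2 /D3 /=.
    have [xy|yx] := leP x y; first by left; left.
    by have [xz|zx] := leP x z; [left; right; rewrite (ltW yx)|right; rewrite ltW].
  have conv1 x x' t : D1 x -> D1 x' -> Num.min x x' <= t <= Num.max x x' -> D1 t.
    rewrite /D1/= => h1 h2 /andP[_ h3]; apply: le_trans h3 _.
    by rewrite ge_max h1 h2.
  have conv3 x x' t : D3 x -> D3 x' -> Num.min x x' <= t <= Num.max x x' -> D3 t.
    rewrite /D3/= => h1 h2 /andP[h3 _]; apply: le_trans h3.
    by rewrite le_min h1 h2.
  have conv2 x x' t : D2 x -> D2 x' -> Num.min x x' <= t <= Num.max x x' -> D2 t.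
    rewrite /D2/= => /andP[h1 h2] /andP[h3 h4] /andP[h5 h6]; apply/andP; split.
      by apply: le_trans h5; rewrite le_min h1 h3.
    by apply: le_trans h6 _; rewrite ge_max h2 h4.
  apply: (taylor2_glue (y := z)) => //.
  + by move=> x; rewrite /D1 /D2/= => -[/le_trans->//|/andP[]//]; exact: ltW.
  + by right; rewrite /D2/= (ltW yz) lexx.
  + by rewrite /D3/=.
  + apply: (taylor2_glue (y := y)) => //.
    * by move=> x /andP[].
    * by rewrite /D1/=.
    * by rewrite /D2/= (ltW yz) lexx.
    * apply: (taylor2_eq (f := f1) (g := fun x => x * f1 x + (1 - c) - 0 * x)).
      - by move=> x; rewrite inE /D1/= /f => ->.
      - by move=> x; rewrite inE /D1/= => /gE1 ->.
      - apply: taylor2_sub K1K _; apply: stein_piece_taylor2 => // x xy.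
        by rewrite mul0r !subr0; have [_ _] := hK1 x xy.
    * apply: (taylor2_eq (f := f2) (g := fun x => x * f2 x + be - ga * x)).
      - by move=> x; rewrite inE /D2/= => /fE2 ->.
      - by move=> x; rewrite inE /D2/= => /gE2 ->.
      - apply: taylor2_sub K2K _; apply: stein_piece_taylor2 => // x xy.
        by have [_ _] := hK2 x xy.
  + apply: (taylor2_eq (f := f3) (g := fun x => x * f3 x + - c - 0 * x)).
    - by move=> x; rewrite inE /D3/= => /fE3 ->.
    - by move=> x; rewrite inE /D3/= => /gE3 ->.
    - apply: taylor2_sub K3K _; apply: stein_piece_taylor2 => // x xy.
      by rewrite mul0r !subr0; have [_ _] := hK3 x xy.
- move=> x; have -> : c + g x - x * f x = h x by rewrite /g; ring.
  rewrite /h; case: ifP => xy; first by rewrite (le_trans xy (ltW yz)) !lexx.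
  case: ifP => xz; last by rewrite !lexx.
  move/negbT: xy; rewrite -ltNge => yx.
  by rewrite mulr_ge0 ?subr_ge0 ?invr_ge0 ?(ltW e0)//= ler_pdivrMr// mul1r lerD2l lerN2 ltW.
Qed.

End SteinSolution.

(** * Independence and expectations *)

Section PiIndep.
Context {R : realType} {dT : measure_display} {Omega : measurableType dT}
  (P : probability Omega R).
Local Open Scope ereal_scope.

(** For fixed [F], the finite measures [P (E]&[F)] and [P F] times [P E] agree on a pi-system
    containing the whole space, hence on the sigma-algebra it generates. *)
Let indep_pi1 (G : set (set Omega)) (F : set Omega) :
  G `<=` measurable -> setI_closed G -> G setT -> measurable F ->
  (forall E, G E -> P (E `&` F) = P E * P F) ->
  forall E, <<s G >> E -> P (E `&` F) = P E * P F.
Proof.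
move=> Gm GI GT mF PG E sE.
have rE : P F = (NngNum (fine_ge0 (measure_ge0 P F)))%:num%:E.
  by rewrite /= fineK// fin_num_measure.
rewrite muleC rE.
have := @g_sigma_algebra_measure_unique _ _ _ G Gm (fun=> setT) (fun=> GT) _
  (mrestr P mF) (mscale (NngNum (fine_ge0 (measure_ge0 P F))) P) GI _ _ E sE.
apply.
- by apply/seteqP; split => // x _; exists 0%N.
- by move=> A GA; rewrite /= /mrestr /mscale/= PG// muleC fineK ?fin_num_measure.
- move=> k; rewrite /= /mrestr setTI.
  by rewrite (le_lt_trans (probability_le1 P mF))// ltry.
Qed.

Lemma indep_pi (G1 G2 : set (set Omega)) :
  G1 `<=` measurable -> G2 `<=` measurable ->
  setI_closed G1 -> setI_closed G2 -> G1 setT -> G2 setT ->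
  (forall E F, G1 E -> G2 F -> P (E `&` F) = P E * P F) ->
  forall E F, <<s G1 >> E -> <<s G2 >> F -> P (E `&` F) = P E * P F.
Proof.
move=> G1m G2m G1I G2I G1T G2T PG E F sE sF.
have sGm G : G `<=` measurable -> <<s G >> `<=` @measurable _ Omega.
  by move=> Gm; apply: smallest_sub => //; exact: sigma_algebra_measurable.
rewrite setIC muleC; apply: (indep_pi1 G2m) => //; first exact: (sGm _ G1m).
move=> F' G2F'; rewrite setIC muleC; apply: (indep_pi1 G1m) => //.
  exact: G2m.
by move=> E' G1E'; exact: PG.
Qed.

End PiIndep.

(** * Sigma-algebras generated by subfamilies of an independent family *)

Section FamilySigma.
Context {R : realType} {dT : measure_display} {Omega : measurableType dT}
  (P : probability Omega R) (I : eqType) (G : I -> set (Omega -> R)).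

Definition fam_gen (A : set I) : set (set Omega) :=
  [set E | exists i f (B : set R), [/\ A i, G i f, measurable B & E = f @^-1` B]].

(** A measurable type on the same carrier, so that measurability with respect to a subfamily is
    ordinary measurability and inherits its closure properties. *)
Definition fam_sigma (A : set I) := g_sigma_algebraType (fam_gen A).

Definition fam_cyl (s : seq I) (n : I -> nat) (X : I -> nat -> Omega -> R)
    (B : I -> nat -> set R) : set Omega :=
  \bigcap_(i in [set` s]) \bigcap_(k in `I_(n i)) (X i k @^-1` B i k).

(** Cylinders in the very shape of [mutual_indep]. Allowing several conditions per index is what
    closes them under intersection. *)
Definition fam_pi (A : set I) : set (set Omega) :=
  [set E | exists (s : seq I) n X B, [/\ uniq s,
     (forall i, i \in s -> A i),
     (forall i k, (k < n i)%N -> G i (X i k) /\ measurable (B i k)) &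
     E = fam_cyl s n X B]].

Lemma fam_gen_sub_pi A : fam_gen A `<=` fam_pi A.
Proof.
move=> _ [i [f [B [Ai Gf mB ->]]]].
exists [:: i], (fun j => (j == i : nat)), (fun _ _ => f), (fun _ _ => B).
split => //.
- by move=> j; rewrite inE => /eqP ->.
- by move=> j k; case: eqP => // ->.
apply/seteqP; split => w /=.
  by move=> Bw j /= ; rewrite inE => /eqP -> k /= _.
by move=> /(_ i); rewrite /= inE eqxx => /(_ isT 0%N); exact.
Qed.

Lemma fam_pi_setT A : fam_pi A setT.
Proof.
exists [::], (fun=> 0%N), (fun _ _ _ => 0), (fun _ _ => setT); split => //.
by apply/seteqP; split => // w _ i /=.
Qed.

Lemma fam_pi_setI A : setI_closed (fam_pi A).
Proof.
move=> _ _ [s [n [X [B [us sA GX ->]]]]] [s' [n' [X' [B' [us' sA' GX' ->]]]]].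
(* On the merged index list the conditions of both cylinders are concatenated: the first [m i] come
   from the first cylinder, the others, shifted by [m i], from the second. Setting the counts to 0
   off each list discards the irrelevant ones. *)
pose m i := if i \in s then n i else 0%N.
pose m' i := if i \in s' then n' i else 0%N.
exists (undup (s ++ s')), (fun i => (m i + m' i)%N),
  (fun i k => if (k < m i)%N then X i k else X' i (k - m i)%N),
  (fun i k => if (k < m i)%N then B i k else B' i (k - m i)%N).
split.
- exact: undup_uniq.
- by move=> i; rewrite mem_undup mem_cat => /orP[/sA|/sA'].
- move=> i k; case: ifP => km kmm'.
    by apply: GX; move: km; rewrite /m; case: ifP.
  apply: GX'; have : (k - m i < m' i)%N by rewrite ltn_subLR// leqNgt km.
  by rewrite /m'; case: ifP.
apply/seteqP; split => w.
  move=> [h h'] i _ k /= kmm'; case: ifP => km.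
    move: (km); rewrite /m; case: ifP => // si kn; exact: h.
  have : (k - m i < m' i)%N by rewrite ltn_subLR// leqNgt km.
  by rewrite /m'; case: ifP => // si kn; exact: h'.
move=> h; split=> i /= si k /= kn.
  have := h i; rewrite /= mem_undup mem_cat si => /(_ isT k) /=.
  have km : (k < m i)%N by rewrite /m si.
  by rewrite km; apply; rewrite ltn_addr.
have := h i; rewrite /= mem_undup mem_cat si orbT => /(_ isT (m i + k)%N) /=.
have km : (k < m' i)%N by rewrite /m' si.
have -> : (m i + k < m i)%N = false by rewrite ltnNge leq_addr.
by rewrite addKn; apply; rewrite ltn_add2l.
Qed.

Hypothesis Gm : forall i f, G i f -> measurable_fun setT f.

Lemma fam_pi_measurable A : fam_pi A `<=` measurable.
Proof.
move=> _ [s [n [X [B [us sA GX ->]]]]].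
apply: fin_bigcap_measurable => // i si.
apply: fin_bigcap_measurable => // k /= kn.
have [/Gm mX mB] := GX i k kn.
by rewrite -[X in measurable X]setTI; exact: mX.
Qed.

Lemma fam_gen_sigma_pi A : <<s fam_gen A >> `<=` <<s fam_pi A >>.
Proof. by apply: sub_smallest2r => //; exact: fam_gen_sub_pi. Qed.

Hypothesis ind : mutual_indep P G.

Local Open Scope ereal_scope.

(** The index lists are disjoint, so the intersection is a cylinder over their concatenation, and
    the product rules for the three lists combine. *)
Lemma fam_pi_indep (A B : set I) : (forall i, A i -> B i -> False) ->
  forall E F, fam_pi A E -> fam_pi B F -> P (E `&` F) = P E * P F.
Proof.
move=> AB E F piE piF.
have mE := fam_pi_measurable piE; have mF := fam_pi_measurable piF.
move: piE piF => [s [n [X [U [us sA GX EE]]]]] [s' [n' [X' [U' [us' sA' GX' FE]]]]].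
have dis i : i \in s -> i \in s' = false.
  by move=> si; apply/negP => si'; exact: (AB i (sA _ si) (sA' _ si')).
pose N i := if i \in s then n i else if i \in s' then n' i else 0%N.
pose Y i := if i \in s then X i else X' i.
pose V i := if i \in s then U i else U' i.
have hyp i k : (k < N i)%N -> G i (Y i k) /\ measurable (V i k).
  rewrite /N /Y /V; case: ifP => // _; first exact: GX.
  by case: ifP => // _; exact: GX'.
have cE : fam_cyl s N Y V = E.
  rewrite EE; apply/seteqP; split => w h i /= si; have := h i si.
    by rewrite /N /Y /V si.
  by rewrite /N /Y /V si.
have cF : fam_cyl s' N Y V = F.
  have nin i : i \in s' -> i \in s = false.
    by move=> si'; apply/negP => si; move: (dis _ si); rewrite si'.
  rewrite FE; apply/seteqP; split => w h i /= si; have := h i si.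
    by rewrite /N /Y /V nin// si.
  by rewrite /N /Y /V nin// si.
have cEF : fam_cyl (s ++ s') N Y V = E `&` F.
  rewrite -cE -cF; apply/seteqP; split => w.
    move=> h; split => i /= si; apply: h => /=; rewrite mem_cat si ?orbT//.
  by move=> [h h'] i /=; rewrite mem_cat => /orP[si|si]; [exact: h|exact: h'].
have ucat : uniq (s ++ s').
  rewrite cat_uniq us us' andbT /=; apply/hasPn => i si'; apply/negP => /= si.
  by move: (dis _ si); rewrite si'.
have h1 := ind ucat hyp; have h2 := ind us hyp; have h3 := ind us' hyp.
rewrite -/(fam_cyl _ _ _ _) big_cat/= in h1.
rewrite -/(fam_cyl _ _ _ _) in h2; rewrite -/(fam_cyl _ _ _ _) in h3.
move: h1; rewrite -h2 -h3 cEF cE cF => h1.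
rewrite -(@fineK _ (P (E `&` F))) ?fin_num_measure//; last exact: measurableI.
by rewrite h1 EFinM !fineK// fin_num_measure.
Qed.

Lemma fam_sigma_indep (A B : set I) : (forall i, A i -> B i -> False) ->
  forall E F, <<s fam_gen A >> E -> <<s fam_gen B >> F -> P (E `&` F) = P E * P F.
Proof.
move=> AB E F /fam_gen_sigma_pi sE /fam_gen_sigma_pi sF.
apply: (@indep_pi _ _ _ P (fam_pi A) (fam_pi B)) => //.
- exact: fam_pi_measurable.
- exact: fam_pi_measurable.
- exact: fam_pi_setI.
- exact: fam_pi_setI.
- exact: fam_pi_setT.
- exact: fam_pi_setT.
- exact: fam_pi_indep.
Qed.

Lemma fam_sigma_measurable A : <<s fam_gen A >> `<=` @measurable _ Omega.
Proof.
apply: smallest_sub; first exact: sigma_algebra_measurable.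
by move=> E /fam_gen_sub_pi; exact: fam_pi_measurable.
Qed.

End FamilySigma.

(** * Real-valued expectation, integrable and square integrable variables *)

Section Expectation.
Context {R : realType} {dT : measure_display} {Omega : measurableType dT}
  (P : probability Omega R).
Implicit Types (X Y Z : Omega -> R) (c K : R).

Definition Ex X : R := \int[P]_w X w.
Definition Int X : Prop := P.-integrable setT (EFin \o X).
Definition L2 X : Prop := measurable_fun setT X /\ Int (fun w => X w ^+ 2).

Lemma fine_expectation X : fine ('E_P[X])%E = Ex X.
Proof. by rewrite unlock. Qed.

Lemma Int_measurable X : Int X -> measurable_fun setT X.
Proof. by move=> /measurable_int/measurable_EFinP. Qed.

Lemma Int_cst c : Int (fun=> c).
Proof. exact: finite_measure_integrable_cst. Qed.

Lemma Ex_cst c : Ex (fun=> c) = c.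
Proof.
rewrite /Ex Rintegral_cst//; rewrite -[RHS]mulr1; congr (_ * _).
exact: (congr1 fine (probability_setT P)).
Qed.

Lemma IntD X Y : Int X -> Int Y -> Int (fun w => X w + Y w).
Proof. by move=> iX iY; have := integrableD measurableT iX iY. Qed.

Lemma IntB X Y : Int X -> Int Y -> Int (fun w => X w - Y w).
Proof. by move=> iX iY; have := integrableB measurableT iX iY. Qed.

Lemma IntZ c X : Int X -> Int (fun w => c * X w).
Proof. by move=> iX; have := integrableZl measurableT c iX. Qed.

Lemma Int_norm X : Int X -> Int (fun w => `|X w|).
Proof. exact: integrable_norm. Qed.

Lemma Int_sum I (s : seq I) (Q : pred I) (F : I -> Omega -> R) :
  (forall i, Q i -> Int (F i)) -> Int (fun w => \sum_(i <- s | Q i) F i w).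
Proof.
move=> iF; rewrite /Int.
have -> : EFin \o (fun w => \sum_(i <- s | Q i) F i w) =
   (fun w => \sum_(i <- s | Q i) (EFin \o F i) w)%E.
  by apply/funext => w /=; rewrite sumEFin.
by apply: integrable_sum => // i Qi; exact: iF.
Qed.

Lemma Int_le X Y : measurable_fun setT X -> Int Y ->
  (forall w, `|X w| <= Y w) -> Int X.
Proof.
move=> mX iY XY; apply: le_integrable iY => //; first exact/measurable_EFinP.
by move=> w _ /=; rewrite lee_fin (le_trans (XY w))// ler_norm.
Qed.

Lemma Int_bounded X K : measurable_fun setT X -> (forall w, `|X w| <= K) -> Int X.
Proof. by move=> mX XK; apply: (Int_le mX (Int_cst K)). Qed.

Lemma ExD X Y : Int X -> Int Y -> Ex (fun w => X w + Y w) = Ex X + Ex Y.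
Proof. by move=> iX iY; rewrite /Ex RintegralD. Qed.

Lemma ExB X Y : Int X -> Int Y -> Ex (fun w => X w - Y w) = Ex X - Ex Y.
Proof. by move=> iX iY; rewrite /Ex RintegralB. Qed.

Lemma ExZ c X : Int X -> Ex (fun w => c * X w) = c * Ex X.
Proof. by move=> iX; rewrite /Ex RintegralZl. Qed.

Lemma Ex_sum I (s : seq I) (Q : pred I) (F : I -> Omega -> R) :
  (forall i, Q i -> Int (F i)) ->
  Ex (fun w => \sum_(i <- s | Q i) F i w) = \sum_(i <- s | Q i) Ex (F i).
Proof.
move=> iF; elim: s => [|i s IH].
  rewrite big_nil -[RHS](Ex_cst 0); congr Ex.
  by apply/funext => w; rewrite big_nil.
rewrite big_cons -IH; case: ifPn => Qi.
  rewrite -ExD; [|exact: iF|exact: Int_sum].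
  by congr Ex; apply/funext => w; rewrite big_cons Qi.
by congr Ex; apply/funext => w; rewrite big_cons (negbTE Qi).
Qed.

Lemma Ex_le X Y : Int X -> Int Y -> (forall w, X w <= Y w) -> Ex X <= Ex Y.
Proof. by move=> iX iY XY; apply: le_Rintegral. Qed.

Lemma Ex_ge0 X : (forall w, 0 <= X w) -> 0 <= Ex X.
Proof. by move=> X0; apply: Rintegral_ge0. Qed.

Lemma Ex_normr X : Int X -> `|Ex X| <= Ex (fun w => `|X w|).
Proof. by move=> iX; exact: le_normr_Rintegral. Qed.

Lemma Ex_norm_le X Y : Int X -> Int Y -> (forall w, `|X w| <= Y w) -> `|Ex X| <= Ex Y.
Proof.
move=> iX iY XY; apply: le_trans (Ex_normr iX) _.
by apply: Ex_le => //; exact: Int_norm.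
Qed.

Lemma L2_measurable X : L2 X -> measurable_fun setT X. Proof. by case. Qed.

Lemma Int_L2M X Y : L2 X -> L2 Y -> Int (fun w => X w * Y w).
Proof.
move=> [mX iX] [mY iY]; apply: (Int_le _ (IntD iX iY)).
  exact: measurable_funM.
move=> w; rewrite ler_norml; have := sqr_ge0 (X w - Y w);
 have := sqr_ge0 (X w + Y w) => *; nra.
Qed.

Lemma L2_bounded X K : measurable_fun setT X -> (forall w, `|X w| <= K) -> L2 X.
Proof.
move=> mX XK; split => //; apply: (@Int_bounded _ (K ^+ 2)).
  exact: measurable_funX.
by move=> w; rewrite normrX lerXn2r ?nnegrE// (le_trans _ (XK w)).
Qed.

Lemma L2_cst c : L2 (fun=> c).
Proof. exact: (@L2_bounded _ `|c|). Qed.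

Lemma L2_Int X : L2 X -> Int X.
Proof.
move=> lX; have := Int_L2M lX (L2_cst 1).
by congr Int; apply/funext => w; rewrite mulr1.
Qed.

Lemma L2_le X Y : measurable_fun setT X -> L2 Y -> (forall w, `|X w| <= Y w) -> L2 X.
Proof.
move=> mX [mY iY] XY; split => //; apply: Int_le iY _.
  exact: measurable_funX.
by move=> w; rewrite normrX lerXn2r ?nnegrE// (le_trans _ (XY w)).
Qed.

Lemma L2Z c X : L2 X -> L2 (fun w => c * X w).
Proof.
move=> [mX iX]; split; first exact: measurable_funM.
have := IntZ (c ^+ 2) iX; congr Int; apply/funext => w; ring.
Qed.

Lemma L2D X Y : L2 X -> L2 Y -> L2 (fun w => X w + Y w).
Proof.
move=> lX lY; have [mX iX] := lX; have [mY iY] := lY.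
split; first exact: measurable_funD.
have := IntD (IntD iX iY) (IntZ 2 (Int_L2M lX lY)).
congr Int; apply/funext => w; ring.
Qed.

Lemma L2B X Y : L2 X -> L2 Y -> L2 (fun w => X w - Y w).
Proof.
move=> lX lY; have := L2D lX (L2Z (-1) lY).
by congr L2; apply/funext => w; rewrite mulN1r.
Qed.

Lemma L2_norm X : L2 X -> L2 (fun w => `|X w|).
Proof.
move=> [mX iX]; split; first exact: measurableT_comp.
by move: iX; congr Int; apply/funext => w; rewrite real_normK// num_real.
Qed.

Lemma L2_sum I (s : seq I) (Q : pred I) (F : I -> Omega -> R) :
  (forall i, Q i -> L2 (F i)) -> L2 (fun w => \sum_(i <- s | Q i) F i w).
Proof.
move=> iF; elim: s => [|i s IH].
  have -> : (fun w => \sum_(i <- [::] | Q i) F i w) = fun=> 0.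
    by apply/funext => w; rewrite big_nil.
  exact: L2_cst.
case Qi : (Q i).
  have -> : (fun w => \sum_(i <- i :: s | Q i) F i w) =
     (fun w => F i w + \sum_(i <- s | Q i) F i w).
    by apply/funext => w; rewrite big_cons Qi.
  by apply: L2D => //; exact: iF.
have -> : (fun w => \sum_(i <- i :: s | Q i) F i w) =
   (fun w => \sum_(i <- s | Q i) F i w).
  by apply/funext => w; rewrite big_cons Qi.
exact: IH.
Qed.

Lemma Ex_sqr_ge0 X : 0 <= Ex (fun w => X w ^+ 2).
Proof. by apply: Ex_ge0 => w; exact: sqr_ge0. Qed.

Lemma Ex_sqrD_le X Y : L2 X -> L2 Y ->
  Ex (fun w => (X w + Y w) ^+ 2) <=
  2 * Ex (fun w => X w ^+ 2) + 2 * Ex (fun w => Y w ^+ 2).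
Proof.
move=> lX lY; have [_ iX] := lX; have [_ iY] := lY.
rewrite -!ExZ// -ExD; [|exact: IntZ..].
apply: Ex_le; [by have [] := L2D lX lY|by apply: IntD; exact: IntZ|].
by move=> w; have := sqr_ge0 (X w - Y w); nra.
Qed.

Lemma Ex_indic (A : set Omega) : measurable A -> Ex (\1_A) = fine (P A).
Proof. by move=> mA; rewrite /Ex /Rintegral integral_indic// setIT. Qed.

Lemma Int_indic (A : set Omega) : measurable A -> Int (\1_A).
Proof. by move=> mA; exact: integrable_indic. Qed.

(** The joint law of the pair and the product of the marginal laws agree on rectangles, hence
    everywhere; Fubini then factors the integral of the product. *)
Lemma Ex_indepM X Y : Int X -> Int Y -> Int (fun w => X w * Y w) ->
  (forall A B, measurable A -> measurable B ->
     P (X @^-1` A `&` Y @^-1` B) = (P (X @^-1` A) * P (Y @^-1` B))%E) ->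
  Ex (fun w => X w * Y w) = Ex X * Ex Y.
Proof.
move=> iX iY iXY ind.
have mX := Int_measurable iX; have mY := Int_measurable iY.
pose X' : {mfun Omega >-> R} := HB.pack X (isMeasurableFun.Build _ _ _ _ X mX).
pose Y' : {mfun Omega >-> R} := HB.pack Y (isMeasurableFun.Build _ _ _ _ Y mY).
pose Z w := (X w, Y w).
have mZ : measurable_fun setT Z by exact: measurable_fun_pair.
pose Z' : {mfun Omega >-> (R * R)%type} := HB.pack Z (isMeasurableFun.Build _ _ _ _ Z mZ).
pose f (z : R * R) : \bar R := (z.1 * z.2)%:E.
have mf : measurable_fun setT f.
  apply/measurable_EFinP; apply: measurable_funM.
    exact: measurable_fst.
  exact: measurable_snd.
have meq (A : set (R * R)) : measurable A ->
    ((distribution P X') \x (distribution P Y'))%E A = distribution P Z' A.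
  by apply: product_measure_unique => B C mB mC; rewrite -ind.
have eqi : (\int[(distribution P X') \x (distribution P Y')]_z f z =
            \int[distribution P Z']_z f z)%E.
  by apply: eq_measure_integral => A mA _; exact: meq.
have iZ : P.-integrable setT (f \o Z) by exact: iXY.
have ip : ((distribution P X') \x (distribution P Y'))%E.-integrable setT f.
  have /integrableP[_ h] := integrable_pushforward (phi := Z) mZ (D := setT) mf iZ measurableT.
  apply/integrableP; split => //.
  rewrite (@eq_measure_integral _ _ _ _ (distribution P Z')) => [|A mA _]; first exact: h.
  exact: meq.
have := integral12_prod_meas1 ip.
rewrite eqi integral_distribution//.
have -> : (\int[distribution P X']_x fubini_F (distribution P Y') f x =
   \int[distribution P X']_x (x * Ex Y)%:E)%E.
  apply: eq_integral => x _; rewrite /fubini_F /f/=.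
  under eq_integral do rewrite EFinM.
  rewrite integralZl//; last first.
    apply: (integrable_pushforward (phi := Y) mY (D := setT) (f := EFin)) => //.
  rewrite (integral_distribution (X := Y'))// EFinM; congr (_ * _)%E.
  by rewrite /Ex /Rintegral fineK//; exact: integrable_fin_num.
rewrite (integral_distribution (X := X'))//=; last 2 first.
- by apply/measurable_EFinP; apply: measurable_funM.
- have := IntZ (Ex Y) iX; rewrite /Int; congr (integrable _ _ _).
  by apply/funext => w /=; rewrite mulrC.
under eq_integral do rewrite EFinM.
rewrite integralZr//.
rewrite /Ex /Rintegral => /(congr1 fine) /= <-.
by rewrite fineM//= integrable_fin_num.
Qed.

End Expectation.

(** * Expectations of products over disjoint subfamilies *)

Section FamExpectation.
Context {R : realType} {dT : measure_display} {Omega : measurableType dT}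
  (P : probability Omega R) (I : eqType) (G : I -> set (Omega -> R)).
Hypothesis Gm : forall i f, G i f -> measurable_fun setT f.
Hypothesis ind : mutual_indep P G.

Definition fmeas (A : set I) (X : Omega -> R) :=
  measurable_fun (setT : set (fam_sigma G A)) (X : fam_sigma G A -> R).

Lemma fmeas_measurable A X : fmeas A X -> measurable_fun setT X.
Proof.
move=> mX _ B mB; apply: (@fam_sigma_measurable _ _ _ _ _ Gm A).
exact: (mX measurableT B mB).
Qed.

Lemma fmeas_gen A i f : A i -> G i f -> fmeas A f.
Proof.
move=> Ai Gf _ B mB; rewrite setTI; apply: sub_sigma_algebra.
by exists i, f, B.
Qed.

Lemma fmeas_sub A B X : A `<=` B -> fmeas A X -> fmeas B X.
Proof.
move=> AB mX _ V mV; have := mX measurableT V mV.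
apply: sub_smallest2r => // _ [i [f [U [Ai Gf mU ->]]]].
by exists i, f, U; split => //; exact: AB.
Qed.

Lemma fmeas_Ex_indepM (A B : set I) X Y : (forall i, A i -> B i -> False) ->
  fmeas A X -> fmeas B Y -> Int P X -> Int P Y -> Int P (fun w => X w * Y w) ->
  Ex P (fun w => X w * Y w) = Ex P X * Ex P Y.
Proof.
move=> AB mX mY iX iY iXY; apply: Ex_indepM => // U V mU mV.
apply: (fam_sigma_indep Gm ind AB).
  by have := mX measurableT U mU; rewrite setTI.
by have := mY measurableT V mV; rewrite setTI.
Qed.

End FamExpectation.

(** * Stein's method for N-dependent sums *)

Definition far (N s t : nat) : bool := (s + N < t)%N || (t + N < s)%N.

Lemma near_count N s T : (\sum_(t < T | ~~ far N s t) 1 <= N.*2.+1)%N.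
Proof.
rewrite -(big_mkord (fun t => ~~ far N s t) (fun=> 1%N)).
rewrite sum1_count.
have sub : {subset [seq t <- index_iota 0 T | ~~ far N s t] <=
            iota (s - N) N.*2.+1}.
  move=> t; rewrite mem_filter mem_iota => /andP[+ _].
  rewrite /far negb_or -!leqNgt => /andP[h1 h2].
  lia.
rewrite -size_filter -[X in (_ <= X)%N](size_iota (s - N)).
by apply: uniq_leq_size => //; rewrite filter_uniq// iota_uniq.
Qed.

Lemma near_sum_le {R : realType} N s T (F : 'I_T -> R) (K : R) : 0 <= K ->
  (forall t : 'I_T, ~~ far N s t -> `|F t| <= K) ->
  `|\sum_(t < T | ~~ far N s t) F t| <= N.*2.+1%:R * K.
Proof.
move=> K0 FK; apply: le_trans (ler_norm_sum _ _ _) _.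
apply: (@le_trans _ _ (\sum_(t < T | ~~ far N s t) K)); first exact: ler_sum.
rewrite sumr_const -sum1_card mulr_natl ler_wpMn2l//.
by apply: leq_trans (near_count N s T); rewrite leq_eqVlt eqxx.
Qed.

Section NDependent.
Context {R : realType} {dT : measure_display} {Omega : measurableType dT}
  (P : probability Omega R) (I : eqType) (G : I -> set (Omega -> R)).
Hypothesis Gm : forall i f, G i f -> measurable_fun setT f.
Hypothesis ind : mutual_indep P G.
Variables (A : nat -> set I) (N : nat).
Hypothesis A_far : forall s t, far N s t -> forall i, A s i -> A t i -> False.

Lemma fmeas_sum (B : set I) J (s : seq J) (Q : pred J) (F : J -> Omega -> R) :
  (forall j, Q j -> fmeas G B (F j)) -> fmeas G B (fun w => \sum_(j <- s | Q j) F j w).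
Proof.
move=> mF.
have -> : (fun w => \sum_(j <- s | Q j) F j w) =
    (fun w => \sum_(j <- s) (if Q j then F j else fun=> 0) w).
  apply/funext => w; rewrite big_mkcond/=.
  by apply: eq_bigr => j _; case: ifP.
by apply: measurable_sum => j; case: ifPn => // Qj; exact: mF.
Qed.

(** Covariances of far pairs vanish, so at most [T (2 N + 1)] terms remain, each bounded through
    [|x y| <= (x^2 + y^2) / 2]. The bound is linear in both [T] and [N], which matters when [N]
    grows with the lag. *)
Lemma Ndep_variance (D : nat -> Omega -> R) (b : nat -> R) (B v : R) T :
  (forall t, fmeas G (A t) (D t)) -> (forall t, L2 P (D t)) ->
  (forall t, Ex P (D t) = 0) -> (forall t, Ex P (fun w => D t w ^+ 2) <= v) ->
  (forall t, `|b t| <= B) ->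
  Ex P (fun w => (\sum_(t < T) b t * D t w) ^+ 2) <= T%:R * N.*2.+1%:R * (B ^+ 2 * v).
Proof.
move=> mD lD D0 Dv bB.
have v0 : 0 <= v by apply: le_trans (Dv 0%N); exact: Ex_sqr_ge0.
have B0 : 0 <= B by apply: le_trans (bB 0%N).
have iDD s t : Int P (fun w => b s * b t * (D s w * D t w)).
  by apply: IntZ; exact: Int_L2M.
have -> : (fun w => (\sum_(t < T) b t * D t w) ^+ 2) =
    (fun w => \sum_(s < T) \sum_(t < T) b s * b t * (D s w * D t w)).
  apply/funext => w; rewrite expr2 big_distrlr/=; apply: eq_bigr => s _.
  by apply: eq_bigr => t _; ring.
rewrite Ex_sum => [|s _]; last by apply: Int_sum => t _.
rewrite -mulrA mulr_natl -[T in leRHS]card_ord -sumr_const.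
apply: ler_sum => s _.
rewrite Ex_sum// (bigID (fun t : 'I_T => far N s t))/=.
rewrite big1 ?add0r => [|t st]; last first.
  rewrite ExZ; last exact: Int_L2M.
  rewrite (fmeas_Ex_indepM Gm ind (A_far st)) ?D0 ?mulr0//.
  - exact: L2_Int.
  - exact: L2_Int.
  - exact: Int_L2M.
apply: le_trans (ler_norm _) _; apply: near_sum_le.
  by rewrite mulr_ge0// sqr_ge0.
move=> t _; rewrite ExZ; last exact: Int_L2M.
rewrite normrM ler_pM//.
  by rewrite normrM expr2 ler_pM.
have [_ i1] := lD s; have [_ i2] := lD t.
apply: (@le_trans _ _ (2^-1 * (Ex P (fun w => D s w ^+ 2) + Ex P (fun w => D t w ^+ 2)))).
  rewrite -ExD// -ExZ; last exact: IntD.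
  apply: Ex_norm_le; [exact: Int_L2M|exact/IntZ/IntD|move=> w].
  rewrite ler_norml; have := sqr_ge0 (D s w - D t w);
  have := sqr_ge0 (D s w + D t w) => *; nra.
by have := Dv s; have := Dv t; lra.
Qed.

Definition Bd (X : Omega -> R) :=
  measurable_fun setT X /\ exists K, forall w, `|X w| <= K.

Lemma Bd_Int X : Bd X -> Int P X.
Proof. by move=> [mX [K XK]]; exact: Int_bounded XK. Qed.

Lemma BdM X Y : Bd X -> Bd Y -> Bd (fun w => X w * Y w).
Proof.
move=> [mX [K XK]] [mY [K' YK]]; split; first exact: measurable_funM.
by exists (K * K') => w; rewrite normrM ler_pM.
Qed.

Lemma BdD X Y : Bd X -> Bd Y -> Bd (fun w => X w + Y w).
Proof.
move=> [mX [K XK]] [mY [K' YK]]; split; first exact: measurable_funD.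
by exists (K + K') => w; rewrite (le_trans (ler_normD _ _))// lerD.
Qed.

Lemma Bd_cst c : Bd (fun=> c). Proof. by split => //; exists `|c|. Qed.

Lemma Bd_sum J (s : seq J) (Q : pred J) (F : J -> Omega -> R) :
  (forall j, Q j -> Bd (F j)) -> Bd (fun w => \sum_(j <- s | Q j) F j w).
Proof.
move=> bF; elim: s => [|j s IH].
  have -> : (fun w => \sum_(i <- [::] | Q i) F i w) = fun=> 0.
    by apply/funext => w; rewrite big_nil.
  exact: Bd_cst.
case Qj : (Q j); last first.
  by move: IH; congr Bd; apply/funext => w; rewrite big_cons Qj.
have := BdD (bF _ Qj) IH.
by congr Bd; apply/funext => w; rewrite big_cons Qj.
Qed.

Lemma fmeas_comp (B : set I) (f : R -> R) X : measurable_fun setT f ->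
  fmeas G B X -> fmeas G B (fun w => f (X w)).
Proof. by move=> mf mX; exact: (measurableT_comp mf mX). Qed.

Lemma fmeasM (B : set I) X Y : fmeas G B X -> fmeas G B Y ->
  fmeas G B (fun w => X w * Y w).
Proof. by move=> mX mY; exact: measurable_funM. Qed.

Section Stein.
Variables (xi : nat -> Omega -> R) (c : nat -> R) (B kap K : R) (T : nat).
Variables (f g : R -> R).
Hypothesis mxi : forall t, fmeas G (A t) (xi t).
Hypothesis xiB : forall t w, `|xi t w| <= B.
Hypothesis xi0 : forall t, Ex P (xi t) = 0.
Hypothesis ck : forall t, `|c t| <= kap.
Hypothesis fK : forall x, `|f x| <= K.
Hypothesis gK : forall x, `|g x| <= K.
Hypothesis mf : measurable_fun setT f.
Hypothesis mg : measurable_fun setT g.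
Hypothesis tfg : taylor2 setT f g K.

Let W w := \sum_(t < T) c t * xi t w.
(** Bounds on the number of indices within [N], respectively [2 N], of a given one. *)
Let n1 : R := N.*2.+1%:R.
Let n2 : R := (N.*2).*2.+1%:R.

Let B0 : 0 <= B.
Proof. by apply: le_trans (xiB 0%N point). Qed.

Let kap0 : 0 <= kap.
Proof. by apply: le_trans (ck 0%N). Qed.

Let K0 : 0 <= K.
Proof. by apply: le_trans (fK 0). Qed.

Let Bxi t : Bd (xi t).
Proof. by split; [exact: (fmeas_measurable Gm (@mxi t))|exists B]. Qed.

Let Bcxi t : Bd (fun w => c t * xi t w).
Proof. exact: BdM (Bd_cst _) (Bxi t). Qed.

Let BW : Bd W.
Proof. by apply: Bd_sum => t _. Qed.

Let Bd_f X : Bd X -> Bd (fun w => f (X w)).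
Proof. by move=> [mX _]; split; [exact: measurableT_comp|exists K]. Qed.

Let Bd_g X : Bd X -> Bd (fun w => g (X w)).
Proof. by move=> [mX _]; split; [exact: measurableT_comp|exists K]. Qed.

Let cxi_le t w : `|c t * xi t w| <= kap * B.
Proof. by rewrite normrM ler_pM. Qed.

Let fmeas_part (Q : pred nat) :
  fmeas G (\bigcup_(t in [set t | Q t]) A t) (fun w => \sum_(t < T | Q t) c t * xi t w).
Proof.
apply: fmeas_sum => t Qt; apply: fmeasM.
  exact: measurable_cst.
by apply: fmeas_sub (@mxi t) => k Ak; exists t.
Qed.

(** Without the summands within [N] of [i], the sum [Wi] is independent of [xi i], so
    [xi i * f (Wi w)] has mean 0. Expanding [f] around the full sum [W] leaves the displayed main
    term and a remainder quadratic in the removed part [eta]. *)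
Let step1 (i : nat) :
  `|Ex P (fun w => xi i w * f (W w)) -
    Ex P (fun w => (\sum_(j < T | ~~ far N i j) c j * xi j w) * xi i w * g (W w))|
  <= B * (K * (n1 * (kap * B)) ^+ 2).
Proof.
pose eta w := \sum_(j < T | ~~ far N i j) c j * xi j w.
pose Wi w := \sum_(j < T | far N i j) c j * xi j w.
have WE w : W w = eta w + Wi w.
  by rewrite /W (bigID (fun j : 'I_T => far N i j))/= addrC.
have Beta : Bd eta by apply: Bd_sum => t _.
have BWi : Bd Wi by apply: Bd_sum => t _.
have zero : Ex P (fun w => xi i w * f (Wi w)) = 0.
  rewrite (fmeas_Ex_indepM Gm ind (A := A i)
      (B := \bigcup_(t in [set t | far N i t]) A t)) ?xi0 ?mul0r//.
  - move=> k Ak [t /= it Atk]; exact: (A_far it Ak Atk).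
  - exact: (fmeas_comp mf (@fmeas_part (far N i))).
  - exact/Bd_Int/Bxi.
  - exact/Bd_Int/Bd_f.
  - exact/Bd_Int/BdM/Bd_f.
have ia : Int P (fun w => xi i w * f (W w)).
  by apply/Bd_Int/BdM => //; exact: Bd_f.
have ib : Int P (fun w => xi i w * f (Wi w)).
  by apply/Bd_Int/BdM => //; exact: Bd_f.
have ic : Int P (fun w => eta w * xi i w * g (W w)).
  by apply/Bd_Int/BdM; [exact: BdM|exact: Bd_g].
have e : Ex P (fun w => xi i w * f (W w)) - Ex P (fun w => eta w * xi i w * g (W w)) =
   Ex P (fun w => xi i w * f (W w) - xi i w * f (Wi w) - eta w * xi i w * g (W w)).
  by rewrite ExB//; [rewrite ExB// zero subr0|exact: IntB].
rewrite [X in `|X|]e.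
rewrite -[leRHS](Ex_cst P); apply: Ex_norm_le.
- by apply: IntB => //; exact: IntB.
- exact: Int_cst.
move=> w; rewrite -/(eta w).
have -> : xi i w * f (W w) - xi i w * f (Wi w) - eta w * xi i w * g (W w) =
  - (xi i w * (f (Wi w) - f (W w) - (Wi w - W w) * g (W w))) by rewrite WE; ring.
rewrite normrN normrM ler_pM//.
apply: le_trans (tfg _ _) _ => //; rewrite ler_wpM2l//.
have -> : Wi w - W w = - eta w by rewrite WE; ring.
rewrite sqrrN -real_normK ?num_real// lerXn2r ?nnegrE//.
  by rewrite mulr_ge0 ?ler0n// mulr_ge0.
apply: near_sum_le => [|t _]; [by rewrite mulr_ge0|exact: cxi_le].
Qed.

(** Since [j] is within [N] of [i], removing everything within [2 N] of [i] makes the rest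
    independent of both variables. The Lipschitz bound on [g] pays for the removal twice: inside the
    product and in the mean of [g]. *)
Let step2 (i j : nat) : ~~ far N i j ->
  `|Ex P (fun w => xi i w * xi j w * g (W w)) -
    Ex P (fun w => xi i w * xi j w) * Ex P (fun w => g (W w))|
  <= B ^+ 2 * (K *+ 2 * (n2 * (kap * B))) *+ 2.
Proof.
move=> nij.
pose eta w := \sum_(k < T | ~~ far N.*2 i k) c k * xi k w.
pose Wi w := \sum_(k < T | far N.*2 i k) c k * xi k w.
have WE w : W w = eta w + Wi w.
  by rewrite /W (bigID (fun j : 'I_T => far N.*2 i j))/= addrC.
have BWi : Bd Wi by apply: Bd_sum => t _.
have indp : Ex P (fun w => xi i w * xi j w * g (Wi w)) =
   Ex P (fun w => xi i w * xi j w) * Ex P (fun w => g (Wi w)).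
  apply: (fmeas_Ex_indepM Gm ind (A := A i `|` A j)
      (B := \bigcup_(t in [set t | far N.*2 i t]) A t)).
  - move=> k Ak [t /= it Atk]; case: Ak => Ak.
      have fit : far N i t by rewrite /far in it *; lia.
      exact: (A_far fit Ak Atk).
    have fjt : far N j t by rewrite /far in it nij *; lia.
    exact: (A_far fjt Ak Atk).
  - by apply: fmeasM; [apply: fmeas_sub (@mxi i); left|apply: fmeas_sub (@mxi j); right].
  - exact: (fmeas_comp mg (@fmeas_part (far N.*2 i))).
  - exact/Bd_Int/BdM.
  - exact/Bd_Int/Bd_g.
  - by apply/Bd_Int/BdM; [exact: BdM|exact: Bd_g].
have gd w : `|g (W w) - g (Wi w)| <= K *+ 2 * (n2 * (kap * B)).
  apply: le_trans (taylor2_lip tfg _ _) _ => //.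
  rewrite ler_wpM2l ?mulrn_wge0//.
  have -> : W w - Wi w = eta w by rewrite WE; ring.
  apply: near_sum_le => [|t _]; [by rewrite mulr_ge0|exact: cxi_le].
have xx w : `|xi i w * xi j w| <= B ^+ 2 by rewrite normrM expr2 ler_pM.
have i1 : Int P (fun w => xi i w * xi j w * g (W w)).
  by apply/Bd_Int/BdM; [exact: BdM|exact: Bd_g].
have i2 : Int P (fun w => xi i w * xi j w * g (Wi w)).
  by apply/Bd_Int/BdM; [exact: BdM|exact: Bd_g].
have i3 : Int P (fun w => g (W w)) by exact/Bd_Int/Bd_g.
have i4 : Int P (fun w => g (Wi w)) by exact/Bd_Int/Bd_g.
have -> : Ex P (fun w => xi i w * xi j w * g (W w)) -
    Ex P (fun w => xi i w * xi j w) * Ex P (fun w => g (W w)) =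
   (Ex P (fun w => xi i w * xi j w * g (W w)) -
   Ex P (fun w => xi i w * xi j w * g (Wi w))) -
   Ex P (fun w => xi i w * xi j w) * (Ex P (fun w => g (W w)) - Ex P (fun w => g (Wi w))).
  by rewrite indp; ring.
rewrite -(ExB i1 i2) -(ExB i3 i4).
apply: le_trans (ler_normB _ _) _; rewrite mulr2n; apply: lerD.
  rewrite -[leRHS](Ex_cst P); apply: Ex_norm_le; [exact: IntB|exact: Int_cst|].
  by move=> w; rewrite -mulrBr normrM ler_pM.
rewrite normrM ler_pM//.
  rewrite -[leRHS](Ex_cst P); apply: Ex_norm_le => //; [exact/Bd_Int/BdM|exact: Int_cst].
rewrite -[leRHS](Ex_cst P); apply: Ex_norm_le => //; [exact: IntB|exact: Int_cst].
Qed.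

(** Both steps are summed with the weights [c]; the second moment of [W] involves only near pairs,
    as the second step requires. With [kap] of order [T^-1/2] the factor [T kap^3] is of order
    [T^-1/2]. *)
Lemma Ndep_stein :
  `|Ex P (fun w => W w * f (W w)) -
    Ex P (fun w => W w ^+ 2) * Ex P (fun w => g (W w))|
  <= T%:R * (kap ^+ 3 * B ^+ 3 * K * (n1 ^+ 2 + 4 * n1 * n2)).
Proof.
have E1 : Ex P (fun w => W w * f (W w)) =
    \sum_(i < T) c i * Ex P (fun w => xi i w * f (W w)).
  have -> : (fun w => W w * f (W w)) =
     (fun w => \sum_(i < T) c i * (xi i w * f (W w))).
    by apply/funext => w; rewrite {1}/W mulr_suml; apply: eq_bigr => i _; ring.
  have ixf i : Int P (fun w => xi i w * f (W w)).
    by apply/Bd_Int/BdM => //; exact: Bd_f.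
  by rewrite Ex_sum => [|i _]; [apply: eq_bigr => i _; rewrite ExZ|exact: IntZ].
have ixx i j : Int P (fun w => xi i w * xi j w) by exact/Bd_Int/BdM.
have ixxg i j : Int P (fun w => xi i w * xi j w * g (W w)).
  by apply/Bd_Int/BdM; [exact: BdM|exact: Bd_g].
have E2 : Ex P (fun w => W w ^+ 2) =
    \sum_(i < T) \sum_(j < T | ~~ far N i j) c i * (c j * Ex P (fun w => xi i w * xi j w)).
  have -> : (fun w => W w ^+ 2) =
     (fun w => \sum_(i < T) \sum_(j < T) c i * c j * (xi i w * xi j w)).
    apply/funext => w; rewrite expr2 big_distrlr/=; apply: eq_bigr => s _.
    by apply: eq_bigr => t _; ring.
  rewrite Ex_sum => [|i _]; last by apply: Int_sum => j _; exact: IntZ.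
  apply: eq_bigr => i _; rewrite Ex_sum => [|j _]; last exact: IntZ.
  rewrite (bigID (fun t : 'I_T => far N i t))/= big1 ?add0r => [|j ij].
    by apply: eq_bigr => j _; rewrite ExZ// mulrA.
  rewrite ExZ// (fmeas_Ex_indepM Gm ind (A_far ij)) ?xi0 ?mulr0//; exact/Bd_Int.
rewrite E1 E2 mulr_suml -sumrB.
apply: le_trans (ler_norm_sum _ _ _) _.
rewrite mulr_natl -[T in leRHS]card_ord -sumr_const; apply: ler_sum => i _.
set eg := Ex P (fun w => g (W w)).
have s1 := step1 i.
have E3 : Ex P (fun w => (\sum_(j < T | ~~ far N i j) c j * xi j w) * xi i w * g (W w)) =
  \sum_(j < T | ~~ far N i j) c j * Ex P (fun w => xi i w * xi j w * g (W w)).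
  have -> : (fun w => (\sum_(j < T | ~~ far N i j) c j * xi j w) * xi i w * g (W w)) =
    (fun w => \sum_(j < T | ~~ far N i j) c j * (xi i w * xi j w * g (W w))).
    by apply/funext => w; rewrite !mulr_suml; apply: eq_bigr => j _; ring.
  by rewrite Ex_sum => [|j _]; [apply: eq_bigr => j _; rewrite ExZ|exact: IntZ].
rewrite E3 in s1.
have s2 : `|\sum_(j < T | ~~ far N i j) c j * (Ex P (fun w => xi i w * xi j w * g (W w)) -
     Ex P (fun w => xi i w * xi j w) * eg)|
    <= n1 * (kap * (B ^+ 2 * (K *+ 2 * (n2 * (kap * B))) *+ 2)).
  apply: near_sum_le.
    by rewrite mulr_ge0// mulrn_wge0// mulr_ge0 ?sqr_ge0// mulr_ge0 ?mulrn_wge0// mulr_ge0 ?ler0n// mulr_ge0.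
  by move=> j ij; rewrite normrM ler_pM//; exact: step2.
have -> : c i * Ex P (fun w => xi i w * f (W w)) -
   (\sum_(j < T | ~~ far N i j) c i * (c j * Ex P (fun w => xi i w * xi j w))) * eg =
   c i * ((Ex P (fun w => xi i w * f (W w)) -
     \sum_(j < T | ~~ far N i j) c j * Ex P (fun w => xi i w * xi j w * g (W w))) +
     \sum_(j < T | ~~ far N i j) c j * (Ex P (fun w => xi i w * xi j w * g (W w)) -
     Ex P (fun w => xi i w * xi j w) * eg)).
  rewrite -mulr_sumr.
  under [X in _ = c i * (_ + X)]eq_bigr do rewrite mulrBr.
  rewrite sumrB.
  under [X in _ = c i * (_ + (_ - X))]eq_bigr do rewrite mulrA.
  by rewrite -mulr_suml; ring.
rewrite normrM.
apply: (@le_trans _ _ (kap * (B * (K * (n1 * (kap * B)) ^+ 2) +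
   n1 * (kap * (B ^+ 2 * (K *+ 2 * (n2 * (kap * B))) *+ 2))))).
  rewrite ler_pM//; apply: le_trans (ler_normD _ _) _; exact: lerD.
by rewrite le_eqVlt; apply/orP; left; apply/eqP; ring.
Qed.

End Stein.

End NDependent.

(** * Lipschitz functions of a real variable *)

Section LipschitzReal.
Context {R : realType}.

(** Increments at distance at most 1 are estimated by the expansion, the others by boundedness. *)
Lemma taylor2_lip_base (f g : R -> R) K : taylor2 setT f g K ->
  (forall x, `|f x| <= K) -> (forall x, `|g x| <= K) ->
  forall a b, `|f b - f a| <= K *+ 2 * `|b - a|.
Proof.
move=> tfg fK gK a b.
have K0 : 0 <= K by apply: le_trans (fK 0).
have [ab|ab] := leP `|b - a| 1.
  have -> : f b - f a = (f b - f a - (b - a) * g a) + (b - a) * g a by ring.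
  apply: le_trans (ler_normD _ _) _.
  rewrite mulrnAl mulr2n; apply: lerD.
    apply: le_trans (tfg _ _ _ _) _ => //; rewrite ler_wpM2l//.
    by rewrite -real_normK ?num_real// expr2 ler_piMl.
  by rewrite normrM mulrC ler_wpM2r.
apply: le_trans (ler_normB _ _) _.
have : K *+ 2 * 1 <= K *+ 2 * `|b - a| by rewrite ler_wpM2l ?mulrn_wge0// ltW.
by have := fK a; have := fK b; rewrite mulr1 mulr2n => *; lra.
Qed.

Lemma lip_measurable (f : R -> R) K : (forall a b, `|f b - f a| <= K * `|b - a|) ->
  measurable_fun setT f.
Proof.
move=> fK; apply: continuous_measurable_fun => a.
apply/cvgrPdist_le => e e0; near=> b.
rewrite distrC; apply: le_trans (fK a b) _.
apply: (@le_trans _ _ ((`|K| + 1) * `|b - a|)).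
  by rewrite ler_wpM2r// (le_trans (ler_norm _))// lerDl.
rewrite mulrC -ler_pdivlMr ?ltr_wpDl//.
rewrite distrC; near: b; apply: cvgr_dist_le; first exact: cvg_id.
by rewrite divr_gt0// ltr_wpDl.
Unshelve. all: by end_near. Qed.

End LipschitzReal.

(** * Stein's identity in the limit for approximable errors *)

Section SteinCLT.
Context {R : realType} {dT : measure_display} {Omega : measurableType dT}
  (P : probability Omega R) (I : eqType) (G : I -> set (Omega -> R)).
Hypothesis Gm : forall i f, G i f -> measurable_fun setT f.
Hypothesis ind : mutual_indep P G.

(** The range [N] and the bound [Bx] may depend on [eps], but on neither [T] nor the weights. The
    error is linear in [T], so that it stays of order [eps] after division by the standard deviation
    of the sum. *)
Definition Ndep_approx (e : nat -> Omega -> R) := forall eps, 0 < eps ->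
  exists (N : nat) (A : nat -> set I) (xi : nat -> Omega -> R) (Bx : R),
    [/\ forall s t, far N s t -> forall i, A s i -> A t i -> False,
        forall t, fmeas G (A t) (xi t),
        forall t w, `|xi t w| <= Bx,
        forall t, Ex P (xi t) = 0 &
        forall (b : nat -> R) B T, (forall t, `|b t| <= B) ->
        Ex P (fun w => (\sum_(t < T) b t * (e t w - xi t w)) ^+ 2)
          <= eps * B ^+ 2 * T%:R].

(** A form of the Cauchy-Schwarz inequality without square roots: for a second factor whose mean
    square is at most [eta ^+ 2], the bound is of order [eta]. *)
Lemma Ex_norm_AMGM X Y eta : 0 < eta -> L2 P X -> L2 P Y ->
  Ex P (fun w => `|X w * Y w|) <=
  2^-1 * (eta * Ex P (fun w => X w ^+ 2) + eta^-1 * Ex P (fun w => Y w ^+ 2)).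
Proof.
move=> e0 lX lY; have [_ iX] := lX; have [_ iY] := lY.
rewrite -!ExZ// -ExD; [|exact: IntZ..]; rewrite -ExZ; last by apply: IntD; exact: IntZ.
apply: Ex_le; [exact/Int_norm/Int_L2M|by apply/IntZ/IntD; exact: IntZ|].
move=> w; rewrite normrM.
rewrite -[X w ^+ 2]real_normK ?num_real// -[Y w ^+ 2]real_normK ?num_real//.
rewrite [leRHS]mulrC ler_pdivlMr//.
have -> : eta * `|X w| ^+ 2 + eta^-1 * `|Y w| ^+ 2 =
  eta * (`|X w| - eta^-1 * `|Y w|) ^+ 2 + `|X w| * `|Y w| * 2.
  by field; rewrite gt_eqF.
by rewrite lerDr mulr_ge0 ?sqr_ge0// ltW.
Qed.

Variables (e : nat -> Omega -> R) (b : nat -> R) (B kap : R) (u : nat -> R).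
Hypothesis le2 : forall t, L2 P (e t).
Hypothesis eapp : Ndep_approx e.
Hypothesis bB : forall t, `|b t| <= B.
Let W T w := u T * \sum_(t < T) b t * e t w.
Hypothesis W1 : \forall T \near \oo, Ex P (fun w => W T w ^+ 2) = 1.
Hypothesis uk : \forall T \near \oo, (u T) ^+ 2 * T%:R <= kap ^+ 2.
Hypothesis kap0 : 0 <= kap.

Lemma L2_W T : L2 P (W T).
Proof. by apply: L2Z; apply: L2_sum => t _; exact: L2Z. Qed.

(** The approximation is fixed before [T]: it replaces [W] by a bounded N-dependent sum [V] at mean
    square distance [eta], and then [T] is taken large enough to make the Stein error of [V]
    small. *)
Lemma stein_cvg (f g : R -> R) K : taylor2 setT f g K ->
  (forall x, `|f x| <= K) -> (forall x, `|g x| <= K) ->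
  (fun T => Ex P (fun w => g (W T w) - W T w * f (W T w))) @ \oo --> (0 : R).
Proof.
move=> tfg fK gK.
have K0 : 0 <= K by apply: le_trans (fK 0).
have fL := taylor2_lip_base tfg fK gK.
have gL c d : `|g d - g c| <= K *+ 2 * `|d - c| by apply: (taylor2_lip tfg).
have mf := lip_measurable fL; have mg := lip_measurable gL.
have B0 : 0 <= B by apply: le_trans (bB 0%N).
apply/cvgrPdist_le => eps eps0.
(* The errors collected at the end amount to [(8 K + 1) eta]; [eta <= 1] is used to bound [eta ^+ 2]
   by [eta]. *)
pose eta := Num.min 1 (eps / (16 * (K + 1))).
have K10 : 0 < 16 * (K + 1) by rewrite mulr_gt0// ltr_wpDl.
have eta0 : 0 < eta by rewrite lt_min ltr01 divr_gt0.
have eta1 : eta <= 1 by rewrite ge_min lexx.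
have etaeps : eta * (16 * (K + 1)) <= eps by rewrite -ler_pdivlMr// ge_min lexx orbT.
(* After multiplication by [u T ^+ 2] the approximation error is at most [eps1 B^2 kap^2], hence at
   most [eta ^+ 2]; the 1 keeps the denominator positive. *)
pose eps1 := eta ^+ 2 / (B ^+ 2 * kap ^+ 2 + 1).
have den0 : 0 < B ^+ 2 * kap ^+ 2 + 1 by rewrite ltr_wpDl// mulr_ge0// sqr_ge0.
have eps10 : 0 < eps1 by rewrite divr_gt0// exprn_gt0.
have [N [A [xi [Bx [Afar mxi xiB xi0 app]]]]] := eapp eps10.
pose n1 : R := N.*2.+1%:R; pose n2 : R := N.*2.*2.+1%:R.
pose C0 := (B * kap) ^+ 3 * Bx ^+ 3 * K * (n1 ^+ 2 + 4 * n1 * n2).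
have Bx0 : 0 <= Bx by apply: le_trans (xiB 0%N point).
have C00 : 0 <= C0.
  by rewrite !mulr_ge0 ?addr_ge0 ?mulr_ge0 ?exprn_ge0 ?mulr_ge0 ?ler0n ?exprn_ge0 ?ler0n.
near=> T.
have T0 : (0 < T)%N by near: T; exact: nbhs_infty_gt.
have TR : 0 < T%:R :> R by rewrite ltr0n.
have sT0 : 0 < Num.sqrt (T%:R : R) by rewrite sqrtr_gt0.
have W1T : Ex P (fun w => W T w ^+ 2) = 1 by near: T; exact: W1.
have ukT : (u T) ^+ 2 * T%:R <= kap ^+ 2 by near: T; exact: uk.
pose V w := \sum_(t < T) (u T * b t) * xi t w.
pose kT := kap / Num.sqrt T%:R * B.
have uTk : `|u T| <= kap / Num.sqrt T%:R.
  rewrite ler_pdivlMr// -ler_sqr ?nnegrE ?mulr_ge0// ?sqrtr_ge0//.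
  by rewrite exprMn real_normK ?num_real// sqr_sqrtr// ltW.
have ckT t : `|u T * b t| <= kT.
  by rewrite normrM ler_pM.
have lxi t : L2 P (xi t).
  by apply: (@L2_bounded _ _ _ _ _ Bx) => //; exact: (fmeas_measurable Gm (@mxi t)).
have lV : L2 P V by apply: L2_sum => t _; exact: L2Z.
have lW := L2_W T.
pose D w := W T w - V w.
have lD : L2 P D by exact: L2B.
have VE w : V w = W T w - D w by rewrite /D; ring.
have ED2 : Ex P (fun w => D w ^+ 2) <= eta ^+ 2.
  have -> : (fun w => D w ^+ 2) =
     (fun w => u T ^+ 2 * (\sum_(t < T) b t * (e t w - xi t w)) ^+ 2).
    apply/funext => w; rewrite -exprMn; congr (_ ^+ 2).
    rewrite /D /W /V !mulr_sumr -sumrB; apply: eq_bigr => t _; ring.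
  rewrite ExZ; last first.
    suff [] : L2 P (fun w => \sum_(t < T) b t * (e t w - xi t w)) by [].
    by apply: L2_sum => t _; apply: L2Z; exact: L2B.
  apply: le_trans (ler_wpM2l (sqr_ge0 _) (app b B T bB)) _.

  have -> : u T ^+ 2 * (eps1 * B ^+ 2 * T%:R) = eps1 * (B ^+ 2 * (u T ^+ 2 * T%:R)) by ring.
  apply: (@le_trans _ _ (eps1 * (B ^+ 2 * kap ^+ 2 + 1))).
    rewrite ler_pM2l//; apply: (@le_trans _ _ (B ^+ 2 * kap ^+ 2)).
      by rewrite ler_wpM2l// sqr_ge0.
    by rewrite lerDl.
  by rewrite /eps1 divfK// gt_eqF.
have [_ iD2] := lD.
have ED1 : Ex P (fun w => `|D w|) <= eta.
  have -> : (fun w => `|D w|) = (fun w => `|1 * D w|) by apply/funext => w; rewrite mul1r.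
  apply: le_trans (Ex_norm_AMGM eta0 (L2_cst P 1) lD) _.
  rewrite Ex_cst expr1n mulr1.
  have : eta^-1 * Ex P (fun w => D w ^+ 2) <= eta.
    by rewrite ler_pdivrMl// -expr2.
  lra.
have EWD : Ex P (fun w => `|W T w * D w|) <= eta.
  apply: le_trans (Ex_norm_AMGM eta0 lW lD) _.
  rewrite W1T mulr1.
  have : eta^-1 * Ex P (fun w => D w ^+ 2) <= eta.
    by rewrite ler_pdivrMl// -expr2.
  lra.
have mW := L2_measurable lW; have mV := L2_measurable lV.
have bf X : measurable_fun setT X -> Int P (fun w => f (X w)).
  by move=> mX; apply: (@Int_bounded _ _ _ _ _ K) => //; exact: measurableT_comp.
have bg X : measurable_fun setT X -> Int P (fun w => g (X w)).
  by move=> mX; apply: (@Int_bounded _ _ _ _ _ K) => //; exact: measurableT_comp.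
have lf X : measurable_fun setT X -> L2 P (fun w => f (X w)).
  by move=> mX; apply: (@L2_bounded _ _ _ _ _ K) => //; exact: measurableT_comp.
have iWf : Int P (fun w => W T w * f (W T w)) by apply: Int_L2M => //; exact: lf.
have iVf : Int P (fun w => V w * f (V w)) by apply: Int_L2M => //; exact: lf.
have iW := bg _ mW; have iV := bg _ mV.
have t1 : `|Ex P (fun w => g (W T w)) - Ex P (fun w => g (V w))| <= K *+ 2 * eta.
  rewrite -ExB//.
  apply: (@le_trans _ _ (Ex P (fun w => K *+ 2 * `|D w|))).
    apply: Ex_norm_le; [exact: IntB|exact/IntZ/Int_norm/L2_Int|].
    by move=> w; exact: gL.
  rewrite ExZ; last exact/Int_norm/L2_Int.
  by rewrite ler_wpM2l// mulrn_wge0.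
have t2 : `|Ex P (fun w => V w ^+ 2) - 1| <= 3 * eta.
  rewrite -[X in _ - X]W1T -ExB; [|by case: lV|by case: lW].
  apply: (@le_trans _ _ (Ex P (fun w => D w ^+ 2 + 2 * `|W T w * D w|))).
    apply: Ex_norm_le.
    - by apply: IntB; [case: lV|case: lW].
    - by apply: IntD => //; apply/IntZ/Int_norm/Int_L2M.
    move=> w; rewrite VE.
    have -> : (W T w - D w) ^+ 2 - W T w ^+ 2 = D w ^+ 2 - 2 * (W T w * D w) by ring.
    apply: le_trans (ler_normB _ _) _.
    by rewrite ger0_norm ?sqr_ge0// normrM (ger0_norm (ler0n _ 2)).
  rewrite ExD//; last by apply/IntZ/Int_norm/Int_L2M.
  rewrite ExZ; last by apply/Int_norm/Int_L2M.
  have eta2 : eta ^+ 2 <= eta by rewrite expr2 ler_piMl// ltW.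
  apply: le_trans (lerD (le_trans ED2 eta2) (ler_wpM2l _ EWD)) _ => //.
  lra.
have t3 : `|Ex P (fun w => V w * f (V w)) -
    Ex P (fun w => V w ^+ 2) * Ex P (fun w => g (V w))| <= C0 / Num.sqrt T%:R.
  have := Ndep_stein (c := fun t => u T * b t) (kap := kT) (B := Bx) (K := K)
    Gm ind Afar T mxi xiB xi0 ckT fK gK mf mg tfg.
  move=> h; apply: le_trans h _.
  rewrite /C0 /kT -/n1 -/n2 le_eqVlt; apply/orP; left; apply/eqP.
  have -> : (kap / Num.sqrt T%:R * B) ^+ 3 = (B * kap) ^+ 3 / (T%:R * Num.sqrt T%:R).
    rewrite -{2}(sqr_sqrtr (ltW TR)); field; by rewrite gt_eqF.
  by field; rewrite !gt_eqF.
have t4 : `|Ex P (fun w => V w * f (V w)) - Ex P (fun w => W T w * f (W T w))| <= 3 * K * eta.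
  rewrite -ExB//.
  apply: (@le_trans _ _ (Ex P (fun w => K * `|D w| + K *+ 2 * `|W T w * D w|))).
    apply: Ex_norm_le; [exact: IntB| |].
      by apply: IntD; apply/IntZ/Int_norm; [exact: L2_Int|exact: Int_L2M].
    move=> w; have -> : V w * f (V w) - W T w * f (W T w) =
      - (D w) * f (V w) + W T w * (f (V w) - f (W T w)) by rewrite /D; ring.
    apply: le_trans (ler_normD _ _) _; apply: lerD.
      by rewrite normrM normrN mulrC ler_wpM2r.
    rewrite !normrM mulrCA ler_wpM2l//.
    by apply: le_trans (fL _ _) _; rewrite distrC.
  rewrite ExD; [|by apply/IntZ/Int_norm; exact: L2_Int|by apply/IntZ/Int_norm; exact: Int_L2M].
  rewrite ExZ; last by apply/Int_norm; exact: L2_Int.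
  rewrite ExZ; last by apply/Int_norm; exact: Int_L2M.
  apply: le_trans (lerD (ler_wpM2l K0 ED1) (ler_wpM2l _ EWD)) _.
    by rewrite mulrn_wge0.
  by rewrite mulr2n; lra.
have t5 : C0 / Num.sqrt T%:R <= eta.
  rewrite ler_pdivrMr// mulrC -ler_pdivrMr//.
  rewrite -[leLHS]ger0_norm; last by rewrite divr_ge0// ltW.
  rewrite -sqrtr_sqr ler_sqrt//.
  near: T; exact: nbhs_infty_ger.
have Kg : `|Ex P (fun w => g (V w))| <= K.
  rewrite -[leRHS](Ex_cst P); apply: Ex_norm_le => //; exact: Int_cst.
rewrite sub0r normrN ExB//.
(* The expectation for [W] is that for [V] plus two replacement errors. In the Stein identity of [V]
   the second moment is traded for 1, the second moment of [W]. *)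
have -> : Ex P (fun w => g (W T w)) - Ex P (fun w => W T w * f (W T w)) =
  (Ex P (fun w => g (W T w)) - Ex P (fun w => g (V w)))
  - (Ex P (fun w => V w ^+ 2) - 1) * Ex P (fun w => g (V w))
  - (Ex P (fun w => V w * f (V w)) -
    Ex P (fun w => V w ^+ 2) * Ex P (fun w => g (V w)))
  + (Ex P (fun w => V w * f (V w)) - Ex P (fun w => W T w * f (W T w))) by ring.
apply: le_trans (ler_normD _ _) _.
apply: le_trans (lerD (ler_normB _ _) (lexx _)) _.
apply: le_trans (lerD (lerD (ler_normB _ _) (lexx _)) (lexx _)) _.
have t2' : `|(Ex P (fun w => V w ^+ 2) - 1) * Ex P (fun w => g (V w))| <= 3 * eta * K.
  by rewrite normrM ler_pM.
rewrite mulr2n in t1.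
apply: le_trans (lerD (lerD (lerD t1 t2') (le_trans t3 t5)) t4) _.
apply: le_trans etaeps; have : 0 <= K * eta by rewrite mulr_ge0// ltW.
lra.
Unshelve. all: by end_near. Qed.

End SteinCLT.

(** * From Stein's equation to convergence of distribution functions *)

Section CdfSandwich.
Context {R : realType} {dT : measure_display} {Omega : measurableType dT}
  (P : probability Omega R).

Lemma ncdf_lip (y e : R) : 0 <= e -> ncdf (y + e) - ncdf y <= normal_peak 1 * e.
Proof.
move=> e0; have [c _ ->] := is_derive_MVT y (y + e) is_derive_ncdf.
have -> : y + e - y = e by ring.
by rewrite ler_wpM2r// normal_pdf_ub// oner_neq0.
Qed.

Lemma measurable_le_set (X : Omega -> R) (y : R) : measurable_fun setT X ->
  measurable [set w | X w <= y].
Proof.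
move=> mX; have -> : [set w | X w <= y] = setT `&` X @^-1` `]-oo, y].
  by apply/seteqP; split => w /=; rewrite in_itv/= => // -[].
exact: mX.
Qed.

Lemma measurable_gt_set (X : Omega -> R) (y : R) : measurable_fun setT X ->
  measurable [set w | y < X w].
Proof.
move=> mX; have -> : [set w | y < X w] = setT `&` X @^-1` `]y, +oo[.
  by apply/seteqP; split => w /=; rewrite in_itv/= andbT => // -[].
exact: mX.
Qed.

Lemma indic_bool (b : Omega -> bool) w : \1_[set w | b w] w = (b w)%:R :> R.
Proof. by rewrite indicE; congr (_ : bool)%:R; apply/idP/idP; rewrite inE. Qed.

Variables (W Z : nat -> Omega -> R).
Hypothesis lW : forall T, L2 P (W T).
Hypothesis mZ : \forall T \near \oo, measurable_fun setT (Z T).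
Hypothesis stein : forall (f g : R -> R) K, taylor2 setT f g K ->
  (forall x, `|f x| <= K) -> (forall x, `|g x| <= K) ->
  (fun T => Ex P (fun w => g (W T w) - W T w * f (W T w))) @ \oo --> (0 : R).
Hypothesis ZW : forall e, 0 < e ->
  (fun T => fine (P [set w | e < `|Z T w - W T w|])) @ \oo --> (0 : R).

(** Off the event [|Z - W| > e], the indicator of [Z <= y] lies between a smoothed indicator of [W]
    descending over [[y - 2e, y - e]] and one descending over [[y + e, y + 2e]]. Their means differ
    from the constants [c'] and [c] by Stein expectations tending to 0. *)
Lemma stein_cvg_dist : cvg_dist_std_normal P Z.
Proof.
move=> y; rewrite -EFin_ncdf; apply/fine_cvgP; split.
  near=> T; have mZT : measurable_fun setT (Z T) by near: T; exact: mZ.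
  by rewrite fin_num_measure//; exact: measurable_le_set.
apply/cvgrPdist_le => eps eps0.
pose pk : R := normal_peak 1.
have pk0 : 0 < pk by rewrite normal_peak_gt0// oner_neq0.
(* The density is at most [pk], so shifting [y] by [2 e] changes [ncdf] by at most [eps / 2]. The
   Stein expectation and the exceptional event take [eps / 4] each. *)
pose e := eps / (4 * pk).
have e0 : 0 < e by rewrite divr_gt0// mulr_gt0.
have pke : pk * (e + e) <= eps / 2.
  by rewrite /e le_eqVlt; apply/orP; left; apply/eqP; field; rewrite gt_eqF.
have y1 : y + e < y + e + e by rewrite ltrDl.
have y2 : y - e - e < y - e by rewrite ltrBlDr ltrDl.
have [f [g [c [K [/andP[_ cz] fK gK tfg h]]]]] := stein_solution y1.
have [f' [g' [c' [K' [/andP[cy _] fK' gK' tfg' h']]]]] := stein_solution y2.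
have up : ncdf (y + e + e) <= ncdf y + eps / 2.
  have := @ncdf_lip y (e + e) (ltac:(by rewrite addr_ge0// ltW)); rewrite addrA -/pk; lra.
have dn : ncdf y - eps / 2 <= ncdf (y - e - e).
  have := @ncdf_lip (y - e - e) (e + e) (ltac:(by rewrite addr_ge0// ltW)).
  have -> : y - e - e + (e + e) = y by ring.
  by rewrite -/pk; lra.
have eps40 : 0 < eps / 4 by rewrite divr_gt0.
near=> T.
have mZT : measurable_fun setT (Z T) by near: T; exact: mZ.
have mWT := L2_measurable (lW T).
have s1 : `|0 - Ex P (fun w => g (W T w) - W T w * f (W T w))| <= eps / 4.
  near: T; move/cvgrPdist_le: (stein tfg fK gK); exact.
have s2 : `|0 - Ex P (fun w => g' (W T w) - W T w * f' (W T w))| <= eps / 4.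
  near: T; move/cvgrPdist_le: (stein tfg' fK' gK'); exact.
have s3 : `|0 - fine (P [set w | e < `|Z T w - W T w|])| <= eps / 4.
  near: T; move/cvgrPdist_le: (ZW e0); exact.
rewrite sub0r normrN in s1; rewrite sub0r normrN in s2; rewrite sub0r normrN in s3.
have mA : measurable [set w | Z T w <= y] by exact: measurable_le_set.
have mE : measurable [set w | e < `|Z T w - W T w|].
  apply: (@measurable_gt_set (fun w => `|Z T w - W T w|)).
  by apply: measurableT_comp => //; exact: measurable_funB.
rewrite -(Ex_indic P mE) in s3; rewrite /comp -(Ex_indic P mA).
have intS f0 g0 K0 : taylor2 setT f0 g0 K0 -> (forall x, `|f0 x| <= K0) ->
    (forall x, `|g0 x| <= K0) -> Int P (fun w => g0 (W T w) - W T w * f0 (W T w)).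
  move=> tf fK0 gK0.
  have mf := lip_measurable (taylor2_lip_base tf fK0 gK0).
  have mg : measurable_fun setT g0.
    by apply: (@lip_measurable _ _ (K0 *+ 2)) => u v; exact: taylor2_lip tf _ _.
  apply: IntB.
    by apply: (@Int_bounded _ _ _ _ _ K0) => //; exact: measurableT_comp.
  apply: Int_L2M => //.
  by apply: (@L2_bounded _ _ _ _ _ K0) => //; exact: measurableT_comp.
have i1 := intS _ _ _ tfg fK gK; have i2 := intS _ _ _ tfg' fK' gK'.
have iA := Int_indic P mA; have iE := Int_indic P mE.
have ub : Ex P (\1_[set w | Z T w <= y]) <= c + Ex P (fun w => g (W T w) - W T w * f (W T w))
    + Ex P (\1_[set w | e < `|Z T w - W T w|]).
  rewrite -[X in X + _ + _](Ex_cst P) -ExD//; last exact: Int_cst.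
  rewrite -ExD//; last by apply: IntD => //; exact: Int_cst.
  apply: Ex_le => //; first by apply: IntD => //; apply: IntD => //; exact: Int_cst.
  move=> w; have /andP[hw _] := h (W T w); rewrite addrA.
  rewrite !indic_bool.
  have [zy|zy] := leP (Z T w) y; last first.
    by rewrite addr_ge0// (le_trans _ hw).
  have [we|we] := leP `|Z T w - W T w| e; last first.
    by rewrite lerDr (le_trans _ hw).
  rewrite addr0; apply: le_trans hw.
  have -> : W T w <= y + e by move: we; rewrite ler_norml => /andP[]; lra.
  by [].
have lb : c' + Ex P (fun w => g' (W T w) - W T w * f' (W T w))
    - Ex P (\1_[set w | e < `|Z T w - W T w|]) <= Ex P (\1_[set w | Z T w <= y]).
  rewrite -[X in X + _ - _](Ex_cst P) -ExD//; last exact: Int_cst.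
  rewrite -ExB//; last by apply: IntD => //; exact: Int_cst.
  apply: Ex_le => //; first by apply: IntB => //; apply: IntD => //; exact: Int_cst.
  move=> w; have /andP[_ hw] := h' (W T w); rewrite addrA.
  have b1 : (W T w <= y - e)%R%:R <= 1 :> R by case: (W T w <= y - e).
  rewrite !indic_bool.
  have [zy|zy] := leP (Z T w) y.
    by rewrite lerBlDr (le_trans hw)// (le_trans b1)// lerDl.
  have [we|we] := leP `|Z T w - W T w| e; last first.
    by rewrite lerBlDr add0r (le_trans hw).
  rewrite subr0; apply: le_trans hw _.
  have -> : (W T w <= y - e) = false.
    apply/negbTE; rewrite -ltNge; move: we; rewrite ler_norml => /andP[]; lra.
  by [].
rewrite ler_norml in s1; rewrite ler_norml in s2; rewrite ler_norml in s3.
rewrite ler_norml.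
by apply/andP; split; lra.
Unshelve. all: by end_near. Qed.

End CdfSandwich.

(** * Approximation of the error process *)

Section MeasurableLim.
Context {R : realType} {dT : measure_display} {Omega : measurableType dT}.

(** The Cauchy criterion with countably many tolerances, so that the set of convergence becomes a
    countable combination of measurable sets. *)
Lemma cvgn_cauchyE (u : nat -> R) : cvgn u <->
  forall k : nat, exists N, forall n m, (N <= n)%N -> (N <= m)%N ->
     `|u n - u m| <= k.+1%:R^-1.
Proof.
split=> [cu k|h].
  have k0 : 0 < (k.+1%:R^-1) / 2 :> R by rewrite divr_gt0// invr_gt0.
  move/cvgrPdist_le: (cu) => /(_ _ k0) [N _ hN].
  exists N => n m Nn Nm.
  have -> : u n - u m = (limn u - u m) - (limn u - u n) by ring.
  apply: le_trans (ler_normB _ _) _.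
  have h1 : `|limn u - u n| <= k.+1%:R^-1 / 2 := hN _ Nn.
  have h2 : `|limn u - u m| <= k.+1%:R^-1 / 2 := hN _ Nm.
  by apply: le_trans (lerD h2 h1) _; rewrite -splitr.
apply/cauchy_cvgP; apply: cauchy_exP => e e0.
have [k ke] : exists k : nat, k.+1%:R^-1 < e.
  have [k _ hk] := near_infty_natSinv_lt (PosNum e0).
  by exists k; exact: (hk k (leqnn k)).
have [N hN] := h k.
exists (u N); exists N => // n /= Nn.
by rewrite /ball/=; apply: le_lt_trans ke; exact: hN.
Qed.

(** The sequence may diverge at some points. On the measurable set [D] of convergence this is the
    measurability of pointwise limits; off [D] the limit operator returns the constant default
    [point]. *)
Lemma measurable_limn (h : nat -> Omega -> R) :
  (forall n, measurable_fun setT (h n)) -> measurable_fun setT (fun w => limn (h^~ w)).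
Proof.
move=> mh.
pose D := [set w | cvgn (h^~ w)].
have DE : D = \bigcap_k \bigcup_N \bigcap_n \bigcap_m
    [set w | `|h (N + n)%N w - h (N + m)%N w| <= k.+1%:R^-1].
  apply/seteqP; split => w.
    move=> /cvgn_cauchyE hw k _; have [N hN] := hw k.
    by exists N => // n _ m _ /=; apply: hN; exact: leq_addr.
  move=> hw; apply/cvgn_cauchyE => k; have [N _ hN] := hw k I.
  exists N => n m Nn Nm; have := hN (n - N)%N I (m - N)%N I.
  by rewrite /= !subnKC.
have mD : measurable D.
  rewrite DE; apply: bigcapT_measurable => k; apply: bigcupT_measurable => N.
  apply: bigcapT_measurable => n; apply: bigcapT_measurable => m.
  have mf : measurable_fun setT (fun w => `|h (N + n)%N w - h (N + m)%N w|).
    by apply: measurableT_comp => //; exact: measurable_funB.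
  rewrite (_ : [set w | _] = setT `&` (fun w => `|h (N + n)%N w - h (N + m)%N w|) @^-1` `]-oo, k.+1%:R^-1]).
    exact: mf.
  by apply/seteqP; split => w /=; rewrite in_itv/= => // -[].
rewrite -(setUv D); apply/measurable_funU => //; first exact: measurableC.
split.
  apply: (@measurable_fun_cvg _ _ _ D h) => // n.
  exact: measurable_funTS.
apply: (@eq_measurable_fun _ _ _ _ _ (fun=> point)) => // w.
rewrite inE => /= nD; apply/esym.
rewrite /lim /lim_in /= /get; apply: xgetPN => l hl.
by apply: nD; apply/cvg_ex; exists l.
Qed.

End MeasurableLim.

(** * Lipschitz functions of random matrices *)

Section LipschitzMatrix.
Context {R : realType}.

Definition l1 d n (A : 'M[R]_(d, n)) : R := \sum_i \sum_j `|A i j|.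

Lemma l1_ge0 d n (A : 'M[R]_(d, n)) : 0 <= l1 A.
Proof. by apply: sumr_ge0 => i _; apply: sumr_ge0. Qed.

Lemma sqr_sum_le (I : finType) (a : I -> R) : (forall i, 0 <= a i) ->
  \sum_i a i ^+ 2 <= (\sum_i a i) ^+ 2.
Proof.
move=> a0; rewrite expr2 big_distrlr/=; apply: ler_sum => i _.
rewrite (bigD1 i)//= -expr2 lerDl; apply: sumr_ge0 => j _.
exact: mulr_ge0.
Qed.

Lemma frob_le_l1 d n (A : 'M[R]_(d, n)) : frob A <= l1 A.
Proof.
rewrite /frob -[leRHS]ger0_norm ?l1_ge0// -sqrtr_sqr ler_sqrt ?sqr_ge0//.
rewrite /l1 !pair_bigA/=.
apply: le_trans (sqr_sum_le (a := fun p : 'I_d * 'I_n => `|A p.1 p.2|) _) => //.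
by apply: ler_sum => p _; rewrite real_normK// num_real.
Qed.

Lemma rat_dense_l1 d n (A : 'M[R]_(d, n)) (e : R) : 0 < e ->
  exists q : 'M[rat]_(d, n), l1 (A - map_mx ratr q) <= e.
Proof.
move=> e0; pose e1 := e / (d%:R * n%:R + 1).
have den0 : 0 < d%:R * n%:R + 1 :> R by rewrite ltr_wpDl// mulr_ge0.
have e10 : 0 < e1 by rewrite divr_gt0.
have h i j : exists q : rat, `|A i j - ratr q| <= e1.
  have [q] := rat_in_itvoo (ltac:(by rewrite ltrDl) : A i j < A i j + e1).
  rewrite in_itv/= => /andP[h1 h2]; exists q.
  by rewrite distrC ger0_norm; lra.
exists (\matrix_(i, j) sval (cid (h i j))).
apply: (@le_trans _ _ (\sum_(i < d) \sum_(j < n) e1)).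
  apply: ler_sum => i _; apply: ler_sum => j _.
  by rewrite !mxE; case: (cid _).
have e1E : e1 * (d%:R * n%:R + 1) = e by rewrite divfK// gt_eqF.
rewrite !sumr_const !card_ord -mulr_natr -[X in X * _]mulr_natr.
have -> : e1 * n%:R * d%:R = e - e1 by rewrite -e1E; ring.
by rewrite gerBl ltW.
Qed.

(** By the Lipschitz bound, [H] is the infimum over rational matrices [q] of the cones
    [H q + L' l1 (A - q)]. The event [H (A w) < c] is therefore a countable union of events on which
    one cone lies below [c]. The measurable structure of [Omega] is arbitrary, so the lemma also
    applies to sub-sigma-algebras. *)
Lemma measurable_lipschitz_mx {dT : measure_display} {Omega : measurableType dT}
  d n (H : 'M[R]_(d, n) -> R) (L : R) (A : Omega -> 'M[R]_(d, n)) :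
  (forall X Y, `|H X - H Y| <= L * l1 (X - Y)) ->
  (forall i j, measurable_fun setT (fun w => A w i j)) ->
  measurable_fun setT (fun w => H (A w)).
Proof.
move=> HL0 mA.
pose L' := `|L| + 1.
have L'0 : 0 < L' by rewrite ltr_wpDl.
have HL X Y : `|H X - H Y| <= L' * l1 (X - Y).
  apply: le_trans (HL0 X Y) _; rewrite ler_wpM2r ?l1_ge0//.
  by rewrite (le_trans (ler_norm _))// lerDl.
apply: (measurability _ (RGenInftyO.measurableE R)) => // _ [_ [c ->] <-].
pose F (q : 'M[rat]_(d, n)) (w : Omega) := H (map_mx ratr q) + L' * l1 (A w - map_mx ratr q).
have mF q : measurable_fun setT (F q).
  apply: measurable_funD => //; apply: measurable_funM => //.
  apply: measurable_sum => i; apply: measurable_sum => j.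
  apply: measurableT_comp => //.
  under eq_fun do rewrite !mxE.
  exact: measurable_funB.
rewrite (_ : _ `&` _ = \bigcup_k (if unpickle k is Some q then
   setT `&` F q @^-1` `]-oo, c[ else set0)).
  apply: bigcupT_measurable => k; case: unpickle => // q.
  exact: mF.
apply/seteqP; split => w.
  move=> [_ /=]; rewrite in_itv/= => Hc.
  (* With [q] this close, the cone at [q] exceeds [H (A w)] by at most two thirds of the gap to
     [c]. *)
  have e0 : 0 < (c - H (A w)) / (3 * L') by rewrite divr_gt0 ?subr_gt0// mulr_gt0.
  have [q hq] := rat_dense_l1 (A w) e0.
  exists (pickle q) => //; rewrite pickleK; split => //=.
  rewrite in_itv/= /F.
  have := HL (map_mx ratr q) (A w).
  have lN : l1 (map_mx ratr q - A w) = l1 (A w - map_mx ratr q).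
    by apply: eq_bigr => i _; apply: eq_bigr => j _; rewrite !mxE distrC.
  rewrite lN ler_norml => /andP[_ h2].
  move: hq; rewrite ler_pdivlMr ?mulr_gt0// => hq.
  have : l1 (A w - map_mx ratr q) * (3 * L') = 3 * (L' * l1 (A w - map_mx ratr q)) by ring.
  lra.
move=> [k _]; case: unpickle => // q [_ /=]; rewrite !in_itv/= /F => Fc.
split => //=; apply: le_lt_trans Fc.
have := HL (A w) (map_mx ratr q); rewrite ler_norml => /andP[_]; lra.
Qed.

End LipschitzMatrix.

(** * Mean square tails of dominated random series *)

Section WeightedSeries.
Context {R : realType}.

(** Induction on the list. A new term needs [2 y S <= Q + C y^2], which follows from [S^2 <= C Q]
    and a square; total weight 0 is treated apart, since then [S = 0]. *)
Lemma weighted_CS (I : Type) (s : seq I) (c y : I -> R) : (forall i, 0 <= c i) ->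
  (\sum_(i <- s) c i * y i) ^+ 2 <= (\sum_(i <- s) c i) * (\sum_(i <- s) c i * y i ^+ 2).
Proof.
move=> c0; elim: s => [|i s IH]; first by rewrite !big_nil expr0n/= mulr0.
rewrite !big_cons; set S := \sum_(j <- s) c j * y j in IH *.
set Cs := \sum_(j <- s) c j in IH *; set Q := \sum_(j <- s) _ in IH *.
have C0 : 0 <= Cs by apply: sumr_ge0.
have Q0 : 0 <= Q by apply: sumr_ge0 => j _; rewrite mulr_ge0// sqr_ge0.
have h : 2 * (y i * S) <= Q + Cs * y i ^+ 2.
  have [C00|Cn0] := eqVneq Cs 0.
    have S0 : S = 0.
      move: IH; rewrite C00 mul0r => S2; apply/eqP; rewrite -sqrf_eq0.
      by rewrite eq_le S2 sqr_ge0.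
    by rewrite S0 mulr0 mulr0 addr_ge0// mulr_ge0// sqr_ge0.
  have Cp : 0 < Cs by rewrite lt_def Cn0.
  rewrite -(ler_pM2l Cp).
  have := sqr_ge0 (Cs * y i - S); nra.
have := ler_wpM2l (c0 i) h; nra.
Qed.

Context {dT : measure_display} {Omega : measurableType dT} (P : probability Omega R).
Variables (z y : nat -> Omega -> R) (c : nat -> R) (V tail : R) (M : nat).
Hypothesis mz : forall j, measurable_fun setT (z j).
Hypothesis ly : forall j, L2 P (y j).
Hypothesis c0 : forall j, 0 <= c j.
Hypothesis zy : forall j w, `|z j w| <= c j * y j w.
Hypothesis yV : forall j, Ex P (fun w => y j w ^+ 2) <= V.
Hypothesis tail0 : 0 < tail.
Hypothesis ctail : forall n, \sum_(M <= j < n) c j <= tail.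

Let S w := limn (fun n => \sum_(0 <= j < n) z j w).
Let SM w := \sum_(0 <= j < M) z j w.
Let Q w := (\sum_(n <oo) (c (M + n)%N * y (M + n)%N w ^+ 2)%:E)%E.

Let Qterm_ge0 n w : (0 <= (c (M + n)%N * y (M + n)%N w ^+ 2)%:E)%E.
Proof. by rewrite lee_fin mulr_ge0// sqr_ge0. Qed.

Let mQterm n : measurable_fun setT (fun w => (c (M + n)%N * y (M + n)%N w ^+ 2)%:E).
Proof.
apply/measurable_EFinP; apply: measurable_funM => //; apply: measurable_funX.
by have [] := ly (M + n)%N.
Qed.

Let partial_sq n q w : (Q w <= q%:E)%E ->
  (\sum_(M <= j < n) `|z j w|) ^+ 2 <= tail * q.
Proof.
move=> Qq.
apply: (@le_trans _ _ ((\sum_(M <= j < n) c j * y j w) ^+ 2)).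
  rewrite lerXn2r ?nnegrE ?sumr_ge0//; last by apply: ler_sum => j _; exact: zy.
  by move=> j _; apply: le_trans (zy j w).
apply: le_trans (weighted_CS _ _ c0) _.
have c1 : 0 <= \sum_(M <= j < n) c j by apply: sumr_ge0.
have c2 : 0 <= \sum_(M <= j < n) c j * y j w ^+ 2.
  by apply: sumr_ge0 => j _; rewrite mulr_ge0// sqr_ge0.
apply: ler_pM => //.
rewrite -lee_fin; apply: le_trans Qq.
rewrite -sumEFin -{1}(addn0 M) addnC big_addn.
apply: le_trans; last first.
  by apply: (@nneseries_lim_ge _ _ xpredT 0 (n - M)%N) => k _ _; exact: Qterm_ge0.
rewrite le_eqVlt; apply/orP; left; apply/eqP; apply: eq_bigr => k _.
by rewrite addnC.
Qed.

Let diff_sq q w : (Q w <= q%:E)%E -> (S w - SM w) ^+ 2 <= tail * q.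
Proof.
move=> Qq.
have q0 : 0 <= tail * q by apply: le_trans (partial_sq 0 Qq); exact: sqr_ge0.
have bnd n : \sum_(M <= j < n) `|z j w| <= Num.sqrt (tail * q).
  rewrite -[leLHS]ger0_norm ?sumr_ge0// -sqrtr_sqr ler_sqrt//.
  exact: partial_sq.
have cS : cvgn (fun n => \sum_(0 <= j < n) z j w).
  apply: (@normed_cvg _ R^o (z^~ w)); apply: nondecreasing_is_cvgn.
    move=> i j ij; rewrite /series/= [leRHS](big_cat_nat (n := i))//= lerDl.
    exact: sumr_ge0.
  exists (\sum_(0 <= j < M) `|z j w| + Num.sqrt (tail * q)) => _ [n _ <-].
  rewrite /series/=; have [nM|Mn] := leqP n M.
    rewrite [X in _ <= X + _](big_cat_nat (n := n))//= -addrA lerDl.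
    by rewrite addr_ge0 ?sqrtr_ge0// sumr_ge0.
  by rewrite [leLHS](big_cat_nat (n := M)) ?(ltnW Mn)//= lerD2l.
have : `|S w - SM w| <= Num.sqrt (tail * q).
  have cd : (fun n => `|\sum_(0 <= j < n) z j w - SM w|) @ \oo --> `|S w - SM w|.
    by apply: cvg_norm; apply: cvgB => //; exact: cvg_cst.
  apply: (cvgr_to_le cd); near=> n.
  have Mn : (M <= n)%N by near: n; exact: nbhs_infty_ge.
  rewrite [X in X - _](big_cat_nat (n := M))//= -/(SM w) addrAC subrr add0r.
  by apply: le_trans (bnd n); exact: ler_norm_sum.
by rewrite -[leLHS]sqrtr_sqr ler_sqrt.
Unshelve. all: by end_near. Qed.

Let measurable_S : measurable_fun setT S.
Proof. by apply: measurable_limn => n; exact: measurable_sum. Qed.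

Let mQ : measurable_fun setT Q.
Proof.
have := @ge0_emeasurable_sum _ Omega R setT
  (fun n w => (c (M + n)%N * y (M + n)%N w ^+ 2)%:E) xpredT.
by apply => // n w _ _; exact: Qterm_ge0.
Qed.

(** Where the weighted sum of squares [Q] is finite, the Cauchy-Schwarz inequality bounds the
    absolute partial sums past [M]; the series then converges and its squared tail is at most
    [tail * Q]. Where [Q] is infinite that bound is void, whatever the limit operator returns. The
    mean of [Q] is at most [tail * V]. *)
Lemma series_tail_L2 : L2 P (fun w => S w - SM w) /\
  Ex P (fun w => (S w - SM w) ^+ 2) <= tail ^+ 2 * V.
Proof.
have mSM : measurable_fun setT SM by exact: measurable_sum.
have mD : measurable_fun setT (fun w => S w - SM w) by exact: measurable_funB.
have mD2 : measurable_fun setT (fun w => (S w - SM w) ^+ 2) by exact: measurable_funX.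
have Q0 w : (0 <= Q w)%E by apply: nneseries_ge0 => n _ _; exact: Qterm_ge0.
have V0 : 0 <= V by apply: le_trans (yV 0%N); exact: Ex_sqr_ge0.
have iQ : (\int[P]_w Q w <= (tail * V)%:E)%E.
  rewrite integral_nneseries//.
  have term n : (\int[P]_w (c (M + n)%N * y (M + n)%N w ^+ 2)%:E =
      (c (M + n)%N * Ex P (fun w => y (M + n)%N w ^+ 2))%:E)%E.
    have [_ iy] := ly (M + n)%N.
    rewrite -ExZ// /Ex /Rintegral fineK//.
    by have := integrable_fin_num measurableT (IntZ (c (M + n)%N) iy).
  under eq_eseriesr do rewrite term.
  apply: lime_le.
    apply: is_cvg_nneseries => n _ _.
    by rewrite lee_fin mulr_ge0// Ex_sqr_ge0.
  apply: nearW => n; rewrite sumEFin lee_fin.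
  apply: (@le_trans _ _ (\sum_(0 <= i < n) c (M + i)%N * V)).
    by apply: ler_sum => i _; rewrite ler_wpM2l.
  rewrite -mulr_suml ler_wpM2r//; apply: le_trans (ctail (M + n)%N).
  have -> : \sum_(M <= j < M + n) c j = \sum_(0 <= i < n) c (M + i)%N.
    by rewrite -{1}[M]add0n big_addn addKn; apply: eq_bigr => k _; rewrite addnC.
  by [].
have le_int : (\int[P]_w ((S w - SM w) ^+ 2)%:E <= (tail ^+ 2 * V)%:E)%E.
  apply: (@le_trans _ _ (\int[P]_w (tail%:E * Q w))%E).
    apply: ge0_le_integral => //.
    - by move=> w _; rewrite lee_fin sqr_ge0.
    - exact/measurable_EFinP.
    - exact: measurable_funeM.
    move=> w _; case: (Q w) (Q0 w) (@diff_sq^~ w) => [q| |]//.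
      by move=> _ h; rewrite -EFinM lee_fin; exact: h.
    by move=> _ _; rewrite gt0_muley ?lte_fin// leey.
  rewrite ge0_integralZl// ?lee_fin ?(ltW tail0)//.
  rewrite expr2 -mulrA EFinM lee_wpmul2l// lee_fin; exact: ltW.
have iD : Int P (fun w => (S w - SM w) ^+ 2).
  apply/integrableP; split; first exact/measurable_EFinP.
  rewrite (eq_integral (fun w => ((S w - SM w) ^+ 2)%:E)) => [|w _]; last first.
    by rewrite /= ger0_norm// sqr_ge0.
  by apply: le_lt_trans le_int _; rewrite ltry.
split; first by split.
rewrite -lee_fin /Ex /Rintegral fineK//.
exact: (integrable_fin_num measurableT iD).
Qed.

End WeightedSeries.

(** * Second moments of sums, centring and clipping *)

Section MomentTools.
Context {R : realType} {dT : measure_display} {Omega : measurableType dT}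
  (P : probability Omega R).
Implicit Types (X Y : Omega -> R).

(** The triangle inequality in L2, written with squares: terms of norm at most [sqrt g * w i] are
    combined by the weighted Cauchy-Schwarz inequality applied to [Y i / w i]. *)
Lemma Ex_sqr_wsum (I : Type) (s : seq I) (Y : I -> Omega -> R) (w : I -> R) g :
  (forall i, L2 P (Y i)) -> (forall i, 0 < w i) ->
  (forall i, Ex P (fun o => Y i o ^+ 2) <= g * w i ^+ 2) ->
  Ex P (fun o => (\sum_(i <- s) Y i o) ^+ 2) <= g * (\sum_(i <- s) w i) ^+ 2.
Proof.
move=> lY w0 Yg.
have iY i : Int P (fun o => Y i o ^+ 2) by have [] := lY i.
apply: (@le_trans _ _ (Ex P (fun o => (\sum_(i <- s) w i) *
    (\sum_(i <- s) (w i)^-1 * Y i o ^+ 2)))).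
  apply: Ex_le.
  - by have [] := @L2_sum _ _ _ P _ s xpredT Y (fun i _ => lY i).
  - by apply: IntZ; apply: Int_sum => i _; exact: IntZ.
  move=> o.
  have := @weighted_CS _ _ s w (fun i => (w i)^-1 * Y i o) (fun i => ltW (w0 i)).
  under eq_bigr do rewrite mulVKf ?gt_eqF//.
  under [X in _ * X]eq_bigr do rewrite exprMn mulrA expr2 mulVKf ?gt_eqF//.
  by [].
rewrite ExZ; last by apply: Int_sum => i _; exact: IntZ.
rewrite expr2 mulrCA ler_wpM2l ?sumr_ge0// => [i _|]; first exact: ltW.
rewrite Ex_sum => [|i _]; last exact: IntZ.
rewrite mulr_sumr; apply: ler_sum => i _.
rewrite ExZ// ler_pdivrMl// mulrCA -expr2; exact: Yg.
Qed.

Lemma Ex_sqr_sum (n : nat) (Y : 'I_n -> Omega -> R) v :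
  (forall i, L2 P (Y i)) -> (forall i, Ex P (fun o => Y i o ^+ 2) <= v) ->
  Ex P (fun o => (\sum_(i < n) Y i o) ^+ 2) <= n%:R ^+ 2 * v.
Proof.
move=> lY Yv.
have := @Ex_sqr_wsum _ (index_enum 'I_n) Y (fun=> 1) v lY (fun=> ltr01).
move=> h; apply: le_trans (h _) _ => [i|]; first by rewrite expr1n mulr1.
by rewrite sumr_const card_ord mulrC.
Qed.

Lemma Ex_sqr_mono X Y : L2 P X -> L2 P Y -> (forall w, `|X w| <= Y w) ->
  Ex P (fun w => X w ^+ 2) <= Ex P (fun w => Y w ^+ 2).
Proof.
move=> lX lY XY; apply: Ex_le; [by have [] := lX|by have [] := lY|].
move=> w; rewrite -[X w ^+ 2]real_normK ?num_real// lerXn2r ?nnegrE//.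
exact: le_trans (XY w).
Qed.

Lemma Ex_sqr_center X : L2 P X ->
  Ex P (fun w => (X w - Ex P X) ^+ 2) <= Ex P (fun w => X w ^+ 2).
Proof.
move=> lX; have [_ iX2] := lX; have iX := L2_Int lX.
have -> : (fun w => (X w - Ex P X) ^+ 2) =
    (fun w => X w ^+ 2 + - (2 * Ex P X) * X w + Ex P X ^+ 2).
  by apply/funext => w; ring.
rewrite ExD; [|by apply: IntD => //; exact: IntZ|exact: Int_cst].
rewrite ExD//; last exact: IntZ.
rewrite ExZ// Ex_cst.
have := sqr_ge0 (Ex P X); lra.
Qed.

Lemma Ex_center0 X : Int P X -> Ex P (fun w => X w - Ex P X) = 0.
Proof. by move=> iX; rewrite ExB ?Ex_cst ?subrr//; exact: Int_cst. Qed.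

Lemma L2_center X : L2 P X -> L2 P (fun w => X w - Ex P X).
Proof. by move=> lX; apply: L2B => //; exact: L2_cst. Qed.

Lemma expectation_ge0_Int X (K : R) : measurable_fun setT X -> (forall w, 0 <= X w) ->
  ('E_P[X] <= K%:E)%E -> Int P X /\ Ex P X <= K.
Proof.
move=> mX X0; rewrite unlock => h.
have iX : Int P X.
  apply/integrableP; split; first exact/measurable_EFinP.
  rewrite (eq_integral (fun w => (X w)%:E)) => [|w _]; last first.
    by rewrite /= ger0_norm.
  by apply: le_lt_trans h _; rewrite ltry.
split => //; rewrite -lee_fin /Ex /Rintegral fineK//.
exact: (integrable_fin_num measurableT iX).
Qed.

Definition clip (b x : R) : R := Num.max (- b) (Num.min b x).

Lemma clip_le b x : 0 <= b -> `|clip b x| <= b.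
Proof.
by move=> b0; rewrite ler_norml /clip le_max lexx/= ge_max ge_min lexx/= andbT ge0_cp.
Qed.

Lemma measurable_clip b : measurable_fun setT (clip b).
Proof. by apply: measurable_maxr => //; exact: measurable_minr. Qed.

(** The left side vanishes unless [|x| > b]; there it is at most [x ^+ 2] and the factor
    [(|x| / b) ^ dl] is at least 1. *)
Lemma clip_sqr (b x dl : R) : 0 < b -> 0 < dl ->
  (x - clip b x) ^+ 2 <= `|x| `^ (2 + dl) / b `^ dl.
Proof.
move=> b0 dl0.
have bd : 0 < b `^ dl by rewrite powR_gt0.
have [xb|bx] := leP `|x| b.
  have -> : clip b x = x.
    by move: xb; rewrite ler_norml => /andP[h1 h2]; rewrite /clip min_r// max_r.
  by rewrite subrr expr0n/= divr_ge0// powR_ge0.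
have x0 : 0 < `|x| by apply: lt_trans bx.
rewrite ler_pdivlMr// powRD; last by rewrite normr_eq0 -normr_gt0 x0 implybT.
rewrite -[2]/(2%:R) powR_mulrn// real_normK ?num_real//.
apply: ler_pM; rewrite ?sqr_ge0 ?powR_ge0//; last first.
  by rewrite ge0_ler_powR// ?nnegrE ltW.
have [x00|x00] := leP 0 x.
  rewrite ger0_norm// in bx.
  have -> : clip b x = b by rewrite /clip min_l ?(ltW bx)// max_r; lra.
  by nra.
rewrite ltr0_norm// in bx.
have -> : clip b x = - b by rewrite /clip min_r ?max_l; lra.
by nra.
Qed.

Lemma sqr_le_powR (x dl : R) : 0 < dl -> x ^+ 2 <= 1 + `|x| `^ (2 + dl).
Proof.
move=> dl0; have [x1|x1] := leP `|x| 1.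
  rewrite (@le_trans _ _ 1)//; last by rewrite lerDl powR_ge0.
  by rewrite -real_normK ?num_real// expr_le1.
rewrite (@le_trans _ _ (`|x| `^ (2 + dl)))//; last by rewrite lerDr.
rewrite -real_normK ?num_real// -powR_mulrn// ler_powR//; first exact: ltW.
by rewrite lerDl ltW.
Qed.

End MomentTools.

(** * Summable telescoping weights *)

Section Weights.
Context {R : realType}.

(** A substitute for [k ^ -2] whose tail sums telescope. *)
Definition wgt (k : nat) : R := (k.+1%:R * k.+2%:R)^-1.

Lemma wgt_gt0 k : 0 < wgt k. Proof. by rewrite invr_gt0 mulr_gt0. Qed.

Lemma wgtE k : wgt k = k.+1%:R^-1 - k.+2%:R^-1.
Proof.
have k1 : k.+1%:R != 0 :> R by rewrite pnatr_eq0.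
have k2 : k.+1%:R + 1 != 0 :> R by rewrite natr1 pnatr_eq0.
rewrite /wgt -(natr1 k.+1); move: (k.+1%:R : R) k1 k2 => a k1 k2; field.
by rewrite k1 k2.
Qed.

Lemma sum_wgt M n : \sum_(M <= k < n) wgt k <= M.+1%:R^-1.
Proof.
have [Mn|nM] := leqP M n; last by rewrite big_geq ?invr_ge0 ?ler0n// ltnW.
under eq_bigr do rewrite wgtE -opprB.
by rewrite sumrN telescope_sumr// opprB gerBl invr_ge0.
Qed.

Lemma inv_sqr_le_wgt k : k.+1%:R ^- 2 <= 2 * wgt k.
Proof.
rewrite /wgt ler_pdivlMr ?mulr_gt0// mulrC ler_pdivrMr ?exprn_gt0//.
have : (1 : R) <= k.+1%:R by rewrite ler1n.
by rewrite -(natr1 k.+1); nra.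
Qed.

End Weights.

(** * Truncation in the lag and clipping of the innovations *)

Section ModelApprox.
Context {R : realType} {dT : measure_display} {Omega : measurableType dT}
  (P : probability Omega R).
Context (q d m L : nat) (s : nat -> 'rV[R]_q) (r : 'I_L -> 'rV[R]_q)
  (dist : 'rV[R]_q -> 'rV[R]_q -> R) (phi : 'I_d -> 'I_L -> R)
  (C : 'I_L.+1 -> nat -> 'M[R]_d) (inn : 'I_L.+1 -> int -> Omega -> 'cV[R]_d)
  (H : 'I_d -> 'M[R]_(d, m.+1) -> R).

(** One index per innovation vector: coordinates of the same vector may be dependent. *)
Definition inn_fam (i : 'I_L.+1 * int) : set (Omega -> R) :=
  [set X | exists nu : 'I_d, X = fun w => inn i.1 i.2 w nu ord0].

Definition Ftr (e : 'I_L.+1 -> int -> Omega -> 'cV[R]_d) (M : nat)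
    (l : 'I_L.+1) (t : int) (nu : 'I_d) (w : Omega) : R :=
  \sum_(0 <= j < M) (C l j *m e l (t - j%:Z) w) nu 0.

(** The matrix entering [H], for arbitrary linear processes [F], so that the true, the truncated and
    the clipped processes are compared by the same lemmas. *)
Definition Umx (F : 'I_L.+1 -> int -> 'I_d -> Omega -> R) (t : nat) (w : Omega) :
    'M[R]_(d, m.+1) :=
  \matrix_(nu < d, k < m.+1)
   (\sum_(l < L) phi nu l * dist (s t) (r l) * F (lift ord0 l) (t%:Z - k%:Z) nu w
    + F ord0 (t%:Z - k%:Z) nu w).

Lemma Umat_Umx t w :
  Umat m s r dist phi C inn t w = Umx (Flin C inn) t w.
Proof. by apply/matrixP => i j; rewrite !mxE. Qed.

(** All innovations dated between [t - N] and [t]; far times have disjoint windows. *)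
Definition win (N : nat) (t : int) : set ('I_L.+1 * int) :=
  [set i | t - N%:Z <= i.2 <= t].

Lemma win_far N a b : far N a b -> forall i, win N a%:Z i -> win N b%:Z i -> False.
Proof. by rewrite /far /win => h [l t] /= h1 h2; lia. Qed.

Hypothesis inn_m : forall l t nu, measurable_fun setT (fun w => inn l t w nu ord0).
Hypothesis inn_ind : mutual_indep P inn_fam.

Let Gm i f : inn_fam i f -> measurable_fun setT f.
Proof. by move=> [nu ->]; exact: inn_m. Qed.

Variable L1 : R.
Hypothesis HL1 : forall nu A B, `|H nu A - H nu B| <= L1 * l1 (A - B).

Lemma fmeas_Ftr (e : 'I_L.+1 -> int -> Omega -> 'cV[R]_d) M l t nu :
  (forall l t (nu : 'I_d), fmeas inn_fam [set (l, t)] (fun w => e l t w nu 0)) ->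
  fmeas inn_fam (win M t) (Ftr e M l t nu).
Proof.
move=> me; rewrite /Ftr.
(* The range of [j] is repeated as a predicate so that [j < M] is at hand for each term. *)
have -> : (fun w => \sum_(0 <= j < M) (C l j *m e l (t - j%:Z) w) nu 0) =
   (fun w => \sum_(0 <= j < M | (j < M)%N)
      \sum_(k < d) C l j nu k * e l (t - j%:Z) w k 0).
  by apply/funext => w; rewrite big_nat_cond [RHS]big_nat_cond; apply: eq_big => [j|j _];
    [rewrite andbT; case: (_ < _)%N; rewrite ?andbT|rewrite mxE].
apply: fmeas_sum => j jM; apply: fmeas_sum => k _; apply: fmeasM.
  exact: measurable_cst.
apply: fmeas_sub (@me l (t - j%:Z) k) => i ->; rewrite /win/=; lia.
Qed.

(** Column [k <= m] looks back by [k] more steps, hence the window [N + m]. *)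
Lemma fmeas_Umx (F : 'I_L.+1 -> int -> 'I_d -> Omega -> R) N nu t :
  (forall l t nu, fmeas inn_fam (win N t) (F l t nu)) ->
  fmeas inn_fam (win (N + m) t%:Z) (fun w => H nu (Umx F t w)).
Proof.
move=> mF.
have mF' l (k : 'I_m.+1) nu' : fmeas inn_fam (win (N + m) t%:Z) (F l (t%:Z - k%:Z) nu').
  by apply: fmeas_sub (@mF l (t%:Z - k%:Z) nu') => i; rewrite /win/=; have := ltn_ord k; lia.
apply: (@measurable_lipschitz_mx R _ (fam_sigma inn_fam (win (N + m) t%:Z)) _ _ (H nu) L1).
  exact: HL1.
move=> i j; rewrite /Umx; under eq_fun do rewrite mxE.
apply: measurable_funD; last exact: mF'.
by apply: measurable_sum => l; apply: measurable_funM => //; exact: mF'.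
Qed.

Lemma measurable_Umx (F : 'I_L.+1 -> int -> 'I_d -> Omega -> R) nu t : (forall l t nu, measurable_fun setT (F l t nu)) ->
  measurable_fun setT (fun w => H nu (Umx F t w)).
Proof.
move=> mF; apply: (@measurable_lipschitz_mx R _ Omega _ _ (H nu) L1).
  exact: HL1.
move=> i j; rewrite /Umx; under eq_fun do rewrite mxE.
apply: measurable_funD; last exact: mF.
by apply: measurable_sum => l; apply: measurable_funM.
Qed.

Variable Lam : R.
Hypothesis Lam0 : 0 <= Lam.
Hypothesis HLam : forall nu F F' t w, `|H nu (Umx F t w) - H nu (Umx F' t w)| <=
  Lam * \sum_(i < d) \sum_(k < m.+1) \sum_(l < L.+1)
    `|F l (t%:Z - k%:Z) i w - F' l (t%:Z - k%:Z) i w|.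

Let n0 : R := d%:R * (m.+1%:R * L.+1%:R).

(** A mean square bound [v] valid for each linear process passes through the Lipschitz function at
    the cost of the squared number [n0] of arguments. *)
Lemma H_diff (F F' : 'I_L.+1 -> int -> 'I_d -> Omega -> R) v nu t :
  (forall l t nu, measurable_fun setT (F l t nu)) ->
  (forall l t nu, measurable_fun setT (F' l t nu)) ->
  (forall l t nu, L2 P (fun w => F l t nu w - F' l t nu w)) ->
  (forall l t nu, Ex P (fun w => (F l t nu w - F' l t nu w) ^+ 2) <= v) ->
  L2 P (fun w => H nu (Umx F t w) - H nu (Umx F' t w)) /\
  Ex P (fun w => (H nu (Umx F t w) - H nu (Umx F' t w)) ^+ 2) <= (Lam * n0) ^+ 2 * v.
Proof.
move=> mF mF' lF Fv.
pose Y i k l w := `|F l (t%:Z - k%:Z) i w - F' l (t%:Z - k%:Z) i w|.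
have lY i k l : L2 P (Y i k l) by exact: L2_norm.
have Yv i k l : Ex P (fun w => Y i k l w ^+ 2) <= v.
  apply: le_trans (Fv l (t%:Z - k%:Z) i); rewrite le_eqVlt; apply/orP; left; apply/eqP.
  by congr Ex; apply/funext => w; rewrite real_normK// num_real.
have lY1 i k : L2 P (fun w => \sum_(l < L.+1) Y i k l w) by exact: L2_sum.
have lY2 i : L2 P (fun w => \sum_(k < m.+1) \sum_(l < L.+1) Y i k l w) by exact: L2_sum.
have lY3 : L2 P (fun w => \sum_(i < d) \sum_(k < m.+1) \sum_(l < L.+1) Y i k l w).
  exact: L2_sum.
have lD : L2 P (fun w => H nu (Umx F t w) - H nu (Umx F' t w)).
  apply: L2_le (L2Z Lam lY3) _; last by move=> w; exact: HLam.
  by apply: measurable_funB; exact: measurable_Umx.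
split=> //.
apply: le_trans (Ex_sqr_mono lD (L2Z Lam lY3) _) _; first by move=> w; exact: HLam.
have -> : (fun w => (Lam * (\sum_(i < d) \sum_(k < m.+1) \sum_(l < L.+1) Y i k l w)) ^+ 2) =
  (fun w => Lam ^+ 2 * (\sum_(i < d) \sum_(k < m.+1) \sum_(l < L.+1) Y i k l w) ^+ 2).
  by apply/funext => w; rewrite exprMn.
rewrite ExZ; last by case: lY3.
rewrite [(Lam * n0) ^+ 2]exprMn -[leRHS]mulrA ler_wpM2l ?sqr_ge0//.
apply: le_trans (Ex_sqr_sum lY2 (v := m.+1%:R ^+ 2 * (L.+1%:R ^+ 2 * v)) _) _.
  move=> i; apply: le_trans (Ex_sqr_sum (lY1 i) (v := L.+1%:R ^+ 2 * v) _) _ => // k.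
  exact: Ex_sqr_sum.
by rewrite /n0 !exprMn !mulrA.
Qed.

Variables (V K' : R).
Hypothesis zL2 : forall l t nu, L2 P (fun w => inn l t w nu 0).
Hypothesis zV : forall l t nu, Ex P (fun w => inn l t w nu 0 ^+ 2) <= V.
Hypothesis K'0 : 0 < K'.
Hypothesis HC : forall l j nu k, `|C l j nu k| <= K' * j.+1%:R ^- 3.

Let cc j : R := K' * j.+1%:R ^- 3.
Let dV : R := d%:R ^+ 2 * V.

Let cc_gt0 j : 0 < cc j.
Proof. by rewrite mulr_gt0// invr_gt0 exprn_gt0. Qed.

Let natS_ge1 j : (1 : R) <= j.+1%:R. Proof. by rewrite ler1n. Qed.

Let cc_le j : cc j <= K'.
Proof. by rewrite ler_piMr ?(ltW K'0)// invf_le1 ?exprn_gt0// exprn_ege1. Qed.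

Let cc_wgt j : cc j <= 2 * K' * wgt j.
Proof.
rewrite -mulrA mulrCA ler_pM2l//; apply: le_trans (inv_sqr_le_wgt j).
by rewrite lef_pV2 ?posrE ?exprn_gt0// ler_weXn2l.
Qed.

Let tail M : R := 2 * K' * M.+1%:R^-1.

Let tail_gt0 M : 0 < tail M.
Proof. by rewrite !mulr_gt0// invr_gt0. Qed.

Let sum_cc M n : \sum_(M <= j < n) cc j <= tail M.
Proof.
apply: (@le_trans _ _ (\sum_(M <= j < n) 2 * K' * wgt j)).
  by apply: ler_sum => j _; exact: cc_wgt.
by rewrite -mulr_sumr ler_wpM2l ?sum_wgt// mulr_ge0// ltW.
Qed.

Let C_mul_le l j (u : 'cV[R]_d) nu : `|(C l j *m u) nu 0| <= cc j * \sum_(k < d) `|u k 0|.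
Proof.
rewrite mxE; apply: le_trans (ler_norm_sum _ _ _) _.
rewrite mulr_sumr; apply: ler_sum => k _.
by rewrite normrM ler_wpM2r.
Qed.

Let V0 : (0 < d)%N -> 0 <= V.
Proof.
move=> d0; apply: le_trans (zV ord0 0 (Ordinal d0)); exact: Ex_sqr_ge0.
Qed.

Let dV0 : 0 <= dV.
Proof.
rewrite /dV; have [->|d0] := posnP d; first by rewrite expr0n/= mul0r.
by rewrite mulr_ge0 ?sqr_ge0 ?V0.
Qed.

Let ynorm l t w : R := \sum_(k < d) `|inn l t w k 0|.

Let ynormL2 l t : L2 P (ynorm l t).
Proof. by apply: L2_sum => k _; exact: L2_norm. Qed.

Let ynormV l t : Ex P (fun w => ynorm l t w ^+ 2) <= dV.
Proof.
apply: (@Ex_sqr_sum _ _ _ P d (fun k w => `|inn l t w k 0|)) => [k|k]; first exact: L2_norm.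
apply: le_trans (zV l t k); rewrite le_eqVlt; apply/orP; left; apply/eqP.
by congr Ex; apply/funext => w; rewrite real_normK// num_real.
Qed.

Let term l j t nu w := (C l j *m inn l t w) nu 0.

Let measurable_term l j t nu : measurable_fun setT (term l j t nu).
Proof.
rewrite /term; under eq_fun do rewrite mxE.
by apply: measurable_sum => k; apply: measurable_funM => //; exact: inn_m.
Qed.

Let term_bound l j t nu : L2 P (term l j t nu) /\
  Ex P (fun w => term l j t nu w ^+ 2) <= cc j ^+ 2 * dV.
Proof.
have lc : L2 P (fun w => cc j * ynorm l t w) by exact: L2Z.
have lt : L2 P (term l j t nu).
  by apply: L2_le (measurable_term _ _ _ _) lc _ => w; exact: C_mul_le.
split => //; apply: le_trans (Ex_sqr_mono lt lc _) _; first by move=> w; exact: C_mul_le.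
have -> : (fun w => (cc j * ynorm l t w) ^+ 2) = (fun w => cc j ^+ 2 * ynorm l t w ^+ 2).
  by apply/funext => w; rewrite exprMn.
by rewrite ExZ; [rewrite ler_wpM2l ?sqr_ge0|case: (ynormL2 l t)].
Qed.

Let measurable_Ftr M l t nu : measurable_fun setT (Ftr inn M l t nu).
Proof. by apply: measurable_sum => j; exact: measurable_term. Qed.

Let measurable_Flin l t nu : measurable_fun setT (Flin C inn l t nu).
Proof. by apply: measurable_limn => n; apply: measurable_sum => j; exact: measurable_term. Qed.

Let Flin_tail M l t nu : L2 P (fun w => Flin C inn l t nu w - Ftr inn M l t nu w) /\
  Ex P (fun w => (Flin C inn l t nu w - Ftr inn M l t nu w) ^+ 2) <= tail M ^+ 2 * dV.
Proof.
apply: (@series_tail_L2 _ _ _ P (fun j => term l j (t - j%:Z) nu)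
  (fun j => ynorm l (t - j%:Z)) cc dV (tail M) M) => //.
- by move=> j; exact: ltW.
- by move=> j w; exact: C_mul_le.
Qed.

Variable nu : 'I_d.

Let G0 : R := (Lam * n0) ^+ 2 * dV.
Let G00 : 0 <= G0. Proof. by rewrite mulr_ge0 ?sqr_ge0. Qed.

Let HM M t w := H nu (Umx (Ftr inn M) t w).
Let HF t w := H nu (Umx (Flin C inn) t w).

Let HM_step k t : L2 P (fun w => HM k.+1 t w - HM k t w) /\
  Ex P (fun w => (HM k.+1 t w - HM k t w) ^+ 2) <= cc k ^+ 2 * G0.
Proof.
have e l t' nu' w : Ftr inn k.+1 l t' nu' w - Ftr inn k l t' nu' w = term l k (t' - k%:Z) nu' w.
  by rewrite /Ftr big_nat_recr//= addrAC subrr add0r.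
have [||h1 h2] := @H_diff (Ftr inn k.+1) (Ftr inn k) (cc k ^+ 2 * dV) nu t
  (@measurable_Ftr _) (@measurable_Ftr _).
- by move=> l t' nu'; under eq_fun do rewrite e; have [] := term_bound l k (t' - k%:Z) nu'.
- by move=> l t' nu'; under eq_fun do rewrite e; have [] := term_bound l k (t' - k%:Z) nu'.
by split => //; rewrite mulrCA.
Qed.

Let HF_tail M t : L2 P (fun w => HF t w - HM M t w) /\
  Ex P (fun w => (HF t w - HM M t w) ^+ 2) <= tail M ^+ 2 * G0.
Proof.
have [||h1 h2] := @H_diff (Flin C inn) (Ftr inn M) (tail M ^+ 2 * dV) nu t
  (@measurable_Flin) (@measurable_Ftr _).
- by move=> l t' nu'; have [] := Flin_tail M l t' nu'.
- by move=> l t' nu'; have [] := Flin_tail M l t' nu'.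
by split => //; rewrite mulrCA.
Qed.

(** Induction on the lag: at lag 0 the truncated processes vanish, so [HM 0 t] is a constant, and
    each further lag adds a square integrable increment. *)
Let HM_L2 M t : L2 P (HM M t).
Proof.
elim: M => [|M IH].
  have -> : HM 0 t = fun=> H nu (Umx (fun _ _ _ _ => 0) t point).
    apply/funext => w; congr (H nu _); apply/matrixP => i j; rewrite !mxE /Ftr !big_nil.
    by congr (_ + _); apply: eq_bigr => l _; rewrite big_nil.
  exact: L2_cst.
have [h _] := HM_step M t; have := L2D h IH.
by congr L2; apply/funext => w; rewrite subrK.
Qed.

Lemma HF_L2 t : L2 P (HF t).
Proof.
have [h _] := HF_tail 0 t; have := L2D h (HM_L2 0 t).
by congr L2; apply/funext => w; rewrite subrK.
Qed.

Let fmeas_inn l t nu' : fmeas inn_fam [set (l, t)] (fun w => inn l t w nu' 0).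
Proof. by apply: (@fmeas_gen _ _ _ _ inn_fam [set (l, t)] (l, t)) => //; exists nu'. Qed.

Let fmeas_HM M t : fmeas inn_fam (win (M + m) t%:Z) (HM M t).
Proof. by apply: fmeas_Umx => l t' nu'; apply: fmeas_Ftr; exact: fmeas_inn. Qed.

Let win_sub N N' t : (N <= N')%N -> win N t `<=` win N' t.
Proof. by move=> NN [l i]; rewrite /win/=; lia. Qed.

Let fmeas_center A X : fmeas inn_fam A X -> fmeas inn_fam A (fun w => X w - Ex P X).
Proof. by move=> mX; apply: measurable_funB => //; exact: measurable_cst. Qed.

Let errM M t w := HM M t w - Ex P (HM M t).
Let errF t w := HF t w - Ex P (HF t).

Let G1 : R := 4 * (2 * m + 3)%:R * K' ^+ 2 * G0.
Let G10 : 0 <= G1.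
Proof. by apply: mulr_ge0 G00; rewrite mulr_ge0 ?sqr_ge0// mulr_ge0 ?ler0n. Qed.

(** The centred increments at lag [k] have dependence range [k + 1 + m] and second moment at most
    [cc k ^+ 2 * G0], so the variance bound for N-dependent sums applies. *)
Let block_step (b : nat -> R) B T k : (forall t, `|b t| <= B) ->
  Ex P (fun w => (\sum_(t < T) b t * (errM k.+1 t w - errM k t w)) ^+ 2)
    <= (T%:R * B ^+ 2 * G1) * wgt k ^+ 2.
Proof.
move=> bB.
pose D t w := (HM k.+1 t w - HM k t w) - Ex P (fun w => HM k.+1 t w - HM k t w).
have DE t w : errM k.+1 t w - errM k t w = D t w.
  rewrite /D ExB; [|exact/L2_Int/HM_L2..]; rewrite /errM; ring.
under eq_fun do under eq_bigr do rewrite DE.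
have B0 : 0 <= B by apply: le_trans (bB 0%N).
apply: (@le_trans _ _ (T%:R * ((k.+1 + m).*2.+1)%:R * (B ^+ 2 * (cc k ^+ 2 * G0)))).
  apply: (@Ndep_variance _ _ _ P _ inn_fam Gm inn_ind
    (fun t => win (k.+1 + m) t%:Z) _ (@win_far (k.+1 + m))).
  - move=> t; apply: fmeas_center; apply: measurable_funB; first exact: fmeas_HM.
    by apply: fmeas_sub (@fmeas_HM k t); apply: win_sub; lia.
  - by move=> t; apply: L2_center; have [] := HM_step k t.
  - by move=> t; apply: Ex_center0; apply: L2_Int; have [] := HM_step k t.
  - move=> t; have [h1 h2] := HM_step k t.
    by apply: le_trans (Ex_sqr_center h1) h2.
  - exact: bB.
have -> : T%:R * ((k.+1 + m).*2.+1)%:R * (B ^+ 2 * (cc k ^+ 2 * G0)) =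
  (T%:R * B ^+ 2 * (K' ^+ 2 * G0)) * (((k.+1 + m).*2.+1)%:R * (k.+1%:R ^- 3) ^+ 2).
  by rewrite /cc exprMn; ring.
have -> : T%:R * B ^+ 2 * G1 * wgt k ^+ 2 =
  (T%:R * B ^+ 2 * (K' ^+ 2 * G0)) * ((2 * m + 3)%:R * (2 * wgt k) ^+ 2).
  by rewrite /G1; ring.
apply: ler_wpM2l.
  by apply: mulr_ge0; apply: mulr_ge0; rewrite ?ler0n ?sqr_ge0.
have k1 := natS_ge1 k.
(* The number of neighbours is at most [(2 m + 3) (k + 1)]. One power of [k + 1] is thus lost from
   the six gained, and the remaining fifth power is more than the square of [wgt k] requires. *)
apply: (@le_trans _ _ ((2 * m + 3)%:R * (k.+1%:R ^- 2) ^+ 2)); last first.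
  apply: ler_wpM2l; first exact: ler0n.
  by rewrite lerXn2r ?nnegrE ?invr_ge0 ?exprn_ge0 ?mulr_ge0 ?ler0n ?(ltW (wgt_gt0 _))// inv_sqr_le_wgt.
apply: (@le_trans _ _ (((2 * m + 3)%:R * k.+1%:R) * (k.+1%:R ^- 3) ^+ 2)).
  apply: ler_wpM2r; first exact: sqr_ge0.
  by rewrite -natrM ler_nat; lia.
rewrite -mulrA; apply: ler_wpM2l; first exact: ler0n.
have kn : k.+1%:R != 0 :> R by rewrite pnatr_eq0.
have -> : k.+1%:R * (k.+1%:R ^- 3) ^+ 2 = k.+1%:R ^- 5 :> R.
  by move: (k.+1%:R : R) kn => a an; field.
have -> : (k.+1%:R ^- 2) ^+ 2 = k.+1%:R ^- 4 :> R.
  by move: (k.+1%:R : R) kn => a an; field.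
by rewrite lef_pV2 ?posrE ?exprn_gt0// ler_weXn2l.
Qed.

(** Telescoping in the lag and the triangle inequality with weights [wgt], whose tail sum is at most
    [1 / (M + 1)]; the bound does not depend on [n]. *)
Let block_bound (b : nat -> R) B T M n : (forall t, `|b t| <= B) -> (M <= n)%N ->
  Ex P (fun w => (\sum_(t < T) b t * (errM n t w - errM M t w)) ^+ 2)
    <= (T%:R * B ^+ 2 * G1) * M.+1%:R ^- 2.
Proof.
move=> bB Mn.
have -> : (fun w => (\sum_(t < T) b t * (errM n t w - errM M t w)) ^+ 2) =
  (fun w => (\sum_(k <- index_iota M n) \sum_(t < T) b t * (errM k.+1 t w - errM k t w)) ^+ 2).
  apply/funext => w; congr (_ ^+ 2); rewrite exchange_big/=; apply: eq_bigr => t _.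
  by rewrite -mulr_sumr telescope_sumr.
apply: le_trans (Ex_sqr_wsum _ (w := wgt) (g := T%:R * B ^+ 2 * G1) _ _ _) _.
- move=> k; apply: L2_sum => t _; apply: L2Z.
  by apply: L2B; apply: L2_center; exact: HM_L2.
- exact: wgt_gt0.
- by move=> k; exact: block_step.
apply: ler_wpM2l.
  by apply: mulr_ge0 => //; rewrite mulr_ge0 ?ler0n ?sqr_ge0.
rewrite -exprVn lerXn2r ?nnegrE ?sumr_ge0 ?invr_ge0 ?ler0n ?sum_wgt// => k _.
exact/ltW/wgt_gt0.
Qed.

Let G2 : R := 2 * G1 + 2.

(** An intermediate lag [n], depending on [T], is inserted. From [errF] to lag [n] the crude bound
    of order [T^2] suffices because [n] is taken large enough to absorb a factor [T]; from [n] to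
    [M] the bound is uniform in [n]. *)
Let trunc_bound (b : nat -> R) B T M : (forall t, `|b t| <= B) ->
  Ex P (fun w => (\sum_(t < T) b t * (errF t w - errM M t w)) ^+ 2)
    <= (T%:R * B ^+ 2 * G2) * M.+1%:R ^- 2.
Proof.
move=> bB; have B0 : 0 <= B by apply: le_trans (bB 0%N).
have M0 : 0 < M.+1%:R ^- 2 :> R by rewrite invr_gt0 exprn_gt0.
have [n Mn hn] : exists2 n, (M <= n)%N & T%:R * (tail n ^+ 2 * G0) <= M.+1%:R ^- 2.
  have cv : (fun n => T%:R * ((2 * K' * n.+1%:R^-1) ^+ 2 * G0)) @ \oo --> (0 : R).
    have -> : 0 = T%:R * ((2 * K' * 0) ^+ 2 * G0) :> R by rewrite mulr0 expr0n/= mul0r mulr0.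
    apply: cvgM; first exact: cvg_cst.
    apply: cvgM; last exact: cvg_cst.
    rewrite expr2; under eq_fun do rewrite expr2.
    by apply: cvgM; (apply: cvgM; [exact: cvg_cst|exact: cvg_harmonic]).
  move/cvgrPdist_le: cv => /(_ _ M0) [n0' _ hn].
  exists (maxn M n0'); first exact: leq_maxl.
  have := hn (maxn M n0') (leq_maxr _ _); rewrite /= sub0r normrN => h.
  exact: le_trans (ler_norm _) h.
have lFn t : L2 P (fun w => errF t w - errM n t w).
  by apply: L2B; apply: L2_center; [exact: HF_L2|exact: HM_L2].
have lnM t : L2 P (fun w => errM n t w - errM M t w).
  by apply: L2B; apply: L2_center; exact: HM_L2.
have -> : (fun w => (\sum_(t < T) b t * (errF t w - errM M t w)) ^+ 2) =
   (fun w => (\sum_(t < T) b t * (errF t w - errM n t w) +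
      \sum_(t < T) b t * (errM n t w - errM M t w)) ^+ 2).
  apply/funext => w; congr (_ ^+ 2); rewrite -big_split/=; apply: eq_bigr => t _.
  by rewrite -mulrDr; congr (_ * _); ring.
apply: le_trans (Ex_sqrD_le _ _) _.
- by apply: L2_sum => t _; exact: L2Z.
- by apply: L2_sum => t _; exact: L2Z.
have h1 : Ex P (fun w => (\sum_(t < T) b t * (errF t w - errM n t w)) ^+ 2) <=
    T%:R * B ^+ 2 * M.+1%:R ^- 2.
  apply: le_trans (@Ex_sqr_sum _ _ _ P T (fun t w => b t * (errF t w - errM n t w))
     (B ^+ 2 * (tail n ^+ 2 * G0)) _ _) _.
  - by move=> t; exact: L2Z.
  - move=> t; under eq_fun do rewrite exprMn.
    rewrite ExZ; last by case: (lFn t).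
    apply: ler_pM; rewrite ?sqr_ge0 ?Ex_sqr_ge0//.
      by rewrite -real_normK ?num_real// lerXn2r ?nnegrE.
    have [k1 k2] := HF_tail n t.
    apply: le_trans k2; apply: le_trans (Ex_sqr_center k1).
    rewrite le_eqVlt; apply/orP; left; apply/eqP; congr Ex; apply/funext => w.
    rewrite ExB; [|exact/L2_Int/HF_L2|exact/L2_Int/HM_L2].
    by congr (_ ^+ 2); rewrite /errF /errM; ring.
  have -> : T%:R ^+ 2 * (B ^+ 2 * (tail n ^+ 2 * G0)) =
    T%:R * B ^+ 2 * (T%:R * (tail n ^+ 2 * G0)) by ring.
  by apply: ler_wpM2l => //; rewrite mulr_ge0 ?ler0n ?sqr_ge0.
have h2 := block_bound T bB Mn.
apply: le_trans (lerD (ler_wpM2l _ h1) (ler_wpM2l _ h2)) _ => //.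
by rewrite /G2 le_eqVlt; apply/orP; left; apply/eqP; ring.
Qed.

Hypothesis clip_small : forall eps, 0 < eps -> exists2 b, 0 < b &
  forall l t nu, Ex P (fun w => (inn l t w nu 0 - clip b (inn l t w nu 0)) ^+ 2) <= eps.

Let cinn b l t w : 'cV[R]_d := \col_k clip b (inn l t w k 0).

Let Fclip b M l t nu' : measurable_fun setT (Ftr (cinn b) M l t nu').
Proof.
apply: measurable_sum => j; under eq_fun do rewrite mxE.
apply: measurable_sum => k; apply: measurable_funM => //.
under eq_fun do rewrite mxE.
by apply: (measurableT_comp (measurable_clip _)); exact: inn_m.
Qed.

(** The factor [M ^+ 2] is harmless: the clipping level is chosen after [M]. *)
Let clip_diff b M eps l t nu' : 0 < b ->
  (forall l t nu, Ex P (fun w => (inn l t w nu 0 - clip b (inn l t w nu 0)) ^+ 2) <= eps) ->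
  L2 P (fun w => Ftr inn M l t nu' w - Ftr (cinn b) M l t nu' w) /\
  Ex P (fun w => (Ftr inn M l t nu' w - Ftr (cinn b) M l t nu' w) ^+ 2)
    <= M%:R ^+ 2 * (d%:R ^+ 2 * (K' ^+ 2 * eps)).
Proof.
move=> b0 he.
pose Y (j : 'I_M) (k : 'I_d) w := C l j nu' k *
  (inn l (t - j%:Z) w k 0 - clip b (inn l (t - j%:Z) w k 0)).
have lc l' t' k : L2 P (fun w => inn l' t' w k 0 - clip b (inn l' t' w k 0)).
  apply: L2B => //; apply: (@L2_bounded _ _ _ _ _ b).
    by apply: (measurableT_comp (measurable_clip _)); exact: inn_m.
  by move=> w; apply: clip_le; exact: ltW.
have lY j k : L2 P (Y j k) by exact: L2Z.
have lY1 j : L2 P (fun w => \sum_(k < d) Y j k w) by exact: L2_sum.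
have e w : Ftr inn M l t nu' w - Ftr (cinn b) M l t nu' w =
   \sum_(j < M) \sum_(k < d) Y j k w.
  rewrite /Ftr !big_mkord -sumrB; apply: eq_bigr => j _.
  by rewrite !mxE -sumrB; apply: eq_bigr => k _; rewrite /Y /cinn !mxE mulrBr.
split; first by under eq_fun do rewrite e; exact: L2_sum.
under eq_fun do rewrite e.
apply: (@Ex_sqr_sum _ _ _ P M (fun j w => \sum_(k < d) Y j k w)) => // j.
apply: (@Ex_sqr_sum _ _ _ P d (Y j)) => // k.
under eq_fun do rewrite exprMn.
rewrite ExZ; last by case: (lc l (t - j%:Z) k).
apply: ler_pM; rewrite ?sqr_ge0 ?Ex_sqr_ge0//.
rewrite -real_normK ?num_real// lerXn2r ?nnegrE ?(ltW K'0)//.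
exact: le_trans (HC _ _ _ _) (cc_le j).
Qed.

(** The lag [M] is chosen first and spends half of [eps]; the clipping level, which may depend on
    [M], spends the other half. The clipping errors are again N-dependent and centred, so their sum
    is also of order [T]. *)
Lemma errF_Ndep_approx : Ndep_approx P inn_fam errF.
Proof.
move=> eps eps0.
have [M hM] : exists M : nat, 2 * (G2 * M.+1%:R ^- 2) <= eps / 2.
  have cv : (fun M => 2 * (G2 * M.+1%:R ^- 2)) @ \oo --> (0 : R).
    have -> : 0 = 2 * (G2 * 0 ^+ 2) :> R by rewrite expr0n/= !mulr0.
    apply: cvgM; first exact: cvg_cst.
    apply: cvgM; first exact: cvg_cst.
    rewrite expr2; under eq_fun do rewrite -exprVn expr2.
    by apply: cvgM; exact: cvg_harmonic.
  have e2 : 0 < eps / 2 by rewrite divr_gt0.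
  move/cvgrPdist_le: cv => /(_ _ e2) [M _ h]; exists M.
  by have := h M (leqnn M); rewrite /= sub0r normrN => h'; exact: le_trans (ler_norm _) h'.
pose N := (M + m)%N.
(* The factor with which the clipping error [e1] enters the final bound, hence the choice of [e1]
   below. *)
pose Q : R := 2 * (N.*2.+1%:R * ((Lam * n0) ^+ 2 * (M%:R ^+ 2 * (d%:R ^+ 2 * K' ^+ 2)))).
have Q0 : 0 <= Q.
  by rewrite /Q mulr_ge0// mulr_ge0 ?ler0n// mulr_ge0 ?sqr_ge0// mulr_ge0 ?sqr_ge0// mulr_ge0 ?sqr_ge0.
pose e1 := eps / 2 / (Q + 1).
have e10 : 0 < e1 by rewrite !divr_gt0// ltr_wpDl.
have [bc bc0 hbc] := clip_small e10.
pose HC' t w := H nu (Umx (Ftr (cinn bc) M) t w).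
pose xi t w := HC' t w - Ex P (HC' t).
have fmH t : fmeas inn_fam (win N t%:Z) (HC' t).
  apply: fmeas_Umx => l t' nu'; apply: fmeas_Ftr => l' t'' nu''.
  have := fmeas_comp (measurable_clip bc) (@fmeas_inn l' t'' nu'').
  by congr fmeas; apply/funext => w; rewrite /cinn mxE.
(* The arguments of [H] are bounded after clipping, and the Lipschitz property compares [H] with its
   value at the zero matrix. *)
have [K1 K1b] : exists K1, forall t w, `|HC' t w| <= K1.
  exists (`|H nu 0| + Lam * \sum_(i < d) \sum_(k < m.+1) \sum_(l < L.+1)
     \sum_(j < M) K' * \sum_(k < d) bc) => t w.
  have U0 : Umx (fun _ _ _ _ => 0) t w = 0.
    apply/matrixP => i j; rewrite !mxE addr0 big1// => l _; exact: mulr0.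
  have -> : HC' t w = H nu 0 + (HC' t w - H nu 0) by ring.
  apply: le_trans (ler_normD _ _) _; rewrite lerD2l -U0.
  apply: le_trans (HLam _ _ _ _ _) _; rewrite ler_wpM2l//.
  apply: ler_sum => i _; apply: ler_sum => k _; apply: ler_sum => l _.
  rewrite subr0 /Ftr big_mkord; apply: le_trans (ler_norm_sum _ _ _) _.
  apply: ler_sum => j _; apply: le_trans (C_mul_le _ _ _ _) _.
  apply: ler_pM => //; [exact: ltW|exact: sumr_ge0|].
  by apply: ler_sum => k' _; rewrite mxE clip_le// ltW.
have lH t : L2 P (HC' t).
  by apply: (@L2_bounded _ _ _ _ _ K1) => //; exact: (fmeas_measurable Gm (@fmH t)).
have mxi t : fmeas inn_fam (win N t%:Z) (xi t) by exact: fmeas_center.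
exists N, (fun t => win N t%:Z), xi, (K1 + K1); split.
- exact: win_far.
- exact: mxi.
- move=> t w; apply: le_trans (ler_normB _ _) _; apply: lerD => //.
  rewrite -[leRHS](Ex_cst P); apply: Ex_norm_le => //; [exact: L2_Int|exact: Int_cst].
- by move=> t; exact/Ex_center0/L2_Int.
move=> b B T bB.
have hd t := @H_diff (Ftr inn M) (Ftr (cinn bc) M) _ nu t (@measurable_Ftr M) (@Fclip bc M)
   (fun l t nu' => (@clip_diff bc M e1 l t nu' bc0 hbc).1)
   (fun l t nu' => (@clip_diff bc M e1 l t nu' bc0 hbc).2).
have lMx t : L2 P (fun w => errM M t w - xi t w).
  by apply: L2B; apply: L2_center => //; exact: HM_L2.
have lFM t : L2 P (fun w => errF t w - errM M t w).
  by apply: L2B; apply: L2_center; [exact: HF_L2|exact: HM_L2].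
have -> : (fun w => (\sum_(t < T) b t * (errF t w - xi t w)) ^+ 2) =
   (fun w => (\sum_(t < T) b t * (errF t w - errM M t w) +
      \sum_(t < T) b t * (errM M t w - xi t w)) ^+ 2).
  apply/funext => w; congr (_ ^+ 2); rewrite -big_split/=; apply: eq_bigr => t _.
  by rewrite -mulrDr; congr (_ * _); ring.
apply: le_trans (Ex_sqrD_le _ _) _.
- by apply: L2_sum => t _; exact: L2Z.
- by apply: L2_sum => t _; exact: L2Z.
have h1 := trunc_bound T M bB.
have h2 : Ex P (fun w => (\sum_(t < T) b t * (errM M t w - xi t w)) ^+ 2) <=
   T%:R * N.*2.+1%:R * (B ^+ 2 * ((Lam * n0) ^+ 2 * (M%:R ^+ 2 * (d%:R ^+ 2 * (K' ^+ 2 * e1))))).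
  have DE t w : errM M t w - xi t w = (HM M t w - HC' t w) - Ex P (fun w => HM M t w - HC' t w).
    rewrite ExB; [|exact/L2_Int/HM_L2|exact: L2_Int]; rewrite /errM /xi; ring.
  apply: (@Ndep_variance _ _ _ P _ inn_fam Gm inn_ind
    (fun t => win N t%:Z) _ (@win_far N) (fun t w => errM M t w - xi t w) b B _ T).
  - by move=> t; apply: measurable_funB; [apply: fmeas_center; exact: fmeas_HM|exact: mxi].
  - exact: lMx.
  - move=> t; under eq_fun do rewrite DE.
    by apply: Ex_center0; apply: L2_Int; exact: (hd t).1.
  - move=> t; under eq_fun do rewrite DE.
    apply: le_trans (Ex_sqr_center (hd t).1) _; exact: (hd t).2.
  - exact: bB.
have TB0 : 0 <= T%:R * B ^+ 2 :> R by rewrite mulr_ge0 ?ler0n ?sqr_ge0.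
apply: le_trans (lerD (ler_wpM2l _ h1) (ler_wpM2l _ h2)) _ => //.
have -> : 2 * (T%:R * B ^+ 2 * G2 * M.+1%:R ^- 2) + 2 *
   (T%:R * N.*2.+1%:R * (B ^+ 2 * ((Lam * n0) ^+ 2 * (M%:R ^+ 2 * (d%:R ^+ 2 * (K' ^+ 2 * e1)))))) =
   T%:R * B ^+ 2 * (2 * (G2 * M.+1%:R ^- 2) + Q * e1) by rewrite /Q; ring.
have -> : eps * B ^+ 2 * T%:R = T%:R * B ^+ 2 * eps by ring.
apply: ler_wpM2l => //.
have Qe : Q * e1 <= eps / 2.
  rewrite /e1 mulrCA ler_piMr//; first by rewrite divr_ge0// ltW.
  by rewrite ler_pdivrMr ?ltr_wpDl// mul1r lerDl.
by apply: le_trans (lerD hM Qe) _; rewrite -splitr.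
Qed.

End ModelApprox.

(** * The assumptions on the errors yield the approximation *)

Section ModelErr.
Context {R : realType} {dT : measure_display} {Omega : measurableType dT}
  (P : probability Omega R).
Context (q d m L : nat) (s : nat -> 'rV[R]_q) (r : 'I_L -> 'rV[R]_q)
  (dist : 'rV[R]_q -> 'rV[R]_q -> R) (phi : 'I_d -> 'I_L -> R)
  (C : 'I_L.+1 -> nat -> 'M[R]_d) (inn : 'I_L.+1 -> int -> Omega -> 'cV[R]_d)
  (H : 'I_d -> 'M[R]_(d, m.+1) -> R) (Sig : 'I_L.+1 -> int -> 'M[R]_d) (delta : R).
Hypothesis sp : spatial_setting s r dist.
Hypothesis delta0 : 0 < delta.
Hypothesis hE1 : E1 P inn Sig.
Hypothesis hE2 : E2 P inn delta.
Hypothesis hE6 : E6 C.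
Hypothesis hE7 : E7 P r dist phi C inn H delta.

Lemma inn_measurable l t nu : measurable_fun setT (fun w => inn l t w nu ord0).
Proof. by have [_ [h _]] := hE1; have [] := h l t nu. Qed.

Lemma inn_indep : mutual_indep P (inn_fam inn).
Proof. by case: hE1. Qed.

Let powm l t nu : measurable_fun setT (fun w => `|inn l t w nu ord0| `^ (2 + delta)).
Proof.
apply: (measurableT_comp (measurable_powR _)).
by apply: measurableT_comp => //; exact: inn_measurable.
Qed.

Lemma inn_moments : exists K : R, 0 <= K /\ forall l t nu,
  Int P (fun w => `|inn l t w nu ord0| `^ (2 + delta)) /\
  Ex P (fun w => `|inn l t w nu ord0| `^ (2 + delta)) <= K.
Proof.
have [K hK] := hE2; exists `|K|; split => // l t nu.
have [||i e] := expectation_ge0_Int _ _ (hK l t nu).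
- exact: powm.
- by move=> w; exact: powR_ge0.
by split => //; apply: le_trans e (ler_norm _).
Qed.

Lemma inn_L2 : exists V : R, forall l t nu, L2 P (fun w => inn l t w nu 0) /\
  Ex P (fun w => inn l t w nu 0 ^+ 2) <= V.
Proof.
have [K [K0 hK]] := inn_moments; exists (1 + K) => l t nu.
have [iK eK] := hK l t nu.
have i1 : Int P (fun w => 1 + `|inn l t w nu ord0| `^ (2 + delta)).
  by apply: IntD => //; exact: Int_cst.
have i2 : Int P (fun w => inn l t w nu 0 ^+ 2).
  apply: Int_le i1 _; first by apply: measurable_funX; exact: inn_measurable.
  by move=> w; rewrite ger0_norm ?sqr_ge0// sqr_le_powR.
split; first by split => //; exact: inn_measurable.
apply: le_trans (Ex_le i2 i1 _) _; first by move=> w; exact: sqr_le_powR.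
by rewrite ExD ?Ex_cst ?lerD2l//; exact: Int_cst.
Qed.

Lemma inn_clip eps : 0 < eps -> exists2 b, 0 < b &
  forall l t nu, Ex P (fun w => (inn l t w nu 0 - clip b (inn l t w nu 0)) ^+ 2) <= eps.
Proof.
move=> eps0; have [K [K0 hK]] := inn_moments.
(* Chosen so that the clipping error, at most [K / b ^ delta], does not exceed [eps]. *)
pose b := ((K + 1) / eps) `^ delta^-1.
have K1 : 0 < (K + 1) / eps by rewrite divr_gt0// ltr_wpDl.
have b0 : 0 < b by rewrite powR_gt0.
have bd : b `^ delta = (K + 1) / eps.
  by rewrite /b -powRrM mulVf ?gt_eqF// powRr1// ltW.
exists b => // l t nu; have [iK eK] := hK l t nu.
have iZ : Int P (fun w => `|inn l t w nu 0| `^ (2 + delta) / b `^ delta).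
  have := IntZ (b `^ delta)^-1 iK.
  by congr Int; apply/funext => w; rewrite mulrC.
have mc : measurable_fun setT (fun w => (inn l t w nu 0 - clip b (inn l t w nu 0)) ^+ 2).
  apply: measurable_funX; apply: measurable_funB; first exact: inn_measurable.
  by apply: (measurableT_comp (measurable_clip b)); exact: inn_measurable.
have cs w : (inn l t w nu 0 - clip b (inn l t w nu 0)) ^+ 2 <=
   `|inn l t w nu 0| `^ (2 + delta) / b `^ delta by exact: clip_sqr.
have ic : Int P (fun w => (inn l t w nu 0 - clip b (inn l t w nu 0)) ^+ 2).
  by apply: Int_le mc iZ _ => w; rewrite ger0_norm ?sqr_ge0.
apply: le_trans (Ex_le ic iZ cs) _.
under eq_fun do rewrite mulrC.
rewrite ExZ// bd invf_div mulrAC ler_pdivrMr ?ltr_wpDl// ler_pM2l//.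
by apply: le_trans eK _; rewrite lerDl.
Qed.

Lemma coef_bound : exists2 K' : R, 0 < K' &
  forall l j nu k, `|C l j nu k| <= K' * j.+1%:R ^- 3.
Proof.
have [K [theta [th0 hK]]] := hE6.
(* The 8 is [2^3], from [j + 1 <= 2 max(j, 1)]; the 1 makes the constant positive. *)
exists (8 * `|K| + 1); first by rewrite ltr_wpDl// mulr_ge0.
move=> l j nu k.
apply: (@le_trans _ _ (rowsupnorm (C l j) nu)).
  exact: (@le_bigmax _ _ _ _ (fun k => `|C l j nu k|)).
apply: le_trans (hK l j nu) _.
set a : R := (maxn j 1)%:R.
have a1 : 1 <= a by rewrite ler1n leq_maxr.
have a0 : 0 < a by apply: lt_le_trans a1.
have h1 : a `^ (- (7 / 2) - theta) <= a ^- 3.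
  rewrite -powR_mulrn ?(ltW a0)// -powRN ler_powR//.
  by have : (3 : R) = 3%:R by []; lra.
have h2 : a ^- 3 <= 8 * j.+1%:R ^- 3.
  rewrite ler_pdivlMr ?exprn_gt0// mulrC ler_pdivrMr ?exprn_gt0//.
  have -> : 8 * a ^+ 3 = (2 * a) ^+ 3 by ring.
  by rewrite lerXn2r ?nnegrE ?ler0n ?mulr_ge0 ?(ltW a0)// -natrM ler_nat; lia.
have p0 : 0 <= a `^ (- (7 / 2) - theta) by exact: powR_ge0.
have j0 : 0 <= j.+1%:R ^- 3 :> R by rewrite invr_ge0 exprn_ge0.
apply: (@le_trans _ _ (`|K| * (8 * j.+1%:R ^- 3))).
  apply: le_trans (ler_wpM2r p0 (ler_norm K)) _.
  by apply: ler_wpM2l => //; exact: le_trans h1 h2.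
have -> : (8 * `|K| + 1) * j.+1%:R ^- 3 = `|K| * (8 * j.+1%:R ^- 3) + j.+1%:R ^- 3 by ring.
by rewrite lerDl.
Qed.

Lemma H_lip_l1 : exists2 L1 : R, 0 <= L1 &
  forall nu A B, `|H nu A - H nu B| <= L1 * l1 (A - B).
Proof.
have [[LH hLH] _] := hE7; exists `|LH| => // nu A B.
apply: le_trans (hLH nu A B) _.
apply: le_trans (ler_wpM2r _ (ler_norm LH)) _; first exact: sqrtr_ge0.
by rewrite ler_wpM2l// frob_le_l1.
Qed.

(** The loadings are at most [Phi] and [dist] is at most 1 on the cube, so the constant depends on
    neither the time nor the site. The 1 in [Phi] covers the idiosyncratic noise, whose coefficient
    is 1. *)
Lemma H_lip_Umx : exists2 Lam : R, 0 <= Lam &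
  forall nu (F F' : 'I_L.+1 -> int -> 'I_d -> Omega -> R) t w,
  `|H nu (Umx m s r dist phi F t w) - H nu (Umx m s r dist phi F' t w)| <=
  Lam * \sum_(i < d) \sum_(k < m.+1) \sum_(l < L.+1)
    `|F l (t%:Z - k%:Z) i w - F' l (t%:Z - k%:Z) i w|.
Proof.
have [L1 L10 hL1] := H_lip_l1.
pose Phi : R := 1 + \sum_(i < d) \sum_(l < L) `|phi i l|.
have Phi0 : 0 <= Phi.
  by rewrite addr_ge0// sumr_ge0// => i _; exact: sumr_ge0.
have phiPhi i l : `|phi i l| <= Phi.
  rewrite /Phi (bigD1 i)//= (bigD1 l)//=.
  have h1 : 0 <= \sum_(j < L | j != l) `|phi i j| by exact: sumr_ge0.
  have h2 : 0 <= \sum_(j < d | j != i) \sum_(l < L) `|phi j l|.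
    by apply: sumr_ge0 => j _; exact: sumr_ge0.
  lra.
have Phi1 : 1 <= Phi.
  by rewrite lerDl sumr_ge0// => i _; exact: sumr_ge0.
exists (L1 * Phi); first exact: mulr_ge0.
move=> nu F F' t w; apply: le_trans (hL1 _ _ _) _; rewrite -mulrA ler_wpM2l//.
rewrite /l1 mulr_sumr; apply: ler_sum => i _; rewrite mulr_sumr; apply: ler_sum => k _.
rewrite !mxE.
set f := fun l => F l (t%:Z - k%:Z) i w; set f' := fun l => F' l (t%:Z - k%:Z) i w.
rewrite big_ord_recl mulrDr opprD addrACA -sumrB addrC.
apply: le_trans (ler_normD _ _) _; apply: lerD; first by rewrite ler_peMl.
apply: le_trans (ler_norm_sum _ _ _) _; rewrite mulr_sumr; apply: ler_sum => l _.
rewrite -mulrBr normrM ler_wpM2r// normrM -[leRHS]mulr1 ler_pM//.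
have [ss [rr dd]] := sp.
have /andP[d0 d1] := dd _ _ (ss t) (rr l).
by rewrite ger0_norm.
Qed.

Variable nu : 'I_d.
Let e t w := err P s r dist phi C inn H nu t w.

Lemma errE t : e t = fun w => H nu (Umx m s r dist phi (Flin C inn) t w) -
   Ex P (fun w => H nu (Umx m s r dist phi (Flin C inn) t w)).
Proof.
apply/funext => w; rewrite /e /err fine_expectation Umat_Umx.
by congr (_ - Ex P _); apply/funext => w'; rewrite Umat_Umx.
Qed.

Lemma err_L2_approx :
  [/\ forall t, L2 P (e t), forall t, Ex P (e t) = 0 & Ndep_approx P (inn_fam inn) e].
Proof.
have [V hV] := inn_L2.
have [K' K'0 hC] := coef_bound.
have [L1 L10 hL1] := H_lip_l1.
have [Lam Lam0 hLam] := H_lip_Umx.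
have zL2 l t nu' := (hV l t nu').1.
have zV l t nu' := (hV l t nu').2.
have hF t := HF_L2 inn_measurable hL1 hLam zL2 zV K'0 hC nu t.
have happ := errF_Ndep_approx inn_measurable inn_indep hL1 Lam0 hLam zL2 zV K'0 hC
  nu inn_clip.
have eE : e = fun t w => H nu (Umx m s r dist phi (Flin C inn) t w) -
   Ex P (fun w => H nu (Umx m s r dist phi (Flin C inn) t w)).
  by apply/funext => t; rewrite errE.
split=> [t|t|]; rewrite ?errE.
- exact: L2_center.
- exact/Ex_center0/L2_Int.
- by rewrite eE.
Qed.

End ModelErr.

(** * Quadratic forms and the ridge estimator *)

Section SymmetricForms.
Context {R : realType}.

(** Row vectors, because [eigenvalue] refers to row eigenvectors. *)
Definition bform p (A : 'M[R]_p) (u v : 'rV[R]_p) : R := (u *m A *m v^T) 0 0.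
Definition sqn p (v : 'rV[R]_p) : R := (v *m v^T) 0 0.

Lemma sqnE p (v : 'rV[R]_p) : sqn v = \sum_i v 0 i ^+ 2.
Proof. by rewrite /sqn mxE; apply: eq_bigr => i _; rewrite mxE expr2. Qed.

Lemma sqn_ge0 p (v : 'rV[R]_p) : 0 <= sqn v.
Proof. by rewrite sqnE; apply: sumr_ge0 => i _; exact: sqr_ge0. Qed.

Lemma sqr_coord_le p (v : 'rV[R]_p) i : v 0 i ^+ 2 <= sqn v.
Proof.
rewrite sqnE (bigD1 i)//= lerDl; apply: sumr_ge0 => j _; exact: sqr_ge0.
Qed.

Lemma sqn_eq0 p (v : 'rV[R]_p) : sqn v = 0 -> v = 0.
Proof.
move=> v0; apply/rowP => i; rewrite mxE; apply/eqP; rewrite -sqrf_eq0.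
by rewrite eq_le sqr_ge0 andbT -v0 sqr_coord_le.
Qed.

Lemma bformDl p (A : 'M[R]_p) u u' v : bform A (u + u') v = bform A u v + bform A u' v.
Proof. by rewrite /bform !mulmxDl mxE. Qed.

Lemma bformDr p (A : 'M[R]_p) u v v' : bform A u (v + v') = bform A u v + bform A u v'.
Proof. by rewrite /bform linearD/= mulmxDr mxE. Qed.

Lemma bformZl p (A : 'M[R]_p) c u v : bform A (c *: u) v = c * bform A u v.
Proof. by rewrite /bform -!scalemxAl mxE. Qed.

Lemma bformZr p (A : 'M[R]_p) c u v : bform A u (c *: v) = c * bform A u v.
Proof. by rewrite /bform linearZ/= -scalemxAr mxE. Qed.

Lemma bformC p (A : 'M[R]_p) u v : A^T = A -> bform A u v = bform A v u.
Proof.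
move=> sA; rewrite /bform.
have -> : (u *m A *m v^T) 0 0 = (u *m A *m v^T)^T 0 0 by rewrite [RHS]mxE.
by rewrite !trmx_mul trmxK sA mulmxA.
Qed.

Lemma bformE p (A : 'M[R]_p) u v : bform A u v = \sum_i \sum_j u 0 i * A i j * v 0 j.
Proof.
rewrite /bform mxE exchange_big/=; apply: eq_bigr => j _.
by rewrite !mxE mulr_suml.
Qed.

Lemma continuous_sum (T : topologicalType) (I : Type) (s : seq I) (F : I -> T -> R) :
  (forall i, continuous (F i)) -> continuous (fun x => \sum_(i <- s) F i x).
Proof.
move=> cF; elim: s => [|i s IH] x.
  under eq_fun do rewrite big_nil.
  exact: cvg_cst.
have -> : (fun x => \sum_(j <- i :: s) F j x) = (fun x => F i x + \sum_(j <- s) F j x).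
  by apply/funext => t; rewrite big_cons.
by apply: cvgD; [exact: cF|exact: IH].
Qed.

Lemma continuous_bform p (A : 'M[R]_p) : continuous (fun v => bform A v v).
Proof.
have -> : (fun v => bform A v v) = (fun v => \sum_i \sum_j v 0 i * A i j * v 0 j).
  by apply/funext => v; rewrite bformE.
apply: continuous_sum => i; apply: continuous_sum => j v.
have h k : u 0 k @[u --> v] --> v 0 k by exact: coord_continuous.
exact: cvgM (cvgM (h i) (cvg_cst (A i j))) (h j).
Qed.

Lemma sqn_bform p (v : 'rV[R]_p) : sqn v = bform 1%:M v v.
Proof. by rewrite /bform mulmx1. Qed.

Lemma continuous_sqn p : continuous (@sqn p).
Proof.
rewrite (_ : @sqn p = fun v => bform 1%:M v v); first exact: continuous_bform.
by apply/funext => v; rewrite sqn_bform.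
Qed.

(* The minimum of the quadratic form on the unit sphere is attained at an
   eigenvector. *)
Lemma sym_eig_lb p (A : 'M[R]_p) (c : R) : A^T = A ->
  (forall a, eigenvalue A a -> c <= a) -> forall v, c * sqn v <= bform A v v.
Proof.
move=> sA cA v.
have [->|vn0] := eqVneq v 0.
  by rewrite /bform /sqn !mul0mx mxE mulr0.
have sqn_gt0 u : u != 0 -> 0 < @sqn p u.
  move=> u0; rewrite lt_def sqn_ge0 andbT.
  by apply: contra u0 => /eqP/sqn_eq0 ->.
pose S := [set u : 'rV[R]_p | sqn u = 1].
have normS u : u != 0 -> S ((Num.sqrt (sqn u))^-1 *: u).
  move=> u0; rewrite /S/= sqn_bform bformZl bformZr -sqn_bform mulrA -invfM.
  by rewrite -expr2 sqr_sqrtr ?sqn_ge0// mulVf// gt_eqF// sqn_gt0.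
have cS : compact S.
  pose Q : set 'rV[R]_p := [set u | forall i, `[(-1), 1]%classic (u ord0 i)].
  have cQ : compact Q by apply: (@rV_compact R p (fun=> `[(-1), 1]%classic)) => i; exact: segment_compact.
  apply: (subclosed_compact _ cQ) => [|u uS i].
    have -> : S = @sqn p @^-1` [set 1] by [].
    by apply: closed_comp => [u _|]; [exact: continuous_sqn|exact: closed_eq].
  rewrite /= in_itv/= -ler_norml -(@expr_le1 _ 2)// real_normK ?num_real//.
  by rewrite -uS sqr_coord_le.
have S0 : S !=set0 by exists ((Num.sqrt (sqn v))^-1 *: v); exact: normS.
have [v0 v0S minv] := EVT_min_rV S0 cS (continuous_subspaceT (@continuous_bform _ A)).
set mu := bform A v0 v0 in minv.
rewrite inE in v0S.
have lb u : mu * sqn u <= bform A u u.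
  have [->|u0] := eqVneq u 0.
    by rewrite /bform /sqn !mul0mx mxE mulr0.
  have := minv _ (mem_set (normS u u0)); rewrite bformZl bformZr mulrA -invfM -expr2.
  by rewrite sqr_sqrtr ?sqn_ge0// mulrC ler_pdivlMr// sqn_gt0.
pose M := A - mu%:M.
have ME u w : bform M u w = bform A u w - mu * bform 1%:M u w.
  by rewrite /bform /M mulmxBr mul_mx_scalar mulmxBl -scalemxAl mulmx1 !mxE.
have sM : M^T = M by rewrite /M linearB/= sA tr_scalar_mx.
have Mge u : 0 <= bform M u u by rewrite ME -sqn_bform subr_ge0.
have M0 : bform M v0 v0 = 0 by rewrite ME -sqn_bform v0S mulr1 subrr.
pose g := v0 *m M.
have gE : bform M v0 g = sqn g by rewrite /bform -/g.
have g0 : sqn g = 0.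
  apply/eqP; rewrite eq_le sqn_ge0 andbT leNgt; apply/negP => gpos.
  (* [v0] minimises the nonnegative form of [M]. At [v0 + t *: g] the form equals
     [2 t |g|^2 + t^2 M(g,g)], which is negative for this [t] unless [g = 0]. *)
  pose t := - (sqn g / (bform M g g + 1)).
  have Bp : 0 < bform M g g + 1 by rewrite ltr_wpDl.
  have := Mge (v0 + t *: g).
  rewrite bformDl !bformDr !bformZl !bformZr M0 add0r (bformC g v0 sM) gE.
  have tE : t * (bform M g g + 1) = - sqn g by rewrite /t mulNr divfK// gt_eqF.
  have t0 : t < 0 by rewrite oppr_lt0 divr_gt0.
  move: (bform M g g) (sqn g) tE t0 gpos (Mge g) => bb sg tE t0 gpos bb0; nra.
have v00 : v0 != 0.
  by apply/eqP => e; move: v0S; rewrite /S/= e /sqn mul0mx mxE => /eqP; rewrite eq_sym oner_eq0.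
have emu : eigenvalue A mu.
  apply/eigenvalueP; exists v0 => //; apply/eqP; rewrite -subr_eq0.
  by have := sqn_eq0 g0; rewrite /g /M mulmxBr mul_mx_scalar => ->.
apply: le_trans (lb v); apply: ler_wpM2r; [exact: sqn_ge0|exact: cA].
Qed.

Lemma bform_norm_le p (A : 'M[R]_p) v : `|bform A v v| <= (\sum_i \sum_j `|A i j|) * sqn v.
Proof.
rewrite bformE; apply: le_trans (ler_norm_sum _ _ _) _.
rewrite mulr_suml; apply: ler_sum => i _; apply: le_trans (ler_norm_sum _ _ _) _.
rewrite mulr_suml; apply: ler_sum => j _; rewrite !normrM mulrAC mulrC ler_wpM2l//.
have h1 := sqr_coord_le v i; have h2 := sqr_coord_le v j.
rewrite -normrM ler_norml.
have := sqr_ge0 (v 0 i - v 0 j); have := sqr_ge0 (v 0 i + v 0 j) => h3 h4.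
by apply/andP; split; nra.
Qed.

(** The infimum is meaningful only for a set bounded below; the sum of the absolute entries bounds
    all eigenvalues. *)
Lemma lmin_le_eig p (A : 'M[R]_p) a : eigenvalue A a -> lmin A <= a.
Proof.
move=> ea; apply: ge_inf => //.
exists (- (\sum_i \sum_j `|A i j|)) => b /eigenvalueP[v vb v0].
have sv : 0 < sqn v.
  rewrite lt_def sqn_ge0 andbT.
  by apply: contra v0 => /eqP/sqn_eq0 ->.
have := bform_norm_le A v; rewrite {1}/bform vb -scalemxAl mxE -/(sqn v) normrM.
rewrite (gtr0_norm sv) ler_pM2r// => h.
by move: h; rewrite ler_norml => /andP[].
Qed.

Lemma sym_lmin_lb p (A : 'M[R]_p) v : A^T = A -> lmin A * sqn v <= bform A v v.
Proof. by move=> sA; apply: sym_eig_lb => // a; exact: lmin_le_eig. Qed.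

(** The operator is tested on the [j]th basis vector; most of the proof checks that the supremum is
    taken over a bounded set. *)
Lemma opnorm_entry p (A : 'M[R]_p) i j : `|A i j| <= opnorm A.
Proof.
have enormE n (v : 'cV[R]_n) k : `|v k 0| <= enorm v.
  rewrite /enorm -sqrtr_sqr ler_sqrt; last by apply: sumr_ge0 => l _; exact: sqr_ge0.
  rewrite (bigD1 k)//= lerDl; apply: sumr_ge0 => l _; exact: sqr_ge0.
pose e : 'cV[R]_p := \col_k (k == j)%:R.
have e1 : enorm e <= 1.
  rewrite /enorm (bigD1 j)//= big1 ?addr0 => [|k kj]; last by rewrite mxE (negbTE kj) expr0n.
  by rewrite mxE eqxx expr1n sqrtr1.
have Ae : A i j = (A *m e) i 0.
  rewrite mxE (bigD1 j)//= big1 ?addr0 => [|k kj]; last by rewrite mxE (negbTE kj) mulr0.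
  by rewrite mxE eqxx mulr1.
rewrite Ae; apply: le_trans (enormE _ _ i) _; apply: ub_le_sup; last by exists e.
pose K := \sum_i \sum_j `|A i j|.
exists (Num.sqrt (\sum_(k < p) K ^+ 2)) => _ [v /= v1 <-].
rewrite /enorm ler_sqrt; last by apply: sumr_ge0 => l _; exact: sqr_ge0.
apply: ler_sum => k _; rewrite -real_normK ?num_real// lerXn2r ?nnegrE//.
  by apply: sumr_ge0 => l _; exact: sumr_ge0.
rewrite mxE; apply: le_trans (ler_norm_sum _ _ _) _.
apply: (@le_trans _ _ (\sum_j `|A k j|)).
  apply: ler_sum => l _; rewrite normrM ler_piMr//.
  exact: le_trans (enormE _ v l) v1.
by rewrite /K [leRHS](bigD1 k)//= lerDl; apply: sumr_ge0 => l _; exact: sumr_ge0.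
Qed.

End SymmetricForms.

(** * Measurability of the inverse of a random matrix *)

Section MeasurableInverse.
Context {R : realType} {dT : measure_display} {Omega : measurableType dT}.

Lemma measurable_funV (f : Omega -> R) : measurable_fun setT f ->
  measurable_fun setT (fun w => (f w)^-1).
Proof.
move=> mf; have -> : (fun w => (f w)^-1) = (fun w => f w * (f w ^+ 2) `^ (-1)).
  apply/funext => w; rewrite powR_inv1 ?sqr_ge0//.
  have [->|f0] := eqVneq (f w) 0; first by rewrite invr0 mul0r.
  by rewrite expr2 invfM mulVKf.
apply: measurable_funM => //; apply: (measurableT_comp (measurable_powR _)).
exact: measurable_funX.
Qed.

Lemma measurable_det n (A : Omega -> 'M[R]_n) :
  (forall i j, measurable_fun setT (fun w => A w i j)) ->
  measurable_fun setT (fun w => \det (A w)).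
Proof.
move=> mA; rewrite /determinant; apply: measurable_sum => s.
by apply: measurable_funM => //; apply: measurable_prod => i _.
Qed.

(** By the cofactor formula. Invertibility is required everywhere since [invmx] follows another
    formula on singular matrices. *)
Lemma measurable_invmx n (A : Omega -> 'M[R]_n) i j :
  (forall i j, measurable_fun setT (fun w => A w i j)) ->
  (forall w, A w \in unitmx) ->
  measurable_fun setT (fun w => invmx (A w) i j).
Proof.
move=> mA uA.
have -> : (fun w => invmx (A w) i j) = (fun w => (\det (A w))^-1 * cofactor (A w) j i).
  by apply/funext => w; rewrite /invmx uA mxE mxE.
apply: measurable_funM; first exact/measurable_funV/measurable_det.
rewrite /cofactor; apply: measurable_funM => //; apply: measurable_det => k l.
under eq_fun do rewrite !mxE.
exact: mA.
Qed.

End MeasurableInverse.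

Lemma unitmx_bform_gt0 {R : realType} p (M : 'M[R]_p) :
  (forall v : 'rV[R]_p, v != 0 -> 0 < bform M v v) -> M \in unitmx.
Proof.
move=> Mpos; rewrite -row_free_unit; apply: inj_row_free => v vM.
apply/eqP; apply: contraT => v0; have := Mpos v v0.
by rewrite /bform vM mul0mx mxE ltxx.
Qed.

(** * The Gram matrix and the coefficients of the ridge estimator *)

Section RidgeAlgebra.
Context {R : realType} (p : nat) (x : nat -> 'cV[R]_p) (Sx : 'M[R]_p).

Definition gram T : 'M[R]_p := (XT x T)^T *m XT x T.

Lemma gramE T i j : gram T i j = \sum_(t < T) x t i 0 * x t j 0.
Proof. by rewrite mxE; apply: eq_bigr => t _; rewrite !mxE. Qed.

Lemma gram_sum T : gram T = \sum_(t < T) x t *m (x t)^T.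
Proof.
apply/matrixP => i j; rewrite gramE summxE; apply: eq_bigr => t _.
by rewrite mxE big_ord1 mxE.
Qed.

Lemma tr_gram T : (gram T)^T = gram T.
Proof. by rewrite /gram trmx_mul trmxK. Qed.

Lemma bform_scalar (l : R) (v : 'rV[R]_p) : bform l%:M v v = l * sqn v.
Proof. by rewrite /bform mul_mx_scalar -scalemxAl mxE. Qed.

Lemma bformDm (A B : 'M[R]_p) v : bform (A + B) v v = bform A v v + bform B v v.
Proof. by rewrite /bform mulmxDr mulmxDl mxE. Qed.

Lemma bformZm c (A : 'M[R]_p) v : bform (c *: A) v v = c * bform A v v.
Proof. by rewrite /bform -scalemxAr -scalemxAl mxE. Qed.

Lemma sqn_gt0 (v : 'rV[R]_p) : v != 0 -> 0 < sqn v.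
Proof.
move=> v0; rewrite lt_def sqn_ge0 andbT.
by apply: contra v0 => /eqP/sqn_eq0 ->.
Qed.

Hypothesis hR : assumption_R x Sx.

Lemma Sx_unit : Sx \in unitmx.
Proof.
have [_ [[_ Sp] _]] := hR; apply: unitmx_bform_gt0 => v v0.
have v0' : v^T != 0 by apply: contra v0 => /eqP h; rewrite -[v]trmxK h trmx0.
by have := Sp _ v0'; rewrite trmxK.
Qed.

Lemma tr_invSx : (invmx Sx)^T = invmx Sx.
Proof. by have [_ [[sS _] _]] := hR; rewrite trmx_inv sS. Qed.

(** The spectral condition as a lower bound of the quadratic form, and the operator norm rate read
    entrywise; [p] is fixed, so its power goes into [D]. *)
Lemma gram_bounds : exists (kap D : R), [/\ 0 < kap, 0 <= D,
  (forall T, (0 < T)%N -> (p <= T)%N -> forall v,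
     kap * sqn v <= bform (T%:R^-1 *: gram T) v v) &
  (forall T, (0 < T)%N -> forall i j,
     `|(T%:R^-1 *: gram T) i j - Sx i j| <= D / Num.sqrt T%:R)].
Proof.
have [_ [_ [[eta [Cst [a [b [eta0 [/andP[a0 ab] [hop heig]]]]]]] _]]] := hR.
exists a, `|Cst * p%:R `^ eta|; split => //.
  move=> T T0 pT v; apply: sym_eig_lb.
    by rewrite linearZ/= tr_gram.
  by move=> e /(heig T T0 pT) /andP[].
move=> T T0 i j.
have hop' := hop T T0; rewrite -gram_sum in hop'.
have -> : (T%:R^-1 *: gram T) i j - Sx i j = (T%:R^-1 *: gram T - Sx) i j by rewrite !mxE.
apply: le_trans (le_trans (opnorm_entry _ i j) hop') _.
by rewrite ler_wpM2r ?ler_norm// invr_ge0 sqrtr_ge0.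
Qed.

Variable a : 'cV[R]_p.
Let b : 'rV[R]_p := a^T *m invmx Sx.

(** The coefficients of the sums of [x t i 0 * e t] in the ridge statistic in direction [a]; their
    limit is [b]. *)
Definition rho T (l : R) : 'rV[R]_p := T%:R *: (a^T *m invmx (gram T + l%:M)).

Lemma gram_unit T l : (0 < T)%N -> (p <= T)%N -> 0 <= l -> gram T + l%:M \in unitmx.
Proof.
move=> T0 pT l0; have [kap [D [kap0 _ hk _]]] := gram_bounds.
apply: unitmx_bform_gt0 => v v0; rewrite bformDm bform_scalar.
have TR : 0 < T%:R :> R by rewrite ltr0n.
have := hk T T0 pT v; rewrite bformZm ler_pdivlMl// => h.
rewrite ltr_pwDl ?mulr_ge0 ?sqn_ge0//; apply: lt_le_trans h.
by rewrite mulr_gt0// mulr_gt0// sqn_gt0.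
Qed.

(** With [M = (gram T + l) / T], the difference [y] satisfies
    [y M = b (Sx - gram T / T) - (l / T) b], whose entries are of order [T^-1/2], and the form of
    [M] is at least [kap]. Uniformity over [l] in [[0,1]] permits inserting a random parameter
    pointwise. *)
Lemma rho_diff : exists2 Cy : R, 0 <= Cy & forall T l, (0 < T)%N -> (p <= T)%N ->
  0 <= l -> l <= 1 -> forall i, `|rho T l 0 i - b 0 i| <= Cy / Num.sqrt T%:R.
Proof.
have [kap [D [kap0 D0 hk hD]]] := gram_bounds.
pose bs := \sum_i `|b 0 i|.
have bs0 : 0 <= bs by exact: sumr_ge0.
have bbs j : `|b 0 j| <= bs by rewrite /bs (bigD1 j)//= lerDl sumr_ge0.
pose E := bs * (D + 1).
have E0 : 0 <= E by rewrite mulr_ge0// addr_ge0.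
(* [p + 1] stands in for the square root of [p]. *)
exists ((p%:R + 1) * E / kap).
  by rewrite divr_ge0 ?(ltW kap0)// mulr_ge0// addr_ge0.
move=> T l T0 pT l0 l1 i.
have TR : 0 < T%:R :> R by rewrite ltr0n.
have sT : 0 < Num.sqrt (T%:R : R) by rewrite sqrtr_gt0.
have sT2 : Num.sqrt (T%:R : R) ^+ 2 = T%:R by rewrite sqr_sqrtr// ltW.
have sT1 : 1 <= Num.sqrt (T%:R : R) by rewrite -{1}sqrtr1 ler_sqrt ?ler1n.
pose M := T%:R^-1 *: (gram T + l%:M).
pose y := rho T l - b.
pose g := y *m M.
have rM : rho T l *m M = a^T.
  rewrite /rho /M -scalemxAl -scalemxAr scalerA divff ?gt_eqF// scale1r.
  by rewrite -mulmxA mulVmx ?mulmx1// gram_unit.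
have bS : b *m Sx = a^T by rewrite /b -mulmxA mulVmx ?mulmx1// Sx_unit.
have gE j : g 0 j = \sum_k b 0 k * (Sx k j - (T%:R^-1 *: gram T) k j) - l / T%:R * b 0 j.
  have -> : g = b *m (Sx - T%:R^-1 *: gram T) - (l / T%:R) *: b.
    rewrite /g /y mulmxBl rM -bS mulmxBr /M scalerDr mulmxDr scale_scalar_mx.
    by rewrite opprD addrA mul_mx_scalar [l / _]mulrC.
  rewrite !mxE; congr (_ - _); apply: eq_bigr => k _; by rewrite !mxE.
have gb j : `|g 0 j| <= E / Num.sqrt T%:R.
  rewrite gE; apply: le_trans (ler_normB _ _) _.
  have -> : E / Num.sqrt T%:R = bs * (D / Num.sqrt T%:R) + (Num.sqrt T%:R)^-1 * bs.
    by rewrite /E; ring.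
  apply: lerD.
    apply: le_trans (ler_norm_sum _ _ _) _; rewrite mulr_suml; apply: ler_sum => k _.
    by rewrite normrM ler_wpM2l// distrC; exact: hD.
  rewrite normrM ler_pM// normrM ger0_norm// normfV (gtr0_norm TR).
  rewrite ler_pdivrMr//.
  have -> : (Num.sqrt T%:R)^-1 * T%:R = Num.sqrt T%:R :> R.
    by rewrite -[X in _ * X]sT2 expr2 mulKf// gt_eqF.
  by lra.
have key : sqn y <= sqn g / kap ^+ 2.
  have h1 : kap * sqn y <= bform M y y.
    rewrite /M bformZm bformDm bform_scalar mulrDr -bformZm.
    apply: le_trans (hk T T0 pT y) _; rewrite lerDl mulr_ge0 ?invr_ge0 ?(ltW TR)//.
    by rewrite mulr_ge0// sqn_ge0.
  (* Young's inequality in each coordinate; the last term is half of the lower bound in [h1] and is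
     absorbed there. *)
  have h2 : bform M y y <= sqn g / (2 * kap) + kap / 2 * sqn y.
    have -> : bform M y y = \sum_j g 0 j * y 0 j.
      by rewrite /bform -/g mxE; apply: eq_bigr => j _; rewrite [X in _ * X]mxE.
    rewrite !sqnE mulr_suml mulr_sumr -big_split/=; apply: ler_sum => j _.
    have -> : g 0 j ^+ 2 / (2 * kap) + kap / 2 * y 0 j ^+ 2 =
       (g 0 j - kap * y 0 j) ^+ 2 / (2 * kap) + g 0 j * y 0 j.
      by field; rewrite gt_eqF.
    by rewrite lerDr divr_ge0 ?sqr_ge0// mulr_ge0// ltW.
  rewrite ler_pdivlMr ?exprn_gt0//.
  have := le_trans h1 h2; rewrite -(ler_pM2r (mulr_gt0 (ltr0n R 2) kap0 : 0 < 2 * kap)).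
  have -> : (sqn g / (2 * kap) + kap / 2 * sqn y) * (2 * kap) = sqn g + kap ^+ 2 * sqn y.
    by field; rewrite gt_eqF.
  lra.
have gsq : sqn g <= p%:R * (E / Num.sqrt T%:R) ^+ 2.
  rewrite sqnE; apply: (@le_trans _ _ (\sum_(j < p) (E / Num.sqrt T%:R) ^+ 2)).
    apply: ler_sum => j _; rewrite -real_normK ?num_real// lerXn2r ?nnegrE//.
    by rewrite divr_ge0// ltW.
  by rewrite sumr_const card_ord mulr_natl.
have -> : rho T l 0 i - b 0 i = y 0 i by rewrite !mxE.
rewrite -ler_sqr ?nnegrE ?divr_ge0 ?mulr_ge0 ?addr_ge0 ?(ltW sT) ?(ltW kap0)//.
rewrite real_normK ?num_real//; apply: le_trans (sqr_coord_le y i) _.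
apply: le_trans key _; rewrite ler_pdivrMr ?exprn_gt0//.
apply: le_trans gsq _.
have -> : ((p%:R + 1) * E / kap / Num.sqrt T%:R) ^+ 2 * kap ^+ 2 =
  (p%:R + 1) ^+ 2 * (E / Num.sqrt T%:R) ^+ 2 by field; rewrite !gt_eqF.
rewrite ler_wpM2r ?sqr_ge0//.
have : 0 <= p%:R :> R by []; nra.
Qed.

End RidgeAlgebra.

Lemma limn_einf_gt0 {R : realType} (u : nat -> R) :
  (0 < limn_einf (fun n => (u n)%:E))%E ->
  exists2 c : R, 0 < c & \forall n \near \oo, c <= u n.
Proof.
rewrite limn_einf_lim => h.
set v := fun n => (u n)%:E in h *.
have cv := @is_cvg_einfs _ v.
have [c c0 hc] : exists2 c : R, 0 < c & (c%:E < limn (einfs v))%E.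
  move: h; case: (limn (einfs v)) => [l| |]//; last by move=> _; exists 1; rewrite ?ltry.
  by rewrite lte_fin => l0; exists (l / 2); rewrite ?divr_gt0// lte_fin ltr_pdivrMr// ltr_pMr ?ltr1n.
exists c => //.
have : \forall n \near \oo, (c%:E < einfs v n)%E.
  exact: (cv [set y | (c%:E < y)%E] (open_ereal_gt' hc)).
apply: filterS => n hn; rewrite -lee_fin; apply: le_trans (ltW hn) _.
by apply: ereal_inf_lbound; exists n => //=.
Qed.

(** * Second moments of weighted sums of approximable errors *)

Section ApproxMoment.
Context {R : realType} {dT : measure_display} {Omega : measurableType dT}
  (P : probability Omega R) (I : eqType) (G : I -> set (Omega -> R)).
Hypothesis Gm : forall i f, G i f -> measurable_fun setT f.
Hypothesis ind : mutual_indep P G.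

Lemma Ndep_approx_moment (e : nat -> Omega -> R) : (forall t, L2 P (e t)) ->
  Ndep_approx P G e -> exists2 C : R, 0 <= C & forall (b : nat -> R) B T,
    (forall t, `|b t| <= B) ->
    Ex P (fun w => (\sum_(t < T) b t * e t w) ^+ 2) <= C * B ^+ 2 * T%:R.
Proof.
move=> le2 app; have [N [A [xi [Bx [Afar mxi xiB xi0 h]]]]] := app 1 ltr01.
exists (2 + 2 * (N.*2.+1%:R * Bx ^+ 2)).
  by rewrite addr_ge0// mulr_ge0// mulr_ge0 ?ler0n ?sqr_ge0.
move=> b B T bB.
have lxi t : L2 P (xi t).
  by apply: (@L2_bounded _ _ _ _ _ Bx) => //; exact: (fmeas_measurable Gm (@mxi t)).
have lD t : L2 P (fun w => e t w - xi t w) by exact: L2B.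
have -> : (fun w => (\sum_(t < T) b t * e t w) ^+ 2) =
   (fun w => (\sum_(t < T) b t * (e t w - xi t w) + \sum_(t < T) b t * xi t w) ^+ 2).
  apply/funext => w; congr (_ ^+ 2); rewrite -big_split/=; apply: eq_bigr => t _; ring.
apply: le_trans (Ex_sqrD_le _ _) _.
- by apply: L2_sum => t _; exact: L2Z.
- by apply: L2_sum => t _; exact: L2Z.
have h1 := h b B T bB.
have h2 : Ex P (fun w => (\sum_(t < T) b t * xi t w) ^+ 2) <=
    T%:R * N.*2.+1%:R * (B ^+ 2 * Bx ^+ 2).
  apply: (@Ndep_variance _ _ _ P _ G Gm ind A _ Afar xi b B _ T) => // t.
  rewrite -[leRHS](Ex_cst P); apply: Ex_le; [by have [] := lxi t|exact: Int_cst|].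
  move=> w; rewrite -real_normK ?num_real// lerXn2r ?nnegrE//.
  exact: le_trans (xiB t w).
apply: le_trans (lerD (ler_wpM2l _ h1) (ler_wpM2l _ h2)) _ => //.
by rewrite le_eqVlt; apply/orP; left; apply/eqP; ring.
Qed.

End ApproxMoment.

(** * The ridge statistic and its variance in terms of the errors *)

Section RidgeStatistic.
Context {R : realType} {dT : measure_display} {Omega : measurableType dT}
  (P : probability Omega R) (p q d m L : nat)
  (x : nat -> 'cV[R]_p) (s : nat -> 'rV[R]_q) (beta : 'I_d -> 'cV[R]_p)
  (r : 'I_L -> 'rV[R]_q) (dist : 'rV[R]_q -> 'rV[R]_q -> R)
  (phi : 'I_d -> 'I_L -> R) (C : 'I_L.+1 -> nat -> 'M[R]_d)
  (inn : 'I_L.+1 -> int -> Omega -> 'cV[R]_d) (H : 'I_d -> 'M[R]_(d, m.+1) -> R)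
  (Sx : 'M[R]_p) (nu : 'I_d).
Hypothesis hR : assumption_R x Sx.

Let e t w := err P s r dist phi C inn H nu t w.

(** Writing [beta nu] as the inverse applied to [(gram + l) beta nu] splits the estimation error
    into a noise part and the regularisation bias, proportional to [l]. *)
Lemma ridge_linear (a : 'cV[R]_p) T l w : (0 < T)%N -> (p <= T)%N -> 0 <= l ->
  (a^T *m (Num.sqrt T%:R *:
     (ridge P x s beta r dist phi C inn H l T nu w - beta nu))) 0 0 =
  (Num.sqrt T%:R)^-1 * (\sum_i rho x a T l 0 i * (\sum_(t < T) x t i 0 * e t w)
     - l * \sum_i rho x a T l 0 i * beta nu i 0).
Proof.
move=> T0 pT l0.
have TR : 0 < T%:R :> R by rewrite ltr0n.
have sT : 0 < Num.sqrt (T%:R : R) by rewrite sqrtr_gt0.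
have uG := gram_unit hR T0 pT l0.
pose ev : 'cV[R]_T := \col_(t < T) e t w.
have YE : YT P x s beta r dist phi C inn H T nu w = XT x T *m beta nu + ev.
  apply/colP => t; rewrite !mxE; congr (_ + _).
  by apply: eq_bigr => i _; rewrite !mxE.
have dE : ridge P x s beta r dist phi C inn H l T nu w - beta nu =
    invmx (gram x T + l%:M) *m ((XT x T)^T *m ev - l *: beta nu).
  rewrite /ridge YE -/(gram x T) -mulmxA mulmxDr mulmxA -/(gram x T).
  have {2}-> : beta nu = invmx (gram x T + l%:M) *m ((gram x T + l%:M) *m beta nu).
    by rewrite mulmxA mulVmx// mul1mx.
  rewrite -mulmxBr; congr (_ *m _); rewrite mulmxDl mul_scalar_mx.
  by rewrite opprD addrA [gram x T *m beta nu + _]addrC addrK.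
rewrite dE -scalemxAr mulmxA.
have -> : a^T *m invmx (gram x T + l%:M) = T%:R^-1 *: rho x a T l.
  by rewrite /rho scalerA mulVf ?scale1r// gt_eqF.
rewrite -scalemxAl scalerA mulmxBr -scalemxAr.
have -> : Num.sqrt T%:R * T%:R^-1 = (Num.sqrt T%:R)^-1 :> R.
  have s2 : Num.sqrt (T%:R : R) ^+ 2 = T%:R by rewrite sqr_sqrtr// ltW.
  by rewrite -[X in _ * X^-1]s2 expr2 invfM mulVKf// gt_eqF.
rewrite [LHS]mxE; congr (_ * _); rewrite [LHS]mxE; congr (_ + _).
  rewrite mxE; apply: eq_bigr => i _; congr (_ * _); rewrite mxE.
  by apply: eq_bigr => t _; rewrite !mxE.
by rewrite [LHS]mxE [in LHS]mxE; congr (- (_ * _)); rewrite mxE.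
Qed.

(** The variance in the normalisation is exactly the second moment of the linear statistic with
    weights [b *m x t], divided by [T]. This is why the normalised linear statistic has variance 1
    for each large [T], and not just in the limit. *)
Lemma ridge_variance (a : 'cV[R]_p) T :
  (forall t, L2 P (e t)) -> (forall t, Ex P (e t) = 0) ->
  let b := a^T *m invmx Sx in
  (a^T *m (invmx Sx *m Gamma P x s r dist phi C inn H T nu *m invmx Sx) *m a) 0 0 =
  bform (Gamma P x s r dist phi C inn H T nu) b b /\
  bform (Gamma P x s r dist phi C inn H T nu) b b =
  T%:R^-1 * Ex P (fun w => (\sum_(t < T) (b *m x t) 0 0 * e t w) ^+ 2).
Proof.
move=> le2 e0 b.
have bT : b^T = invmx Sx *m a by rewrite /b trmx_mul trmxK (tr_invSx hR).
split; first by rewrite /bform bT !mulmxA.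
have covE t1 t2 : fine (covariance P (err P s r dist phi C inn H nu t1)
      (err P s r dist phi C inn H nu t2)) = Ex P (fun w => e t1 w * e t2 w).
  rewrite unlock fine_expectation !fine_expectation; congr Ex; apply/funext => w /=.
  by rewrite !e0 mulrfctE /= !subr0.
have iee t1 t2 : Int P (fun w => e t1 w * e t2 w) by exact: Int_L2M.
rewrite /Gamma bformZm; congr (_ * _).
have -> : (fun w => (\sum_(t < T) (b *m x t) 0 0 * e t w) ^+ 2) =
    (fun w => \sum_(t1 < T) \sum_(t2 < T) (b *m x t1) 0 0 * (b *m x t2) 0 0 * (e t1 w * e t2 w)).
  apply/funext => w; rewrite expr2 big_distrlr/=; apply: eq_bigr => t1 _.
  by apply: eq_bigr => t2 _; ring.
rewrite Ex_sum => [|t1 _]; last by apply: Int_sum => t2 _; exact: IntZ.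
rewrite /bform mulmx_sumr mulmx_suml summxE; apply: eq_bigr => t1 _.
rewrite Ex_sum => [|t2 _]; last exact: IntZ.
rewrite mulmx_sumr mulmx_suml summxE; apply: eq_bigr => t2 _.
rewrite ExZ// covE -scalemxAr -scalemxAl mxE mulrC; congr (_ * _).
have -> : b *m (x t1 *m (x t2)^T) *m b^T = (b *m x t1) *m (b *m x t2)^T.
  by rewrite [(b *m x t2)^T]trmx_mul !mulmxA.
by rewrite mxE big_ord1 [X in _ * X]mxE.
Qed.

Lemma tr_Gamma T : (Gamma P x s r dist phi C inn H T nu)^T =
  Gamma P x s r dist phi C inn H T nu.
Proof.
rewrite /Gamma linearZ/=; congr (_ *: _); rewrite linear_sum/=.
rewrite [RHS]exchange_big/=; apply: eq_bigr => t1 _; rewrite linear_sum/=.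
apply: eq_bigr => t2 _; rewrite linearZ/= trmx_mul trmxK.
by rewrite covarianceC.
Qed.

End RidgeStatistic.

(** * Asymptotic normality with a random regularisation parameter *)

Section RidgeNormality.
Context {R : realType} {dT : measure_display} {Omega : measurableType dT}
  (P : probability Omega R) (p q d m L : nat)
  (x : nat -> 'cV[R]_p) (s : nat -> 'rV[R]_q) (beta : 'I_d -> 'cV[R]_p)
  (r : 'I_L -> 'rV[R]_q) (dist : 'rV[R]_q -> 'rV[R]_q -> R)
  (phi : 'I_d -> 'I_L -> R) (C : 'I_L.+1 -> nat -> 'M[R]_d)
  (inn : 'I_L.+1 -> int -> Omega -> 'cV[R]_d) (H : 'I_d -> 'M[R]_(d, m.+1) -> R)
  (Sx : 'M[R]_p) (Sig : 'I_L.+1 -> int -> 'M[R]_d) (delta : R).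
Hypothesis hR : assumption_R x Sx.
Hypothesis sp : spatial_setting s r dist.
Hypothesis delta0 : 0 < delta.
Hypothesis hE1 : E1 P inn Sig.
Hypothesis hE2 : E2 P inn delta.
Hypothesis hE6 : E6 C.
Hypothesis hE7 : E7 P r dist phi C inn H delta.
Variable nu : 'I_d.
Hypothesis hG : Gamma_eig_cond P x s r dist phi C inn H nu.
Variable lam : nat -> Omega -> R.
Hypothesis lam0 : forall T w, 0 <= lam T w.
Hypothesis mlam : forall T, measurable_fun setT (lam T).
Hypothesis lam_cvg : ((fun T => 'E_P[(fun w => lam T w ^+ 2)%R]) @ \oo --> 0)%E.

Let e t w := err P s r dist phi C inn H nu t w.
Let le2 : forall t, L2 P (e t).
Proof. by have [] := err_L2_approx sp delta0 hE1 hE2 hE6 hE7 nu. Qed.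
Let e0 : forall t, Ex P (e t) = 0.
Proof. by have [] := err_L2_approx sp delta0 hE1 hE2 hE6 hE7 nu. Qed.
Let eapp : Ndep_approx P (inn_fam inn) e.
Proof. by have [] := err_L2_approx sp delta0 hE1 hE2 hE6 hE7 nu. Qed.

Let Gm i f : inn_fam inn i f -> measurable_fun setT f.
Proof. by move=> [nu' ->]; exact: (inn_measurable hE1). Qed.

(** Convergence of the extended expectations to a finite limit makes them finite for large [T],
    hence the squares integrable from then on. *)
Let lam_sqr : (\forall T \near \oo, Int P (fun w => lam T w ^+ 2)) /\
  (fun T => Ex P (fun w => lam T w ^+ 2)) @ \oo --> (0 : R).
Proof.
have /fine_cvgP[hf hc] := lam_cvg; split.
  apply: filterS hf => T /fineK hT.
  have hle : ('E_P[(fun w => lam T w ^+ 2)%R] <=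
    (fine 'E_P[(fun w => lam T w ^+ 2)%R])%:E)%E by rewrite hT.
  have mX : measurable_fun setT (fun w => lam T w ^+ 2) by exact: measurable_funX.
  by have [] := expectation_ge0_Int mX (fun w => sqr_ge0 _) hle.
have -> : (fun T => Ex P (fun w => lam T w ^+ 2)) =
    fine \o (fun T => 'E_P[(fun w => lam T w ^+ 2)%R])%E.
  by apply/funext => T /=; rewrite fine_expectation.
exact: hc.
Qed.

Let Gam T := Gamma P x s r dist phi C inn H T nu.

Section Direction.
Variable a : 'cV[R]_p.
Let b : 'rV[R]_p := a^T *m invmx Sx.
Hypothesis bn0 : b != 0.
Let bt t : R := (b *m x t) 0 0.
Let s2 T : R := bform (Gam T) b b.
Let u T : R := (Num.sqrt T%:R)^-1 / Num.sqrt (s2 T).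
(** What remains of [Z] when [rho] is replaced by its limit [b] and the bias is dropped. *)
Let W T w := u T * \sum_(t < T) bt t * e t w.
Let S i T w : R := \sum_(t < T) x t i 0 * e t w.
Let Z T w : R := ((a^T *m (Num.sqrt T%:R *:
     (ridge P x s beta r dist phi C inn H (lam T w) T nu w - beta nu))) 0 0
   - (a^T *m (0 : 'cV[R]_p)) 0 0) /
   Num.sqrt ((a^T *m (invmx Sx *m Gam T *m invmx Sx) *m a) 0 0).

Let s2_lb : exists2 c : R, 0 < c & \forall T \near \oo, c <= s2 T.
Proof.
have [h _] := hG; have [c0 c00 hc0] := limn_einf_gt0 h.
exists (c0 * sqn b); first by rewrite mulr_gt0// sqn_gt0.
apply: filterS hc0 => T hT; apply: le_trans (sym_lmin_lb b (tr_Gamma _ _ _ _ _ _ _ _ _ _ _)).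
by rewrite ler_wpM2r// sqn_ge0.
Qed.

Let s2E T : s2 T = T%:R^-1 * Ex P (fun w => (\sum_(t < T) bt t * e t w) ^+ 2).
Proof. by have [_] := ridge_variance hR a T le2 e0. Qed.

Let x_bound : exists2 Bx : R, 0 <= Bx & forall t i, `|x t i 0| <= Bx.
Proof.
have [[B hB] _] := hR; exists `|B| => // t i.
exact: le_trans (hB t i) (ler_norm _).
Qed.

Let bt_bound : exists B : R, forall t, `|bt t| <= B.
Proof.
have [Bx _ hB] := x_bound; exists (\sum_i `|b 0 i| * Bx) => t.
rewrite /bt mxE; apply: le_trans (ler_norm_sum _ _ _) _; apply: ler_sum => i _.
by rewrite normrM ler_wpM2l.
Qed.

Let btS T w : \sum_(t < T) bt t * e t w = \sum_i b 0 i * S i T w.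
Proof.
under eq_bigr do rewrite /bt mxE mulr_suml.
rewrite exchange_big/=; apply: eq_bigr => i _; rewrite mulr_sumr.
by apply: eq_bigr => t _; rewrite mulrA.
Qed.

Let ZE T w : (0 < T)%N -> (p <= T)%N ->
  Z T w = (Num.sqrt T%:R)^-1 * (\sum_i rho x a T (lam T w) 0 i * S i T w
     - lam T w * \sum_i rho x a T (lam T w) 0 i * beta nu i 0) / Num.sqrt (s2 T).
Proof.
move=> T0 pT; rewrite /Z mulmx0 [X in _ - X]mxE subr0.
rewrite (ridge_linear _ _ _ _ _ _ _ _ _ _ hR)//.
by have [-> _] := ridge_variance hR a T le2 e0.
Qed.

Let mS i T : measurable_fun setT (S i T).
Proof.
by apply: measurable_sum => t; apply: measurable_funM => //; have [] := le2 t.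
Qed.

Let mZ : \forall T \near \oo, measurable_fun setT (Z T).
Proof.
near=> T.
have T0 : (0 < T)%N by near: T; exact: nbhs_infty_gt.
have pT : (p <= T)%N by near: T; exact: nbhs_infty_ge.
rewrite (funext (fun w => @ZE T w T0 pT)).
have mr i : measurable_fun setT (fun w => rho x a T (lam T w) 0 i).
  rewrite /rho; under eq_fun do rewrite !mxE.
  apply: measurable_funM => //; apply: measurable_sum => j; apply: measurable_funM => //.
  apply: measurable_invmx => [k l|w]; last exact: (gram_unit hR).
  under eq_fun do rewrite !mxE.
  apply: measurable_funD => //.
  case: (k == l) => /=; first by under eq_fun do rewrite mulr1n; exact: mlam.
  by under eq_fun do rewrite mulr0n; exact: measurable_cst.
apply: measurable_funM => //; apply: measurable_funM => //.
apply: measurable_funB.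
  by apply: measurable_sum => i; apply: measurable_funM.
apply: measurable_funM; first exact: mlam.
by apply: measurable_sum => i; apply: measurable_funM.
Unshelve. all: by end_near. Qed.

(** Where [lam T w <= 1], the difference is at most [Y], whose second moment is at most [K3 / T];
    where [lam T w > 1], the indicator is at most [lam T w ^+ 2]. One pointwise bound thus combines
    both Markov inequalities. *)
Let ZW (eps : R) : 0 < eps ->
  (fun T => fine (P [set w | eps < `|Z T w - W T w|])) @ \oo --> (0 : R).
Proof.
move=> eps0.
have [c c0 hc] := s2_lb.
have [Cy Cy0 hCy] := rho_diff hR a.
have [Bx Bx0 hBx] := x_bound.
have [Cm Cm0 hCm] := Ndep_approx_moment Gm (inn_indep hE1) le2 eapp.
have [il cl] := lam_sqr.
(* Bounds the bias sum, since [rho] differs from [b] by at most [Cy] when [T >= 1]. *)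
pose K2 := \sum_i (`|b 0 i| + Cy) * `|beta nu i 0|.
have K20 : 0 <= K2 by apply: sumr_ge0 => i _; rewrite mulr_ge0// addr_ge0.
pose q0 := (Num.sqrt c)^-1.
have q00 : 0 < q0 by rewrite invr_gt0 sqrtr_gt0.
pose Y T w := q0 * (Num.sqrt T%:R)^-1 * (Cy / Num.sqrt T%:R * (\sum_i `|S i T w|) + K2).
have lS i T : L2 P (S i T) by apply: L2_sum => t _; exact: L2Z.
have lS1 T : L2 P (fun w => \sum_i `|S i T w|) by apply: L2_sum => i _; exact: L2_norm.
have lY T : L2 P (Y T) by apply: L2Z; apply: L2D; [exact: L2Z|exact: L2_cst].
pose K3 := q0 ^+ 2 * (2 * (Cy ^+ 2 * (p%:R ^+ 2 * (Cm * Bx ^+ 2))) + 2 * K2 ^+ 2).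
have EY T : (0 < T)%N -> Ex P (fun w => Y T w ^+ 2) <= K3 / T%:R.
  move=> T0; have TR : 0 < T%:R :> R by rewrite ltr0n.
  have sT : 0 < Num.sqrt (T%:R : R) by rewrite sqrtr_gt0.
  have sT2 : Num.sqrt (T%:R : R) ^+ 2 = T%:R by rewrite sqr_sqrtr// ltW.
  have -> : (fun w => Y T w ^+ 2) = (fun w => (q0 ^+ 2 / T%:R) *
      (Cy / Num.sqrt T%:R * (\sum_i `|S i T w|) + K2) ^+ 2).
    by apply/funext => w; rewrite /Y !exprMn [(Num.sqrt T%:R)^-1 ^+ 2]exprVn sT2.
  rewrite ExZ; last first.
    by have [] := L2D (L2Z (Cy / Num.sqrt T%:R) (lS1 T)) (L2_cst P K2).
  rewrite /K3 [leRHS]mulrAC; apply: ler_wpM2l; first by rewrite divr_ge0 ?sqr_ge0// ltW.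
  apply: le_trans (Ex_sqrD_le (L2Z _ (lS1 T)) (L2_cst P K2)) _.
  rewrite Ex_cst lerD2r ler_wpM2l//.
  under eq_fun do rewrite exprMn.
  rewrite ExZ; last by have [] := lS1 T.
  rewrite exprMn [(Num.sqrt T%:R)^-1 ^+ 2]exprVn sT2 -mulrA ler_wpM2l ?sqr_ge0// ler_pdivrMl//.
  apply: le_trans (@Ex_sqr_sum _ _ _ P p (fun i w => `|S i T w|) (Cm * Bx ^+ 2 * T%:R) _ _) _.
  - by move=> i; exact: L2_norm.
  - move=> i; under eq_fun do rewrite real_normK ?num_real//.
    by apply: (hCm (fun t => x t i 0)).
  by rewrite le_eqVlt; apply/orP; left; apply/eqP; ring.
have K30 : 0 <= K3.
  rewrite mulr_ge0 ?sqr_ge0// addr_ge0// mulr_ge0 ?sqr_ge0// mulr_ge0 ?sqr_ge0//.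
  by rewrite mulr_ge0 ?sqr_ge0// mulr_ge0 ?sqr_ge0.
apply/cvgrPdist_le => h h0.
have clh : \forall T \near \oo, `|0 - Ex P (fun w => lam T w ^+ 2)| <= h / 2.
  by move/cvgrPdist_le: cl; apply; rewrite divr_gt0.
near=> T.
have T0 : (0 < T)%N by near: T; exact: nbhs_infty_gt.
have pT : (p <= T)%N by near: T; exact: nbhs_infty_ge.
have TR : 0 < T%:R :> R by rewrite ltr0n.
have sT : 0 < Num.sqrt (T%:R : R) by rewrite sqrtr_gt0.
have sT1 : 1 <= Num.sqrt (T%:R : R) by rewrite -{1}sqrtr1 ler_sqrt ?ler1n.
have cT : c <= s2 T by near: T.
have iT : Int P (fun w => lam T w ^+ 2) by near: T.
have mZT : measurable_fun setT (Z T) by near: T; exact: mZ.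
have lT : Ex P (fun w => lam T w ^+ 2) <= h / 2.
  have : `|0 - Ex P (fun w => lam T w ^+ 2)| <= h / 2 by near: T; exact: clh.
  by rewrite sub0r normrN; exact: le_trans (ler_norm _).
have KT : K3 / eps ^+ 2 / T%:R <= h / 2.
  rewrite ler_pdivrMr// [leRHS]mulrC -ler_pdivrMr ?divr_gt0//.
  by near: T; exact: nbhs_infty_ger.
have q0T : (Num.sqrt (s2 T))^-1 <= q0.
  by rewrite lef_pV2 ?posrE ?sqrtr_gt0 ?(lt_le_trans c0 cT)// ler_sqrt// (le_trans (ltW c0)).
have diff w : lam T w <= 1 -> `|Z T w - W T w| <= Y T w.
  move=> l1; rewrite ZE// /W /u btS.
  have -> : (Num.sqrt T%:R)^-1 * (\sum_i rho x a T (lam T w) 0 i * S i T w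
     - lam T w * \sum_i rho x a T (lam T w) 0 i * beta nu i 0) / Num.sqrt (s2 T)
     - (Num.sqrt T%:R)^-1 / Num.sqrt (s2 T) * (\sum_i b 0 i * S i T w) =
     (Num.sqrt (s2 T))^-1 * (Num.sqrt T%:R)^-1 *
      (\sum_i (rho x a T (lam T w) 0 i - b 0 i) * S i T w
       - lam T w * \sum_i rho x a T (lam T w) 0 i * beta nu i 0).
    under [X in _ = _ * _ * (X - _)]eq_bigr do rewrite mulrBl.
    by rewrite sumrB; ring.
  rewrite normrM; apply: ler_pM => //.
    rewrite normrM (gtr0_norm (x := (Num.sqrt T%:R)^-1)) ?invr_gt0//.
    by rewrite ler_wpM2r ?invr_ge0 ?(ltW sT)// ger0_norm// invr_ge0 sqrtr_ge0.
  apply: le_trans (ler_normB _ _) _; apply: lerD.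
    apply: le_trans (ler_norm_sum _ _ _) _; rewrite mulr_sumr; apply: ler_sum => i _.
    by rewrite normrM ler_wpM2r//; exact: hCy.
  rewrite normrM ger0_norm//.
  apply: (@le_trans _ _ (`|\sum_i rho x a T (lam T w) 0 i * beta nu i 0|)).
    by rewrite ler_piMl.
  apply: le_trans (ler_norm_sum _ _ _) _; apply: ler_sum => i _.
  rewrite normrM ler_wpM2r//.
  have -> : rho x a T (lam T w) 0 i = b 0 i + (rho x a T (lam T w) 0 i - b 0 i) by ring.
  apply: le_trans (ler_normD _ _) _; rewrite lerD2l.
  apply: le_trans (hCy T (lam T w) T0 pT (lam0 T w) l1 i) _.
  by rewrite ler_pdivrMr// ler_peMr.
have lW : L2 P (W T) by apply: L2Z; apply: L2_sum => t _; exact: L2Z.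
have mE : measurable [set w | eps < `|Z T w - W T w|].
  apply: (@measurable_gt_set _ _ _ (fun w => `|Z T w - W T w|)).
  by apply: measurableT_comp => //; apply: measurable_funB => //; have [] := lW.
have iY : Int P (fun w => Y T w ^+ 2) by have [] := lY T.
rewrite sub0r normrN -(Ex_indic P mE) ger0_norm; last by apply: Ex_ge0 => w.
apply: (@le_trans _ _ (Ex P (fun w => lam T w ^+ 2 + eps ^- 2 * Y T w ^+ 2))).
  apply: Ex_le; [exact: Int_indic|by apply: IntD => //; exact: IntZ|].
  move=> w; rewrite indic_bool.
  have [we|we] := ltP eps; last first.
    by rewrite addr_ge0 ?sqr_ge0// mulr_ge0 ?sqr_ge0// invr_ge0 sqr_ge0.
  have [l1|l1] := leP (lam T w) 1; last first.
    rewrite -[leLHS]addr0 lerD//; last by rewrite mulr_ge0 ?sqr_ge0// invr_ge0 sqr_ge0.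
    by rewrite expr_ge1// ltW.
  rewrite -[leLHS]add0r lerD ?sqr_ge0// ler_pdivlMl ?exprn_gt0// mulr1.
  by rewrite lerXn2r ?nnegrE ?(ltW eps0)//; [apply: le_trans (diff w l1)|apply: le_trans (ltW we) (diff w l1)].
rewrite ExD//; last exact: IntZ.
rewrite ExZ// [leRHS]splitr; apply: lerD => //.
apply: le_trans KT.
have -> : K3 / eps ^+ 2 / T%:R = eps ^- 2 * (K3 / T%:R) by rewrite mulrAC mulrC.
by rewrite ler_wpM2l ?invr_ge0 ?sqr_ge0// EY.
Unshelve. all: by end_near. Qed.

Lemma ridge_cvg_dist : cvg_dist_std_normal P Z.
Proof.
have [c c0 hc] := s2_lb; have [B hB] := bt_bound.
have W1 : \forall T \near \oo, Ex P (fun w => W T w ^+ 2) = 1.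
  near=> T.
  have TR : 0 < T%:R :> R by rewrite ltr0n; near: T; exact: nbhs_infty_gt.
  have cT : c <= s2 T by near: T.
  have s20 : 0 < s2 T by apply: lt_le_trans cT.
  have E2 : Ex P (fun w => (\sum_(t < T) bt t * e t w) ^+ 2) = T%:R * s2 T.
    by rewrite s2E mulVKf// gt_eqF.
  rewrite /W; under eq_fun do rewrite exprMn.
  rewrite ExZ; last first.
    suff [] : L2 P (fun w => \sum_(t < T) bt t * e t w) by [].
    by apply: L2_sum => t _; exact: L2Z.
  rewrite E2 /u exprMn !exprVn !sqr_sqrtr ?(ltW TR) ?(ltW s20)//.
  by field; rewrite !gt_eqF.
(* The left side is the inverse of [s2 T], at most [c^-1]; [1 + c^-1] replaces its square root. *)
have uk : \forall T \near \oo, u T ^+ 2 * T%:R <= (1 + c^-1) ^+ 2.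
  near=> T.
  have TR : 0 < T%:R :> R by rewrite ltr0n; near: T; exact: nbhs_infty_gt.
  have cT : c <= s2 T by near: T.
  have s20 : 0 < s2 T by apply: lt_le_trans cT.
  have -> : u T ^+ 2 * T%:R = (s2 T)^-1.
    rewrite /u exprMn !exprVn !sqr_sqrtr ?(ltW TR) ?(ltW s20)//.
    by field; rewrite !gt_eqF.
  apply: (@le_trans _ _ c^-1); first by rewrite lef_pV2 ?posrE.
  have : 0 < c^-1 by rewrite invr_gt0.
  nra.
have k0 : 0 <= 1 + c^-1 by rewrite addr_ge0// invr_ge0 ltW.
apply: (stein_cvg_dist (W := W)).
- by move=> T; apply: L2Z; apply: L2_sum => t _; exact: L2Z.
- exact: mZ.
- move=> f g K tfg fK gK.
  exact: (stein_cvg Gm (inn_indep hE1) le2 eapp hB W1 uk k0 tfg fK gK).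
- exact: ZW.
Unshelve. all: by end_near. Qed.

End Direction.

(** Positivity of the variance in direction [a] at a single time already forces [b != 0]; the lower
    bound on the eigenvalues of [Gamma] then keeps the variance away from 0. *)
Lemma ridge_asymp_normal :
  asymp_normal P
    (fun T w => Num.sqrt T%:R *:
      (ridge P x s beta r dist phi C inn H (lam T w) T nu w - beta nu))
    (fun _ => 0) (fun T => invmx Sx *m Gam T *m invmx Sx).
Proof.
move=> a [n _ apos]; apply: ridge_cvg_dist.
apply: contraPneq (apos n (leqnn n)) => b0 /=.
have [-> _] := ridge_variance hR a n le2 e0.
by rewrite b0 /bform !mul0mx mxE ltxx.
Qed.

End RidgeNormality.

Theorem theorem8 (R : realType) (dT : measure_display) (Omega : measurableType dT)
  (P : probability Omega R) (p q d m L : nat)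
  (x : nat -> 'cV[R]_p) (s : nat -> 'rV[R]_q) (beta : 'I_d -> 'cV[R]_p)
  (r : 'I_L -> 'rV[R]_q) (dist : 'rV[R]_q -> 'rV[R]_q -> R)
  (phi : 'I_d -> 'I_L -> R) (C : 'I_L.+1 -> nat -> 'M[R]_d)
  (inn : 'I_L.+1 -> int -> Omega -> 'cV[R]_d) (H : 'I_d -> 'M[R]_(d, m.+1) -> R)
  (Sx : 'M[R]_p) (Sig : 'I_L.+1 -> int -> 'M[R]_d) (delta : R) :
  assumption_R x Sx ->
  spatial_setting s r dist ->
  0 < delta ->
  E1 P inn Sig -> E2 P inn delta -> E3 P inn -> E4 P inn Sig -> E5 P inn -> E6 C ->
  E7 P r dist phi C inn H delta ->
  bounded_idio_var P inn ->
  (forall nu, Gamma_eig_cond P x s r dist phi C inn H nu) ->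
  (* (i) non-random regularization parameter *)
  (forall lam : nat -> R,
     (forall T, 0 <= lam T) -> lam @ \oo --> 0 ->
     forall nu : 'I_d,
       asymp_normal P
         (fun T w => Num.sqrt T%:R *:
             (ridge P x s beta r dist phi C inn H (lam T) T nu w - beta nu))
         (fun _ => 0)
         (fun T => invmx Sx *m Gamma P x s r dist phi C inn H T nu *m invmx Sx))
  /\
  (* (ii) random regularization parameter *)
  (forall lam : nat -> Omega -> R,
     (forall T w, 0 <= lam T w) -> (forall T, measurable_fun setT (lam T)) ->
     ((fun T => 'E_P[(fun w => lam T w ^+ 2)%R]) @ \oo --> 0)%E ->
     forall nu : 'I_d,
       asymp_normal P
         (fun T w => Num.sqrt T%:R *:
             (ridge P x s beta r dist phi C inn H (lam T w) T nu w - beta nu))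
         (fun _ => 0)
         (fun T => invmx Sx *m Gamma P x s r dist phi C inn H T nu *m invmx Sx)).
Proof.
move=> hR sp delta0 hE1 hE2 _ _ _ hE6 hE7 _ hG.
have ii (lam : nat -> Omega -> R) (lam0 : forall T w, 0 <= lam T w)
    (mlam : forall T, measurable_fun setT (lam T))
    (lamE : ((fun T => 'E_P[(fun w => lam T w ^+ 2)%R]) @ \oo --> 0)%E) nu :=
  ridge_asymp_normal beta hR sp delta0 hE1 hE2 hE6 hE7 (hG nu) lam0 mlam lamE.
split; last exact: ii.
move=> lam lam0 lamc nu; apply: (ii (fun T _ => lam T)) => //.
have -> : (fun T => 'E_P[(fun=> lam T ^+ 2)%R])%E = (fun T => (lam T ^+ 2)%:E).
  by apply/funext => T; exact: expectation_cst.
apply: cvg_EFin; first exact: nearW.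
rewrite -(mulr0 (0 : R)); under eq_fun do rewrite expr2.
exact: cvgM.
Qed.
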